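(* Let $G=\mathbb{T}\times\mathbb{R}^n\times V\times H$ be a translation complete subgroup of $G_{aWH}$, and let $\mathcal{H}_U$ be a $G$-invariant closed subspace of $L^2(\mathbb{R}^n)$, where $U\subset\widehat{\mathbb{R}^n}$ is a $V\rtimes H^T$-invariant Borel set. For $\psi\in\mathcal{H}_U$ put $$\Phi_\psi(\omega)=\int_V\int_H|\widehat\psi(h^T(\omega-\xi))|^2\,|\det(h^T|_V)|\,dh\,d\xi .$$ Then $\psi$ is weakly admissible for $\mathcal{H}_U$ if and only if there is a constant $C_\psi>0$ such that $0<\Phi_\psi(\omega)<C_\psi$ for a.e. $\omega\in U$. Furthermore, $\psi$ is admissible for $\mathcal{H}_U$ if and only if there is a constant $C_\psi>0$ such that $\Phi_\psi(\omega)=C_\psi$ for a.e. $\omega\in U$.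
   Context: The dual group $\widehat{\mathbb{R}^n}$ is identified with $\mathbb{R}^n$ (column vectors) by associating to $\xi$ the character $x\mapsto e^{2\pi i\langle x,\xi\rangle}$; $\widehat f$ denotes the Fourier--Plancherel transform, $\widehat f(\gamma)=\int f(x)e^{-2\pi i\langle\gamma,x\rangle}dx$. The affine Weyl-Heisenberg group is $G_{aWH}=\mathbb{T}\times\mathbb{R}^n\times\widehat{\mathbb{R}^n}\times\mathrm{GL}(n,\mathbb{R})$ with the product topology and group law $(z_1,x_1,\xi_1,h_1)(z_2,x_2,\xi_2,h_2)=(z_1z_2e^{2\pi i\langle\xi_1,h_1x_2\rangle},\,x_1+h_1x_2,\,\xi_1+h_1^{-T}\xi_2,\,h_1h_2)$, where $h^{-T}=(h^{-1})^T$. Its quasi-regular representation on $L^2(\mathbb{R}^n)$ is $\pi(z,x,\xi,h)=zT_xM_\xi D_h$, where $T_xf(y)=f(y-x)$, $M_\xi f(y)=e^{2\pi i\langle y,\xi\rangle}f(y)$, $D_hf(y)=|\det h|^{-1/2}f(h^{-1}y)$. A translation complete subgroup is a subgroup of the form $G=\mathbb{T}\times\mathbb{R}^n\times V\times H$, where $V\subset\widehat{\mathbb{R}^n}$ is a linear subspace, $H$ is a closed subgroup of $\mathrm{GL}(n,\mathbb{R})$, and $h^TV\subset V$ for all $h\in H$. Its left Haar measure is $|\det(h^T|_V)|\,dz\,dx\,d\xi\,\frac{dh}{|\det h|}$ ($dz$ normalized on $\mathbb{T}$, $dx,d\xi$ Lebesgue measures, $dh$ left Haar measure on $H$). The group $V\rtimes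 H^T$ is the set $V\times H$ with law $(\xi_1,h_1)(\xi_2,h_2)=(\xi_1+h_1^{-T}\xi_2,h_1h_2)$; it acts on $\widehat{\mathbb{R}^n}$ from the right by the dual action $\gamma.(\xi,h)=h^T(\gamma-\xi)$. For a Borel set $U\subset\widehat{\mathbb{R}^n}$, $\mathcal{H}_U=\{f\in L^2(\mathbb{R}^n):\widehat f=0\text{ a.e. outside }U\}$. The generalized wavelet transform is $V_\psi f(\mathbf{x})=\langle f,\pi(\mathbf{x})\psi\rangle$, $\mathbf{x}\in G$. A vector $\psi\in\mathcal{H}_U$ is weakly admissible for $\mathcal{H}_U$ if $V_\psi:\mathcal{H}_U\to L^2(G)$ is a bounded injective operator, and admissible for $\mathcal{H}_U$ if $V_\psi:\mathcal{H}_U\to L^2(G)$ is a nontrivial (nonzero) scalar multiple of an isometry. *)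

(* Defs.v *)
From HB Require Import structures.
From mathcomp Require Import all_boot all_order all_algebra.
From mathcomp Require Import all_classical all_reals all_analysis.
From mathcomp Require Import measurable_realfun complex.

Set Implicit Arguments.
Unset Strict Implicit.
Unset Printing Implicit Defensive.

Import Order.TTheory GRing.Theory Num.Theory.
Import numFieldNormedType.Exports.

Local Open Scope classical_set_scope.
Local Open Scope ring_scope.
Local Open Scope complex_scope.

(* Matrices with the Borel sigma-algebra of their usual topology. *)
Definition bmx (R : realType) (m n : nat) : Type :=
  g_sigma_algebraType (@open 'M[R]_(m, n)).
HB.instance Definition _ (R : realType) (m n : nat) := Measurable.on (bmx R m n).

Notation bvec R n := (bmx R n 1).

Section borel_matrix.
Context {R : realType} {m n : nat}.

Lemma measurable_coord (i : 'I_m) (j : 'I_n) :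
  measurable_fun setT (fun A : bmx R m n => (A i j : R)).
Proof.
apply: (measurability _ (RGenOpens.measurableE R)).
move=> _ [_ [a [b ->] <-]]; rewrite setTI; apply: sub_sigma_algebra.
have /continuousP := @coord_continuous R m n i j.
by apply; exact: interval_open.
Qed.

Lemma open_mx_rat (O : set 'M[R]_(m, n)) : open O -> forall A, O A ->
  exists c : 'M[rat]_(m, n) * rat,
    (forall i j, ball (ratr (c.1 i j) : R) (ratr c.2) (A i j)) /\
    (forall B : 'M[R]_(m, n),
      (forall i j, ball (ratr (c.1 i j) : R) (ratr c.2) (B i j)) -> O B).
Proof.
move=> oO A OA.
have /nbhs_ballP [e /= e0 eO] : nbhs A O by exact: open_nbhs_nbhs.
have /rat_in_itvoo[r] : 0 < e / 2 by rewrite divr_gt0.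
rewrite in_itv /= => /andP[r0 re].
have hc i j : exists q : rat, ball (A i j) (ratr r) (ratr q : R).
  have /rat_in_itvoo[q] : A i j - ratr r < A i j + ratr r.
    by rewrite ltrD2l gt0_cp.
  rewrite in_itv /= => /andP[q1 q2]; exists q.
  by rewrite /ball /= ltr_distlC q1.
pose c : 'M[rat]_(m, n) := \matrix_(i, j) sval (cid (hc i j)).
exists (c, r); split => /= [i j|B AB].
  by rewrite mxE; case: cid => q /= /ball_sym.
apply: eO; split => // i j.
have re2 : ratr r <= e / 2 by exact: ltW.
apply: (@ball_split R R (ratr (c i j) : R)); last exact: le_ball (AB i j).
by apply: (le_ball re2); rewrite mxE; case: cid.
Qed.

Lemma measurable_fun_borel_mx d (T : measurableType d) (D : set T)
    (f : T -> bmx R m n) : measurable D ->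
  (forall i j, measurable_fun D (fun x => f x i j : R)) -> measurable_fun D f.
Proof.
move=> mD mf; apply: (@measurability _ _ _ (bmx R m n) D f (@open 'M[R]_(m, n)) erefl).
move=> _ [W oO <-].
pose K := fun (c : 'M[rat]_(m, n) * rat) (B : 'M[R]_(m, n)) =>
  forall i j, ball (ratr (c.1 i j) : R) (ratr c.2) (B i j).
pose F (c : 'M[rat]_(m, n) * rat) : set T :=
  if `[< K c `<=` W >] then D `&` (f @^-1` K c) else set0.
have -> : D `&` (f @^-1` W) = \bigcup_c F c.
  apply/seteqP; split => x /=.
    move=> [Dx Ofx]; have [c [cx cO]] := open_mx_rat oO Ofx.
    by exists c => //; rewrite /F; case: asboolP.
  move=> [c _]; rewrite /F; case: asboolP => // cO [Dx Kx]; split => //.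
  exact: cO.
pose G (k : nat) := if unpickle k is Some c then F c else set0.
have -> : \bigcup_c F c = \bigcup_k G k.
  apply/seteqP; split => x [c _ Fx].
    by exists (pickle c) => //; rewrite /G pickleK.
  by move: Fx; rewrite /G; case: unpickle => // c' ?; exists c'.
apply: bigcupT_measurable => k; rewrite /G; case: unpickle => // c.
rewrite /F; case: asboolP => // _.
have -> : D `&` (f @^-1` K c) = \bigcap_(ij in [set: 'I_m * 'I_n])
    (D `&` (fun x => f x ij.1 ij.2) @^-1` (ball (ratr (c.1 ij.1 ij.2) : R) (ratr c.2)))
    `&` D.
  apply/seteqP; split => x /=.
    by move=> [Dx Kx]; split => // -[i j] _ /=; split => //; exact: Kx.
  by move=> [h Dx]; split => // i j; have [] := h (i, j) I.
apply: measurableI => //; apply: fin_bigcap_measurable => // ij _.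
by apply: mf => //; apply: open_measurable; exact: ball_open.
Qed.

End borel_matrix.

Section measure_constructions.
Context d1 d2 (T1 : measurableType d1) (T2 : measurableType d2) (R : realType).
Local Open Scope ereal_scope.

(* The left inverse g is only used to transfer sigma-finiteness. *)
Definition transport (m : set T1 -> \bar R)
    (f : T1 -> T2) (g : T2 -> T1) (mf : measurable_fun setT f)
    (mg : measurable_fun setT g) (fK : cancel f g) : set T2 -> \bar R :=
  pushforward m f.

Section transport.
Variables (m : {sigma_finite_measure set T1 -> \bar R}).
Variables (f : T1 -> T2) (g : T2 -> T1) (mf : measurable_fun setT f).
Variables (mg : measurable_fun setT g) (fK : cancel f g).

Let mpre A : measurable A -> measurable (f @^-1` A).
Proof. by move=> mA; rewrite -[X in measurable X]setTI; exact: mf. Qed.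

Let transport0 : transport m mf mg fK set0 = 0.
Proof. by rewrite /transport /pushforward preimage_set0 measure0. Qed.

Let transport_ge0 A : 0 <= transport m mf mg fK A.
Proof. exact: measure_ge0. Qed.

Let transport_sigma_additive : semi_sigma_additive (transport m mf mg fK).
Proof.
move=> F mF tF mUF; rewrite /transport /pushforward preimage_bigcup.
apply: measure_semi_sigma_additive => [k||]; first exact: mpre.
  apply/trivIsetP => /= i j _ _ ij; rewrite -preimage_setI.
  by move/trivIsetP : tF => /(_ _ _ _ _ ij) -> //; rewrite preimage_set0.
by rewrite -preimage_bigcup; exact: mpre.
Qed.

HB.instance Definition _ := isMeasure.Build _ _ _ (transport m mf mg fK)
  transport0 transport_ge0 transport_sigma_additive.

Lemma transport_sigma_finite : sigma_finite setT (transport m mf mg fK).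
Proof.
have [F FT Foo] := sigma_finiteT m.
exists (fun k => g @^-1` F k) => [|k]; first by rewrite -preimage_bigcup -FT.
have [mF mFoo] := Foo k; split; first by rewrite -[X in measurable X]setTI; exact: mg.
by rewrite /transport /pushforward -comp_preimage (_ : g \o f = id)//; exact/funext.
Qed.

HB.instance Definition _ := @Measure_isSigmaFinite.Build _ _ _
  (transport m mf mg fK) transport_sigma_finite.

End transport.

Section scale.
Variables (r : {nonneg R}) (m : {sigma_finite_measure set T1 -> \bar R}).

(* An alias of mscale, for which sigma-finiteness can be inferred. *)
Definition scale_measure : set T1 -> \bar R := mscale r m.

HB.instance Definition _ := Measure.copy scale_measure (mscale r m).

Lemma scale_measure_sigma_finite : sigma_finite setT scale_measure.
Proof.
have [F FT Foo] := sigma_finiteT m; exists F => // k.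
have [mF mFoo] := Foo k; split => //.
by rewrite /scale_measure /mscale/= lte_mul_pinfty// lee_fin.
Qed.

HB.instance Definition _ := @Measure_isSigmaFinite.Build _ _ _
  scale_measure scale_measure_sigma_finite.

End scale.

Section product.
Variables (m1 : {sigma_finite_measure set T1 -> \bar R}).
Variables (m2 : {sigma_finite_measure set T2 -> \bar R}).

(* An alias of \x: the canonical sigma-finite structure that the library
   infers for m1 \x m2 is the one for subprobabilities only. *)
Definition prod_measure : set (T1 * T2) -> \bar R := m1 \x m2.

HB.instance Definition _ := Measure.copy prod_measure (m1 \x m2).

Lemma prod_measure_sigma_finite : sigma_finite setT prod_measure.
Proof.
have /sigma_finiteP[F [TF ndF Foo]] := sigma_finiteT m1.
have /sigma_finiteP[G [TG ndG Goo]] := sigma_finiteT m2.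
exists (fun k => F k `*` G k).
  rewrite -setXTT TF TG predeqE => -[x y]; split.
    move=> [/= [k _ Fkx] [l _ Gly]]; exists (maxn k l) => //; split.
    - by move: x Fkx; exact/subsetPset/ndF/leq_maxl.
    - by move: y Gly; exact/subsetPset/ndG/leq_maxr.
  by move=> [k _ []/= ? ?]; split; exists k.
move=> k; have [? ?] := Foo k; have [? ?] := Goo k.
split; first exact: measurableX.
by rewrite /prod_measure product_measure1E// lte_mul_pinfty// ge0_fin_numE.
Qed.

HB.instance Definition _ := @Measure_isSigmaFinite.Build _ _ _
  prod_measure prod_measure_sigma_finite.

End product.

Definition density (m : set T1 -> \bar R) (w : T1 -> R)
    (mw : measurable_fun setT w) (w0 : forall x, (0 <= w x)%R) :
  set T1 -> \bar R := fun A => \int[m]_(x in A) (w x)%:E.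

Section density.
Variables (m : {measure set T1 -> \bar R}) (w : T1 -> R).
Hypotheses (mw : measurable_fun setT w) (w0 : forall x, (0 <= w x)%R).

Let density0 : density m mw w0 set0 = 0.
Proof. by rewrite /density integral_set0. Qed.

Let density_ge0 A : 0 <= density m mw w0 A.
Proof. by apply: integral_ge0 => x _; rewrite lee_fin. Qed.

Let density_sigma_additive : semi_sigma_additive (density m mw w0).
Proof.
move=> /= F mF tF mUF; rewrite /density; apply: cvg_toP.
  apply: ereal_nondecreasing_is_cvgn => p q pq.
  by apply: lee_sum_nneg_natr => // k _ _; exact: density_ge0.
rewrite ge0_integral_bigcup//=; last by move=> x _; rewrite lee_fin.
by apply/measurable_EFinP; exact: measurable_funTS.
Qed.

HB.instance Definition _ := isMeasure.Build _ _ _ (density m mw w0)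
  density0 density_ge0 density_sigma_additive.

End density.
End measure_constructions.

Section lebesgue_n.
Context {R : realType}.

Definition consv n (p : R * bvec R n) : bvec R n.+1 :=
  \col_i (if unlift ord0 i is Some j then p.2 j 0 else p.1).
Definition unconsv n (x : bvec R n.+1) : R * bvec R n :=
  (x ord0 0, \col_i x (lift ord0 i) 0).

Lemma measurable_consv n : measurable_fun setT (@consv n).
Proof.
apply: measurable_fun_borel_mx => // i j.
under eq_fun do rewrite mxE.
case: unlift => [k|]; last exact: measurable_fst.
exact: (measurableT_comp (measurable_coord k 0)).
Qed.

Lemma measurable_unconsv n : measurable_fun setT (@unconsv n).
Proof.
apply/measurable_fun_pairP; split; first exact: measurable_coord.
apply: measurable_fun_borel_mx => // i j.
rewrite /comp /=; under eq_fun do rewrite mxE.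
exact: measurable_coord.
Qed.

Lemma consvK n : cancel (@consv n) (@unconsv n).
Proof.
move=> [t x]; congr pair; first by rewrite mxE unlift_none.
by apply/colP => i; rewrite !mxE liftK.
Qed.

Fixpoint lebesgue_vec n : {sigma_finite_measure set (bvec R n) -> \bar R} :=
  match n with
  | 0 => dirac (0 : bvec R 0)
  | k.+1 => transport (prod_measure (@lebesgue_measure R) (lebesgue_vec k))
        (@measurable_consv k) (@measurable_unconsv k) (@consvK k)
  end.

End lebesgue_n.

HB.instance Definition _ (R : realType) := isPointed.Build R[i] 0.

(* The Borel sigma-algebra of the complex plane, pulled back from R * R. *)
Definition bC (R : realType) : Type :=
  g_sigma_algebra_preimageType (fun z : R[i] => (complex.Re z, complex.Im z) : R * R).
HB.instance Definition _ (R : realType) := Measurable.on (bC R).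

Lemma measurable_fun_bC (R : realType) d (T : measurableType d)
    (f : T -> bC R) : measurable_fun setT (fun x => complex.Re (f x)) ->
  measurable_fun setT (fun x => complex.Im (f x)) -> measurable_fun setT f.
Proof.
move=> mr mi _ A [B mB <-]; rewrite setTI.
exact: (measurable_fun_pair mr mi).
Qed.

Section complex_analysis.
Context {R : realType}.

Definition expi (t : R) : R[i] := cos (2 * pi * t) +i* sin (2 * pi * t).

Lemma measurable_expi : measurable_fun setT (expi : R -> bC R).
Proof.
apply: measurable_fun_bC => /=.
  apply: (measurableT_comp (f := cos)); last exact: mulrl_measurable.
  by apply: continuous_measurable_fun; exact: continuous_cos.
apply: (measurableT_comp (f := sin)); last exact: mulrl_measurable.
by apply: continuous_measurable_fun; exact: continuous_sin.
Qed.

(* Normalized Haar measure dz on the unit circle, as a measure on C. *)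
Definition circle_measure : set (bC R) -> \bar R :=
  pushforward (mrestr lebesgue_measure (measurable_itv `[(0 : R), 1[))
    (expi : measurableTypeR R -> bC R).

Let circle0 : circle_measure set0 = 0%E.
Proof. by rewrite /circle_measure /pushforward preimage_set0 measure0. Qed.

Let circle_ge0 A : (0 <= circle_measure A)%E.
Proof. by rewrite /circle_measure /pushforward; exact: measure_ge0. Qed.

Let mexpi A : measurable A -> measurable ((expi : R -> bC R) @^-1` A).
Proof. by move=> mA; rewrite -[X in measurable X]setTI; exact: measurable_expi. Qed.

Let circle_sigma_additive : semi_sigma_additive circle_measure.
Proof.
move=> F mF tF mUF; rewrite /circle_measure /pushforward preimage_bigcup.
apply: measure_semi_sigma_additive => [k||]; first exact: mexpi.
  apply/trivIsetP => /= i j _ _ ij; rewrite -preimage_setI.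
  by move/trivIsetP : tF => /(_ _ _ _ _ ij) -> //; rewrite preimage_set0.
by rewrite -preimage_bigcup; exact: mexpi.
Qed.

HB.instance Definition _ := isMeasure.Build _ _ _ circle_measure
  circle0 circle_ge0 circle_sigma_additive.

Lemma circle_measureT : circle_measure setT = 1%E.
Proof.
rewrite /circle_measure /pushforward preimage_setT /mrestr setTI.
by rewrite /= lebesgue_measure_itv/= lte_fin ltr01 oppr0 adde0.
Qed.

Let circle_sigma_finite : sigma_finite setT circle_measure.
Proof.
exists (fun=> setT) => [|k]; first by rewrite bigcup_const.
by rewrite circle_measureT ltry.
Qed.

HB.instance Definition _ := @Measure_isSigmaFinite.Build _ _ _
  circle_measure circle_sigma_finite.

Section function_spaces.
Context d (T : measurableType d) (mu : {measure set T -> \bar R}).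
Implicit Types (D : set T) (f : T -> R[i]) (p : \bar R).

(* The L^p norm over D of a complex-valued function. *)
Definition cnorm p D f : \bar R :=
  'N[mu]_p [EFin \o ((fun x => Normc.normc (f x)) \_ D)].

Definition cLfun p D f : Prop :=
  measurable_fun D (f : T -> bC R) /\ (cnorm p D f < +oo)%E.

Definition cintegral f : R[i] :=
  (\int[mu]_x complex.Re (f x)) +i* (\int[mu]_x complex.Im (f x)).

Definition inner f g : R[i] := cintegral (fun x => f x * (g x)^*%C).

End function_spaces.

Section fourier.
Variable n : nat.
Implicit Types (f g : bvec R n -> R[i]) (x y xi : 'cV[R]_n).

Definition lebesgue_L2 f := cLfun (@lebesgue_vec R n) 2%:E setT f.
Definition L2norm f : \bar R := cnorm (@lebesgue_vec R n) 2%:E setT f.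

Definition dot x y : R := \sum_i x i 0 * y i 0.

Definition fourier f (gamma : 'cV[R]_n) : R[i] :=
  cintegral (@lebesgue_vec R n) (fun x => f x * expi (- dot gamma x)).

(* g is an L^2-limit of the Fourier transforms of functions of L^1 and L^2
   approximating f in L^2. *)
Definition is_plancherel f g : Prop :=
  lebesgue_L2 g /\
  exists u : nat -> bvec R n -> R[i],
    [/\ forall k, cLfun (@lebesgue_vec R n) 1%:E setT (u k) /\ lebesgue_L2 (u k),
        L2norm (fun x => f x - u k x) @[k --> \oo] --> 0%E &
        L2norm (fun x => g x - fourier (u k) x) @[k --> \oo] --> 0%E].

(* A representative of the Fourier-Plancherel transform of f, which is only
   defined up to almost everywhere equality. *)
Definition plancherel f : bvec R n -> R[i] := get (is_plancherel f).

End fourier.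

End complex_analysis.

Section subspace.
Context {R : realType} {n : nat}.
Implicit Types (V : {vspace 'cV[R]_n}).

(* det (A|_V) for A *m V <= V. *)
Definition det_on V (A : 'M[R]_n) : R :=
  \det (\matrix_(i < \dim V, j < \dim V)
          coord (vbasis V) i (A *m (vbasis V)`_j : 'cV[R]_n)).

Definition vspace_param V (t : bvec R (\dim V)) : bvec R n :=
  \sum_(i < \dim V) t i 0 *: (vbasis V)`_i.
Definition vspace_coord V (v : bvec R n) : bvec R (\dim V) :=
  \col_i coord (vbasis V) i (v : 'cV[R]_n).

Lemma coord_sum V (i : 'I_(\dim V)) (v : 'cV[R]_n) :
  coord (vbasis V) i v = \sum_k v k 0 * coord (vbasis V) i (delta_mx k 0).
Proof.
rewrite {1}(_ : v = \sum_k v k 0 *: delta_mx k 0).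
  by rewrite linear_sum; apply: eq_bigr => k _; rewrite linearZ.
rewrite {1}[v]matrix_sum_delta; apply: eq_bigr => k _.
by rewrite big_ord1.
Qed.

Lemma measurable_vspace_param V : measurable_fun setT (@vspace_param V).
Proof.
apply: measurable_fun_borel_mx => // i j.
under eq_fun do rewrite summxE.
apply: measurable_sum => k; under eq_fun do rewrite mxE.
by apply: measurable_funM => //; exact: measurable_coord.
Qed.

Lemma measurable_vspace_coord V : measurable_fun setT (@vspace_coord V).
Proof.
apply: measurable_fun_borel_mx => // i j.
under eq_fun do rewrite mxE coord_sum.
apply: measurable_sum => k.
by apply: measurable_funM => //; exact: measurable_coord.
Qed.

Lemma vspace_paramK V : cancel (@vspace_param V) (@vspace_coord V).
Proof.
move=> t; apply/colP => i; rewrite mxE.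
by rewrite coord_sum_free// (basis_free (vbasisP V)).
Qed.

Definition gram V : R :=
  \det (\matrix_(i < \dim V, j < \dim V) dot (vbasis V)`_i (vbasis V)`_j).

(* Lebesgue measure of the Euclidean space V, as a measure on R^n: the Gram
   factor makes it independent of the basis. *)
Definition lebesgue_vspace V : {sigma_finite_measure set (bvec R n) -> \bar R} :=
  scale_measure (NngNum (sqrtr_ge0 (gram V)))
    (transport (@lebesgue_vec R (\dim V)) (@measurable_vspace_param V)
      (@measurable_vspace_coord V) (@vspace_paramK V)).

End subspace.

Section affine_weyl_heisenberg.
Context {R : realType} {n : nat}.

Definition awh : Type := (R[i] * 'cV[R]_n * 'cV[R]_n * 'M[R]_n)%type.

Definition awh_group : set awh :=
  [set g : awh | let: (z, x, xi, h) := g in `|z| = 1 /\ h \in unitmx].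

Definition awh_mul (g1 g2 : awh) : awh :=
  let: (z1, x1, xi1, h1) := g1 in
  let: (z2, x2, xi2, h2) := g2 in
  (z1 * z2 * expi (dot xi1 (h1 *m x2)), x1 + h1 *m x2,
   xi1 + (invmx h1)^T *m xi2, h1 *m h2).

Definition awh_one : awh := (1, 0, 0, 1%:M).

Definition awh_subgroup (G : set awh) : Prop :=
  [/\ G `<=` awh_group, G awh_one,
      forall g1 g2, G g1 -> G g2 -> G (awh_mul g1 g2) &
      forall g, G g -> exists2 g', G g' & awh_mul g g' = awh_one].

Definition closed_subgroup_GL (H : set 'M[R]_n) : Prop :=
  [/\ H `<=` [set h | h \in unitmx], H 1%:M,
      forall h1 h2, H h1 -> H h2 -> H (h1 *m h2),
      forall h, H h -> H (invmx h) &
      closure H `&` [set h | h \in unitmx] `<=` H].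

Definition translation_complete (G : set awh) (V : {vspace 'cV[R]_n})
    (H : set 'M[R]_n) : Prop :=
  [/\ awh_subgroup G, closed_subgroup_GL H,
      forall h v, H h -> v \in V -> h^T *m v \in V &
      G = [set g : awh | let: (z, x, xi, h) := g in
             [/\ `|z| = 1, xi \in V & H h]]].

(* A left Haar measure of H, viewed as a Borel measure on the matrices that is
   carried by H. *)
Definition left_haar (H : set 'M[R]_n)
    (muH : {measure set (bmx R n n) -> \bar R}) : Prop :=
  [/\ muH (~` H) = 0%E, (0 < muH H)%E,
      forall K : set 'M[R]_n, compact K -> K `<=` H -> (muH K < +oo)%E &
      forall h (A : set (bmx R n n)), H h -> measurable A -> A `<=` H ->
        muH ((fun a : 'M[R]_n => h *m a) @` A) = muH A].

(* The space of awh as a measurable space. *)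
Definition bawh : Type := (bC R * bvec R n * bvec R n * bmx R n n)%type.
HB.instance Definition _ := Measurable.on bawh.

Definition haar_weight (V : {vspace 'cV[R]_n}) (g : bawh) : R :=
  `|det_on V (g.2 : 'M[R]_n)^T| / `|\det (g.2 : 'M[R]_n)|.

Lemma measurable_det d (T : measurableType d) k (M : T -> 'M[R]_k) :
  (forall i j, measurable_fun setT (fun x => M x i j)) ->
  measurable_fun setT (fun x => \det (M x)).
Proof.
move=> mM; rewrite /determinant.
apply: measurable_sum => s; apply: measurable_funM => //.
exact: measurable_prod.
Qed.

Lemma measurable_det_on d (T : measurableType d) (V : {vspace 'cV[R]_n})
    (M : T -> 'M[R]_n) :
  (forall i j, measurable_fun setT (fun x => M x i j)) ->
  measurable_fun setT (fun x => det_on V (M x)).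
Proof.
move=> mM; apply: measurable_det => i j.
under eq_fun => x do rewrite mxE coord_sum.
apply: measurable_sum => k; apply: measurable_funM => //.
under eq_fun => x do rewrite mxE.
by apply: measurable_sum => l; exact: measurable_funM.
Qed.

Lemma measurable_inv : measurable_fun setT (@GRing.inv R).
Proof.
have oN0 : open [set x : R | x != 0].
  rewrite (_ : [set _ | _] = ~` [set 0]); first exact/closed_openC/closed_eq.
  by apply/seteqP; split => x /=; [move/eqP|move/eqP].
rewrite (_ : setT = [set x : R | x != 0] `|` [set 0]); last first.
  by apply/seteqP; split => x //= _; have [->|] := eqVneq x 0; [right|left].
apply/measurable_funU => //; first exact: open_measurable.
split; last exact: measurable_fun_set1.
apply: open_continuous_measurable_fun => // x; rewrite inE /= => x0.
exact: inv_continuous.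
Qed.

Lemma measurable_haar_weight V : measurable_fun setT (haar_weight V).
Proof.
have mh (i j : 'I_n) :
    measurable_fun setT (fun g : bawh => (g.2 : 'M[R]_n) i j).
  by apply: (measurableT_comp (measurable_coord i j)); exact: measurable_snd.
apply: measurable_funM.
  apply: (measurableT_comp (f := @Num.norm R R)) => //.
  apply: measurable_det_on => i j.
  by rewrite (_ : (fun _ => _) = (fun g : bawh => (g.2 : 'M[R]_n) j i))//;
    apply/funext => g; rewrite mxE.
apply: (measurableT_comp measurable_inv).
apply: (measurableT_comp (f := @Num.norm R R)) => //.
exact: measurable_det.
Qed.

Lemma haar_weight_ge0 V g : 0 <= haar_weight V g.
Proof. by rewrite divr_ge0. Qed.

(* The left Haar measure |det (h^T|_V)| dz dx dxi dh / |det h|. *)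
Definition haar_awh (V : {vspace 'cV[R]_n})
    (muH : {sigma_finite_measure set (bmx R n n) -> \bar R}) :
    {measure set bawh -> \bar R} :=
  density
    (prod_measure (prod_measure (prod_measure
       (@circle_measure R) (@lebesgue_vec R n)) (lebesgue_vspace V)) muH)
    (measurable_haar_weight V) (haar_weight_ge0 V).

Implicit Types f psi : bvec R n -> R[i].

Definition translation (x : 'cV[R]_n) f : bvec R n -> R[i] :=
  fun y => f ((y : 'cV[R]_n) - x).
Definition modulation (xi : 'cV[R]_n) f : bvec R n -> R[i] :=
  fun y => expi (dot y xi) * f y.
Definition dilation (h : 'M[R]_n) f : bvec R n -> R[i] :=
  fun y => ((Num.sqrt `|\det h|)^-1)%:C * f (invmx h *m y).

Definition quasi_regular (g : awh) f : bvec R n -> R[i] :=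
  let: (z, x, xi, h) := g in
  fun y => z * translation x (modulation xi (dilation h f)) y.

Definition wavelet psi f (g : awh) : R[i] :=
  inner (@lebesgue_vec R n) f (quasi_regular g psi).

(* The space H_U of functions whose Fourier transform is supported in U. *)
Definition spectral_subspace (U : set (bvec R n)) : set (bvec R n -> R[i]) :=
  [set f | lebesgue_L2 f /\
    \forall gamma \ae (@lebesgue_vec R n), ~ U gamma -> plancherel f gamma = 0].

Definition closed_subspace (S : set (bvec R n -> R[i])) : Prop :=
  [/\ S `<=` @lebesgue_L2 R n, S (fun=> 0),
      forall (a : R[i]) f g, S f -> S g -> S (fun x => a * f x + g x) &
      forall (u : nat -> bvec R n -> R[i]) f, (forall k, S (u k)) ->
        lebesgue_L2 f -> L2norm (fun x => f x - u k x) @[k --> \oo] --> 0%E ->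
        S f].

Definition group_invariant (G : set awh) (S : set (bvec R n -> R[i])) : Prop :=
  forall g f, G g -> S f -> S (quasi_regular g f).

Definition dual_action (gamma xi : 'cV[R]_n) (h : 'M[R]_n) : 'cV[R]_n :=
  h^T *m (gamma - xi).

Definition dual_invariant (V : {vspace 'cV[R]_n})
    (H : set 'M[R]_n) (U : set (bvec R n)) : Prop :=
  forall gamma xi h, U gamma -> xi \in V -> H h -> U (dual_action gamma xi h).

Definition Phi (V : {vspace 'cV[R]_n}) (H : set 'M[R]_n)
    (muH : {measure set (bmx R n n) -> \bar R}) psi (omega : 'cV[R]_n) : \bar R :=
  (\int[lebesgue_vspace V]_(xi in [set xi | xi \in V])
     \int[muH]_(h in H)
       (Normc.normc (plancherel psi (h^T *m (omega - xi))) ^+ 2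
          * `|det_on V h^T|)%:E)%E.

Section admissibility.
Variables (G : set awh) (muG : {measure set bawh -> \bar R}).
Variables (S : set (bvec R n -> R[i])) (psi : bvec R n -> R[i]).

Definition bounded_wavelet : Prop :=
  exists M : R, forall f, S f ->
    cLfun muG 2%:E G (wavelet psi f) /\
    (cnorm muG 2%:E G (wavelet psi f) <= M%:E * L2norm f)%E.

(* Elements of L^2 spaces are functions here, identified when they are equal
   almost everywhere. *)
Definition injective_wavelet : Prop :=
  forall f1 f2, S f1 -> S f2 ->
    (\forall g \ae muG, G g -> wavelet psi f1 g = wavelet psi f2 g) ->
    \forall x \ae (@lebesgue_vec R n), f1 x = f2 x.

Definition isometric (A : (bvec R n -> R[i]) -> awh -> R[i]) : Prop :=
  forall f, S f ->
    cLfun muG 2%:E G (A f) /\ cnorm muG 2%:E G (A f) = L2norm f.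

Definition weakly_admissible : Prop := bounded_wavelet /\ injective_wavelet.

Definition admissible : Prop :=
  exists2 c : R[i], c != 0 & exists2 A, isometric A &
    forall f g, S f -> G g -> wavelet psi f g = c * A f g.

End admissibility.

End affine_weyl_heisenberg.

Arguments awh R n : clear implicits.

(* Main.v *)
(* For fixed (z, xi, h), Parseval's formula identifies x |-> V_psi f (z, x, xi, h),
   up to a unimodular factor and the reflection x |-> -x, with the Fourier
   transform of gamma |-> |det h|^(1/2) f^(gamma) conj (psi^(h^T (gamma - xi))).
   The Plancherel theorem in x and Tonelli's theorem then give
     ||V_psi f||^2 = \int |f^(gamma)|^2 Phi_psi(gamma) dgamma,
   that is, V_psi acts as multiplication of f^ by the square root of Phi_psi.
   The bounds on Phi_psi give one direction; the other is read off by testing on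
   the f in H_U whose transform is the indicator of a subset of U of finite
   measure.

   The Plancherel theorem on the line is obtained for bounded continuous
   functions by inserting the factor exp(-|s|/m), whose transform is an
   approximate identity (the Poisson kernel), and letting m tend to infinity;
   it extends by density, and to R^n by induction on n. *)

Require Import Defs.
From HB Require Import structures.
From mathcomp Require Import all_boot all_order all_algebra.
From mathcomp Require Import all_classical all_reals all_analysis.
From mathcomp Require Import measurable_realfun complex ring lra.

Set Implicit Arguments.
Unset Strict Implicit.
Unset Printing Implicit Defensive.

Import Order.TTheory GRing.Theory Num.Theory.
Import numFieldNormedType.Exports.

Local Open Scope classical_set_scope.
Local Open Scope ring_scope.
Local Open Scope complex_scope.

(** On each fibre Plancherel is applied to the product of f^ with the conjugate of a shifted psi^.
    As a product of two L^2 functions it is always integrable, but it is square integrable only when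
    its overlap integral is finite. The energy identity is therefore stated under almost everywhere
    finiteness of the weighted overlaps, which is supplied in two ways: an upper bound on Phi_psi
    makes the total integral finite, and for an indicator transform each overlap is at most the
    squared norm of psi times a determinant factor. The test functions require the transform to be
    onto L^2; this is deduced from the multiplication formula by comparing norms. Since a transform
    is determined only up to null sets, most statements concern the relation [is_plancherel]; the
    chosen representative [plancherel] enters through [plancherelP] and [plancherel_ae]. The part of
    U where Phi_psi is too large, zero or different from the constant may have infinite measure, so
    it is shown to be null by testing its subsets of finite measure. *)

Lemma eq_lee (R : numDomainType) (x y : \bar R) : x = y -> (x <= y)%E.
Proof. by move=> ->. Qed.

(** * Complex-valued functions and their integrals *)

Section complex_numbers.
Context {R : realType}.
Implicit Types (z w : R[i]) (t s : R).
Import Normc.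

Lemma sqr_normcE z : normc z ^+ 2 = complex.Re z ^+ 2 + complex.Im z ^+ 2.
Proof. by case: z => a b /=; rewrite sqr_sqrtr// addr_ge0// sqr_ge0. Qed.

Lemma normc_ge0 z : 0 <= normc z.
Proof. by case: z => a b /=; exact: sqrtr_ge0. Qed.

Lemma normc_conj z : normc (z^*%C) = normc z.
Proof. by case: z => a b /=; rewrite sqrrN. Qed.

Lemma Re_le_normc z : `|complex.Re z| <= normc z.
Proof.
rewrite -(@ler_pXn2r _ 2)// ?nnegrE ?normc_ge0// sqr_normcE real_normK ?num_real//.
by rewrite lerDl sqr_ge0.
Qed.

Lemma Im_le_normc z : `|complex.Im z| <= normc z.
Proof.
rewrite -(@ler_pXn2r _ 2)// ?nnegrE ?normc_ge0// sqr_normcE real_normK ?num_real//.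
by rewrite lerDr sqr_ge0.
Qed.

Lemma normc_real t : normc (t%:C) = `|t|.
Proof. by rewrite /= expr0n/= addr0 sqrtr_sqr. Qed.

Lemma mul_conj z : z * z^*%C = (normc z ^+ 2)%:C.
Proof. by rewrite sqr_normcE; case: z => a b; congr (_ +i* _) => /=; ring. Qed.

Lemma normc_eq0 z : (normc z == 0) = (z == 0).
Proof. by apply/eqP/eqP => [/eq0_normc//|->]; exact: normc0. Qed.

Lemma normcB_swap z w : normc (z - w) = normc (w - z).
Proof. by rewrite -opprB normcN. Qed.

Lemma ler_dist_normc z w : `|normc z - normc w| <= normc (z - w).
Proof.
rewrite ler_norml; apply/andP; split.
  rewrite lerNl opprB lerBlDr normcB_swap; apply: le_trans (le_normcD _ _).
  by rewrite subrK.
by rewrite lerBlDr; apply: le_trans (le_normcD _ _); rewrite subrK.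
Qed.

(** By the parallelogram law the two sides differ by [normc (z - w) ^+ 2]. *)
Lemma sqr_normcD z w : normc (z + w) ^+ 2 <= 2 * normc z ^+ 2 + 2 * normc w ^+ 2.
Proof.
rewrite !sqr_normcE; case: z => a b; case: w => c d /=.
have := sqr_ge0 (a - c); have := sqr_ge0 (b - d); nra.
Qed.

Lemma ReD z w : complex.Re (z + w) = complex.Re z + complex.Re w.
Proof. by case: z => ? ?; case: w. Qed.
Lemma ImD z w : complex.Im (z + w) = complex.Im z + complex.Im w.
Proof. by case: z => ? ?; case: w. Qed.
Lemma ReM z w : complex.Re (z * w) = complex.Re z * complex.Re w - complex.Im z * complex.Im w.
Proof. by case: z => ? ?; case: w. Qed.
Lemma ImM z w : complex.Im (z * w) = complex.Re z * complex.Im w + complex.Im z * complex.Re w.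
Proof. by case: z => ? ?; case: w => ? ? /=; rewrite addrC [X in _ + X]mulrC. Qed.
Lemma ReJ z : complex.Re (z^*%C) = complex.Re z. Proof. by case: z. Qed.
Lemma ImJ z : complex.Im (z^*%C) = - complex.Im z. Proof. by case: z. Qed.
Lemma complex_eta z : z = complex.Re z +i* complex.Im z. Proof. by case: z. Qed.

Lemma complexrM s t : (s * t)%:C = s%:C * t%:C :> R[i].
Proof. exact: rmorphM. Qed.

Lemma conjcM z w : conjc (z * w) = conjc z * conjc w.
Proof. exact: rmorphM. Qed.

Lemma expiD s t : expi (s + t) = expi s * expi t.
Proof. by rewrite /expi mulrDr cosD sinD; simpc; congr (_ +i* _); rewrite addrC. Qed.

Lemma expi0 : expi (0 : R) = 1.
Proof. by rewrite /expi mulr0 cos0 sin0. Qed.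

Lemma expiN t : expi (- t) = (expi t)^*%C.
Proof. by rewrite /expi mulrN cosN sinN. Qed.

Lemma normc_expi t : normc (expi t) = 1.
Proof. by rewrite /expi /= cos2Dsin2 sqrtr1. Qed.

End complex_numbers.

Section complex_measurable.
Context d (T : measurableType d) {R : realType}.
Implicit Types (f g : T -> bC R) (u : T -> R).
Import Normc.

Lemma measurable_Re : measurable_fun setT (@complex.Re R : bC R -> R).
Proof.
move=> _ B mB; rewrite setTI; exists (B `*` setT); first exact: measurableX.
by rewrite setTI; apply/seteqP; split => z //= -[].
Qed.

Lemma measurable_Im : measurable_fun setT (@complex.Im R : bC R -> R).
Proof.
move=> _ B mB; rewrite setTI; exists (setT `*` B); first exact: measurableX.
by rewrite setTI; apply/seteqP; split => z //= -[].
Qed.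

Lemma cmeasurable_Re f : measurable_fun setT f ->
  measurable_fun setT (fun x => complex.Re (f x)).
Proof. by move=> mf; exact: (measurableT_comp measurable_Re). Qed.

Lemma cmeasurable_Im f : measurable_fun setT f ->
  measurable_fun setT (fun x => complex.Im (f x)).
Proof. by move=> mf; exact: (measurableT_comp measurable_Im). Qed.

Lemma cmeasurableD f g : measurable_fun setT f -> measurable_fun setT g ->
  measurable_fun setT (fun x => f x + g x : bC R).
Proof.
move=> mf mg; apply: measurable_fun_bC.
  by under eq_fun do rewrite ReD; apply: measurable_funD; exact: cmeasurable_Re.
by under eq_fun do rewrite ImD; apply: measurable_funD; exact: cmeasurable_Im.
Qed.

Lemma cmeasurableM f g : measurable_fun setT f -> measurable_fun setT g ->
  measurable_fun setT (fun x => f x * g x : bC R).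
Proof.
move=> mf mg.
have mrf := cmeasurable_Re mf; have mif := cmeasurable_Im mf.
have mrg := cmeasurable_Re mg; have mig := cmeasurable_Im mg.
apply: measurable_fun_bC.
  by under eq_fun do rewrite ReM; apply: measurable_funB; exact: measurable_funM.
by under eq_fun do rewrite ImM; apply: measurable_funD; exact: measurable_funM.
Qed.

Lemma cmeasurable_conj f : measurable_fun setT f ->
  measurable_fun setT (fun x => (f x)^*%C : bC R).
Proof.
move=> mf; apply: measurable_fun_bC.
  by under eq_fun do rewrite ReJ; exact: cmeasurable_Re.
under eq_fun do rewrite ImJ; apply: measurable_funN; exact: cmeasurable_Im.
Qed.

Lemma cmeasurable_real u : measurable_fun setT u ->
  measurable_fun setT (fun x => (u x)%:C : bC R).
Proof. by move=> mu; apply: measurable_fun_bC. Qed.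

Lemma cmeasurable_cst (c : R[i]) : measurable_fun setT (fun _ : T => c : bC R).
Proof. exact: measurable_cst. Qed.

Lemma cmeasurableN f : measurable_fun setT f ->
  measurable_fun setT (fun x => - f x : bC R).
Proof.
move=> mf; rewrite (_ : (fun _ => _) = (fun x => (-1) * f x : bC R)).
  by apply: cmeasurableM => //; exact: cmeasurable_cst.
by apply/funext => x; rewrite mulN1r.
Qed.

Lemma cmeasurableB f g : measurable_fun setT f -> measurable_fun setT g ->
  measurable_fun setT (fun x => f x - g x : bC R).
Proof. by move=> mf mg; apply: cmeasurableD => //; exact: cmeasurableN. Qed.

Lemma cmeasurable_expi u : measurable_fun setT u ->
  measurable_fun setT (fun x => expi (u x) : bC R).
Proof. by move=> mu; exact: (measurableT_comp measurable_expi). Qed.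

Lemma measurable_normc : measurable_fun setT (@normc R : bC R -> R).
Proof.
rewrite (_ : @normc R = fun z => Num.sqrt (complex.Re z ^+ 2 + complex.Im z ^+ 2)); last first.
  by apply/funext => -[].
apply: (measurableT_comp (f := @Num.sqrt R)).
  apply: continuous_measurable_fun; exact: sqrt_continuous.
by apply: measurable_funD; apply: measurable_funX; [exact: measurable_Re|exact: measurable_Im].
Qed.

Lemma cmeasurable_normc f : measurable_fun setT f ->
  measurable_fun setT (fun x => normc (f x)).
Proof. by move=> mf; exact: (measurableT_comp measurable_normc). Qed.

Lemma cmeasurable_sqr_normc f : measurable_fun setT f ->
  measurable_fun setT (fun x => (normc (f x) ^+ 2)%:E).
Proof. by move=> mf; apply/measurable_EFinP/measurable_funX; exact: cmeasurable_normc. Qed.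

End complex_measurable.

Section complex_integral.
Context d (T : measurableType d) {R : realType} (mu : {measure set T -> \bar R}).
Implicit Types (f g : T -> bC R) (c : R[i]).
Import Normc.
Local Open Scope ereal_scope.

Definition cintegrable f :=
  measurable_fun setT f /\ \int[mu]_x (normc (f x))%:E < +oo.

(** The squared L^2 norm as a plain integral in the extended reals: Tonelli's theorem, Fatou's lemma
    and changes of variables apply to it directly, whereas [cnorm] carries a power 1/2. *)
Definition sqr_integral f : \bar R := \int[mu]_x (normc (f x) ^+ 2)%:E.

Lemma cintegrableP f : cintegrable f <->
  measurable_fun setT f /\ mu.-integrable setT (fun x => (normc (f x))%:E).
Proof.
split=> -[mf fi]; split => //.
  apply/integrableP; split; first exact/measurable_EFinP/cmeasurable_normc.
  by under eq_integral do rewrite gee0_abs ?lee_fin ?normc_ge0//.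
case/integrableP : fi => _.
by under eq_integral do rewrite gee0_abs ?lee_fin ?normc_ge0//.
Qed.

Lemma le_cintegrable f g : measurable_fun setT f -> cintegrable g ->
  (forall x, normc (f x) <= normc (g x))%R -> cintegrable f.
Proof.
move=> mf [mg gi] fg; split=> //; apply: le_lt_trans gi.
apply: ge0_le_integral => //.
- by move=> x _; rewrite lee_fin normc_ge0.
- exact/measurable_EFinP/cmeasurable_normc.
- exact/measurable_EFinP/cmeasurable_normc.
- by move=> x _; rewrite lee_fin.
Qed.

Lemma cintegrable_Re f : cintegrable f ->
  mu.-integrable setT (EFin \o (fun x => complex.Re (f x))).
Proof.
move=> /cintegrableP[mf]; apply: le_integrable => //.
  exact/measurable_EFinP/cmeasurable_Re.
move=> x _; rewrite /= lee_fin [leRHS]ger0_norm ?normc_ge0//.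
exact: Re_le_normc.
Qed.

Lemma cintegrable_Im f : cintegrable f ->
  mu.-integrable setT (EFin \o (fun x => complex.Im (f x))).
Proof.
move=> /cintegrableP[mf]; apply: le_integrable => //.
  exact/measurable_EFinP/cmeasurable_Im.
move=> x _; rewrite /= lee_fin [leRHS]ger0_norm ?normc_ge0//.
exact: Im_le_normc.
Qed.

Lemma cintegrableD f g : cintegrable f -> cintegrable g ->
  cintegrable (fun x => f x + g x)%R.
Proof.
move=> /cintegrableP[mf fi] /cintegrableP[mg gi]; apply/cintegrableP.
have mfg : measurable_fun setT (fun x => f x + g x : bC R)%R by exact: cmeasurableD.
split=> //; apply: (le_integrable _ _ _ (integrableD _ fi gi)) => //.
  exact/measurable_EFinP/cmeasurable_normc.
move=> x _ /=; rewrite lee_fin !ger0_norm ?addr_ge0 ?normc_ge0//.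
exact: le_normcD.
Qed.

Lemma cintegrableZ c f : cintegrable f -> cintegrable (fun x => c * f x)%R.
Proof.
move=> /cintegrableP[mf fi]; apply/cintegrableP; split.
  by apply: cmeasurableM => //; exact: cmeasurable_cst.
rewrite (_ : (fun _ => _) = (fun x => (normc c)%:E * (normc (f x))%:E)).
  exact: integrableZl.
by apply/funext => x; rewrite normcM.
Qed.

Lemma cintegrableN f : cintegrable f -> cintegrable (fun x => - f x)%R.
Proof.
move=> fi; rewrite (_ : (fun _ => _) = (fun x => (-1) * f x)%R).
  exact: cintegrableZ.
by apply/funext => x; rewrite mulN1r.
Qed.

Lemma cintegrableB f g : cintegrable f -> cintegrable g ->
  cintegrable (fun x => f x - g x)%R.
Proof. by move=> fi gi; apply: cintegrableD => //; exact: cintegrableN. Qed.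

Lemma cintegrable_conj f : cintegrable f -> cintegrable (fun x => (f x)^*%C).
Proof.
move=> fi; apply: (le_cintegrable _ fi); first by apply: cmeasurable_conj; case: fi.
by move=> x; rewrite normc_conj.
Qed.

Lemma cintegrable_bounded f g (M : R) : cintegrable f -> measurable_fun setT g ->
  (forall x, normc (g x) <= M)%R -> cintegrable (fun x => f x * g x)%R.
Proof.
move=> fi mg gM; apply: (le_cintegrable _ (cintegrableZ (M%:C) fi)).
  by apply: cmeasurableM => //; case: fi.
move=> x; rewrite !normcM normc_real mulrC ler_wpM2r ?normc_ge0//.
exact: le_trans (ler_norm _).
Qed.

Lemma cintegralD f g : cintegrable f -> cintegrable g ->
  cintegral mu (fun x => f x + g x)%R = (cintegral mu f + cintegral mu g)%R.
Proof.
move=> fi gi; rewrite /cintegral; simpc; congr (_ +i* _).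
  under eq_Rintegral do rewrite ReD.
  by rewrite RintegralD//; exact: cintegrable_Re.
under eq_Rintegral do rewrite ImD.
by rewrite RintegralD//; exact: cintegrable_Im.
Qed.

Lemma cintegralZ c f : cintegrable f ->
  cintegral mu (fun x => c * f x)%R = (c * cintegral mu f)%R.
Proof.
move=> fi; have fr := cintegrable_Re fi; have fim := cintegrable_Im fi.
have Zi (r : R) (h : T -> R) : mu.-integrable setT (EFin \o h) ->
    mu.-integrable setT (EFin \o (fun x => r * h x)%R).
  by move=> hi; have := integrableZl measurableT r hi.
rewrite /cintegral [c in RHS]complex_eta; simpc; congr (_ +i* _).
  under eq_Rintegral do rewrite ReM.
  by rewrite RintegralB ?RintegralZl//; exact: Zi.
under eq_Rintegral do rewrite ImM.
by rewrite RintegralD ?RintegralZl//; exact: Zi.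
Qed.

Lemma cintegralB f g : cintegrable f -> cintegrable g ->
  cintegral mu (fun x => f x - g x)%R = (cintegral mu f - cintegral mu g)%R.
Proof.
move=> fi gi; rewrite cintegralD//; last exact: cintegrableN.
congr (_ + _)%R; rewrite -mulN1r -cintegralZ//; congr cintegral.
by apply/funext => x; rewrite mulN1r.
Qed.

Lemma cintegral_conj f : cintegrable f ->
  cintegral mu (fun x => (f x)^*%C) = ((cintegral mu f)^*%C)%R.
Proof.
move=> fi; rewrite /cintegral /=; congr (_ +i* _).
  by apply: eq_Rintegral => x _; rewrite ReJ.
under eq_Rintegral do rewrite ImJ -mulN1r.
by rewrite RintegralZl ?mulN1r//; exact: cintegrable_Im.
Qed.

Lemma eq_cintegral f g : f =1 g -> cintegral mu f = cintegral mu g.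
Proof. by move=> /funext ->. Qed.

Lemma ae_eq_cintegral f g : measurable_fun setT f -> measurable_fun setT g ->
  {ae mu, forall x, f x = g x} -> cintegral mu f = cintegral mu g.
Proof.
move=> mf mg fg; rewrite /cintegral /Rintegral; congr (fine _ +i* fine _).
  apply: ae_eq_integral => //; try by apply/measurable_EFinP/cmeasurable_Re.
  by apply: filterS fg => x -> _.
apply: ae_eq_integral => //; try by apply/measurable_EFinP/cmeasurable_Im.
by apply: filterS fg => x -> _.
Qed.

Lemma cintegral_real (u : T -> R) :
  cintegral mu (fun x => (u x)%:C) = ((\int[mu]_x u x)%R)%:C.
Proof.
by rewrite /cintegral /= /Rintegral [X in _ +i* fine X](@integral0 _ _ _ mu setT).
Qed.

(* Rotating the integral to the positive real axis bounds its modulus by that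
   of the real part of the rotated integrand. *)
Lemma normc_cintegral_le f : cintegrable f ->
  (normc (cintegral mu f))%:E <= \int[mu]_x (normc (f x))%:E.
Proof.
move=> fi; have [mf foo] := fi; set z := cintegral mu f.
have [->|z0] := eqVneq z 0%R.
  by rewrite normc0; apply: integral_ge0 => x _; rewrite lee_fin normc_ge0.
have nz0 : (normc z != 0)%R by rewrite normc_eq0.
pose u : R[i] := (z^*%C * ((normc z)^-1)%:C)%R.
have u1 : normc u = 1%R.
  by rewrite /u normcM normc_conj normc_real ger0_norm ?invr_ge0 ?normc_ge0// mulfV.
have : (normc z = complex.Re (u * z))%R.
  rewrite /u mulrAC [(_ * z)%R]mulrC mul_conj -rmorphM /= expr2 -mulrA mulfV//.
  by rewrite mulr1.
rewrite /z -cintegralZ// => ->; rewrite /= fineK; last first.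
  apply: integrable_fin_num => //; have /= := cintegrable_Re (cintegrableZ u fi).
  by apply.
apply: (@le_trans _ _ (\int[mu]_x `|(complex.Re (u * f x))%:E|)).
  apply: le_trans (lee_abs _) _; apply: le_abse_integral => //.
  by apply: (measurable_int mu); exact: (cintegrable_Re (cintegrableZ u fi)).
apply: ge0_le_integral => //.
- apply: measurableT_comp => //.
  by apply: (measurable_int mu); exact: (cintegrable_Re (cintegrableZ u fi)).
- exact/measurable_EFinP/cmeasurable_normc.
- by move=> x _; rewrite /= lee_fin (le_trans (Re_le_normc _))// normcM u1 mul1r.
Qed.

End complex_integral.

(** * Fubini's theorem for complex functions *)

Section complex_fubini.
Context d1 d2 (T1 : measurableType d1) (T2 : measurableType d2) {R : realType}.
Variables (m1 : {sigma_finite_measure set T1 -> \bar R}).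
Variables (m2 : {sigma_finite_measure set T2 -> \bar R}).
Implicit Types (F : T1 * T2 -> bC R).
Import Normc.
Local Open Scope ereal_scope.

(** Tonelli's theorem makes the integrals of the positive and negative parts measurable; their
    difference is measurable also at points where both are infinite, and [fine] is measurable on all
    extended reals. *)
Lemma measurable_integral_snd (u : T1 * T2 -> R) : measurable_fun setT u ->
  measurable_fun setT (fun x => (\int[m2]_y u (x, y))%R).
Proof.
move=> mu; apply: (measurableT_comp (f := fine)); first exact: fine_measurable.
pose f z := (u z)%:E.
have mf : measurable_fun setT f by exact/measurable_EFinP.
rewrite (_ : (fun _ => _) = (fun x => \int[m2]_y f^\+ (x, y)) \- (fun x => \int[m2]_y f^\- (x, y))).
  apply: emeasurable_funB.
    by apply: (measurable_fun_fubini_tonelli_F f^\+); [exact: measurable_funepos|].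
  by apply: (measurable_fun_fubini_tonelli_F f^\-); [exact: measurable_funeneg|].
apply/funext => x; rewrite integralE; congr (_ - _).
  by under eq_integral do rewrite (funepos_comp f)/=.
by under eq_integral do rewrite (funeneg_comp f)/=.
Qed.

Lemma measurable_cintegral_snd F : measurable_fun setT F ->
  measurable_fun setT (fun x => cintegral m2 (fun y => F (x, y)) : bC R).
Proof.
move=> mF; apply: measurable_fun_bC => /=.
  exact: (measurable_integral_snd (cmeasurable_Re mF)).
exact: (measurable_integral_snd (cmeasurable_Im mF)).
Qed.

Lemma ae_cintegrable_snd F : cintegrable (m1 \x m2) F ->
  {ae m1, forall x, cintegrable m2 (fun y => F (x, y))}.
Proof.
move=> [mF Foo].
have mn : measurable_fun setT (fun z => (normc (F z))%:E).
  exact/measurable_EFinP/cmeasurable_normc.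
have := Foo; rewrite fubini_tonelli1//; last first.
  by move=> x; rewrite lee_fin normc_ge0.
move=> h.
have F0 x : 0 <= fubini_F m2 (fun z => (normc (F z))%:E) x.
  by apply: integral_ge0 => y _; rewrite lee_fin normc_ge0.
have /(integrable_ae measurableT) :
    m1.-integrable setT (fubini_F m2 (fun z => (normc (F z))%:E)).
  apply/integrableP; split.
    apply: measurable_fun_fubini_tonelli_F => // x.
    by rewrite lee_fin normc_ge0.
  by under eq_integral do rewrite gee0_abs//.
apply: filterS => x /(_ I) xfin; split.
  exact: measurableT_comp.
by rewrite ltey_eq xfin.
Qed.

Lemma Rintegral_fubini1 (u : T1 * T2 -> R) : (m1 \x m2).-integrable setT (EFin \o u) ->
  (\int[m1]_x \int[m2]_y u (x, y) = \int[m1 \x m2]_z u z)%R.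
Proof.
move=> ui; rewrite /Rintegral; congr fine.
have mu : measurable_fun setT u by apply/measurable_EFinP; exact: measurable_int ui.
have Fi := integrable_fubini_F ui.
(* The inner real integral is [fine] of the extended one. The two agree only where the latter is
   finite, which is the case almost everywhere. *)
rewrite -(integral12_prod_meas1 ui); apply: ae_eq_integral => //.
- by apply/measurable_EFinP; exact: measurable_integral_snd.
- exact: measurable_int Fi.
- by have := integrable_ae measurableT Fi; apply: filterS => x /= h /h/fineK.
Qed.

Lemma cfubini1 F : cintegrable (m1 \x m2) F ->
  cintegral m1 (fun x => cintegral m2 (fun y => F (x, y))) = cintegral (m1 \x m2) F.
Proof.
move=> Fi; rewrite {1 3}/cintegral; congr (_ +i* _) => /=.
  exact: (Rintegral_fubini1 (cintegrable_Re Fi)).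
exact: (Rintegral_fubini1 (cintegrable_Im Fi)).
Qed.

End complex_fubini.

Section complex_fubini_swap.
Context d1 d2 (T1 : measurableType d1) (T2 : measurableType d2) {R : realType}.
Variables (m1 : {sigma_finite_measure set T1 -> \bar R}).
Variables (m2 : {sigma_finite_measure set T2 -> \bar R}).
Implicit Types (F : T1 * T2 -> bC R).
Import Normc.
Local Open Scope ereal_scope.

Lemma measurable_integral_fst (u : T1 * T2 -> R) : measurable_fun setT u ->
  measurable_fun setT (fun y => (\int[m1]_x u (x, y))%R).
Proof.
move=> mu; apply: (measurable_integral_snd m1 (u := fun z => u (z.2, z.1))).
by apply: measurableT_comp => //; exact: measurable_fun_pair.
Qed.

Lemma Rintegral_fubini2 (u : T1 * T2 -> R) : (m1 \x m2).-integrable setT (EFin \o u) ->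
  (\int[m2]_y \int[m1]_x u (x, y) = \int[m1 \x m2]_z u z)%R.
Proof.
move=> ui; rewrite /Rintegral; congr fine.
have mu : measurable_fun setT u by apply/measurable_EFinP; exact: measurable_int ui.
have ms : measurable_fun setT (fun z : T2 * T1 => u (z.2, z.1)).
  by apply: measurableT_comp => //; exact: measurable_fun_pair.
have Gi : m2.-integrable setT (fubini_F m1 (EFin \o (fun z : T2 * T1 => u (z.2, z.1)))).
  apply: integrable_fubini_F; apply/integrable12ltyP; first exact/measurable_EFinP.
  by apply/(integrable21ltyP m1 m2 (f := EFin \o u)) => //; exact/measurable_EFinP.
rewrite -(integral21_prod_meas1 ui); apply: ae_eq_integral => //.
- by apply/measurable_EFinP; exact: measurable_integral_fst.
- exact: measurable_int Gi.
- by have := integrable_ae measurableT Gi; apply: filterS => x /= h /h/fineK.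
Qed.

Lemma cfubini2 F : cintegrable (m1 \x m2) F ->
  cintegral m2 (fun y => cintegral m1 (fun x => F (x, y))) = cintegral (m1 \x m2) F.
Proof.
move=> Fi; rewrite {1 3}/cintegral; congr (_ +i* _) => /=.
  exact: (Rintegral_fubini2 (cintegrable_Re Fi)).
exact: (Rintegral_fubini2 (cintegrable_Im Fi)).
Qed.

Lemma cfubini F : cintegrable (m1 \x m2) F ->
  cintegral m1 (fun x => cintegral m2 (fun y => F (x, y))) =
  cintegral m2 (fun y => cintegral m1 (fun x => F (x, y))).
Proof. by move=> Fi; rewrite cfubini1// cfubini2. Qed.

End complex_fubini_swap.

Section complex_substitution.
Context d1 d2 (T1 : measurableType d1) (T2 : measurableType d2) {R : realType}.
Variables (m1 : {measure set T1 -> \bar R}) (m2 : {measure set T2 -> \bar R}).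
Variables (phi : T1 -> T2) (c : R).
Hypothesis c0 : 0 <= c.
Hypothesis mphi : measurable_fun setT phi.
(** A change of variables known for nonnegative functions extends to integrable complex ones through
    positive and negative parts. Taken as a hypothesis on [phi], it serves reflections, dilations of
    the line, affine maps of R^n and the identification of R x R^n with R^(n+1). *)
Hypothesis phiE : forall f : T2 -> \bar R, measurable_fun setT f ->
  (forall x, 0 <= f x)%E -> (\int[m1]_x f (phi x) = c%:E * \int[m2]_y f y)%E.
Import Normc.
Local Open Scope ereal_scope.

Lemma cintegrable_substitution (F : T2 -> bC R) : cintegrable m2 F ->
  cintegrable m1 (fun x => F (phi x)).
Proof.
move=> [mF Foo]; split; first exact: measurableT_comp.
rewrite (phiE (f := fun y => (normc (F y))%:E)).
- by rewrite lte_mul_pinfty// lee_fin.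
- exact/measurable_EFinP/cmeasurable_normc.
- by move=> x; rewrite lee_fin normc_ge0.
Qed.

Lemma Rintegral_substitution (u : T2 -> R) : m2.-integrable setT (EFin \o u) ->
  (\int[m1]_x u (phi x) = c * \int[m2]_y u y)%R.
Proof.
move=> ui; have mu := measurable_int _ ui.
rewrite /Rintegral -[c in RHS]/(fine c%:E) -fineM//; last exact: integrable_fin_num.
congr fine; rewrite integralE [in RHS]integralE muleBr//; last first.
  by rewrite fin_num_adde_defr//; exact: integrable_pos_fin_num ui.
rewrite -(phiE (f := (EFin \o u)^\+)); last 2 first.
- exact: measurable_funepos.
- by [].
rewrite -(phiE (f := (EFin \o u)^\-)); last 2 first.
- exact: measurable_funeneg.
- by [].
congr (_ - _); first by rewrite (funepos_comp (EFin \o u))/=.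
by rewrite (funeneg_comp (EFin \o u))/=.
Qed.

Lemma cintegral_substitution (F : T2 -> bC R) : cintegrable m2 F ->
  cintegral m1 (fun x => F (phi x)) = (c%:C * cintegral m2 F)%R.
Proof.
move=> Fi; rewrite /cintegral; simpc; congr (_ +i* _); rewrite /= mul0r ?subr0 ?addr0.
  exact: (Rintegral_substitution (cintegrable_Re Fi)).
exact: (Rintegral_substitution (cintegrable_Im Fi)).
Qed.

Lemma sqr_integral_substitution (F : T2 -> bC R) : measurable_fun setT F ->
  sqr_integral m1 (fun x => F (phi x)) = c%:E * sqr_integral m2 F.
Proof.
move=> mF; rewrite /sqr_integral (phiE (f := fun y => (normc (F y) ^+ 2)%:E))//.
  exact: cmeasurable_sqr_normc.
by move=> x; rewrite lee_fin sqr_ge0.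
Qed.

End complex_substitution.

Section complex_tensor.
Context d1 d2 (T1 : measurableType d1) (T2 : measurableType d2) {R : realType}.
Variables (m1 : {sigma_finite_measure set T1 -> \bar R}).
Variables (m2 : {sigma_finite_measure set T2 -> \bar R}).
Implicit Types (f : T1 -> bC R) (g : T2 -> bC R).
Import Normc.
Local Open Scope ereal_scope.

Lemma ge0_integral_tensor (u : T1 -> \bar R) (v : T2 -> \bar R) :
  measurable_fun setT u -> measurable_fun setT v ->
  (forall x, 0 <= u x) -> (forall y, 0 <= v y) ->
  \int[m1 \x m2]_z (u z.1 * v z.2) = \int[m1]_x u x * \int[m2]_y v y.
Proof.
move=> mu mv u0 v0; rewrite (fubini_tonelli1 (fun z => u z.1 * v z.2)).
- rewrite -ge0_integralZr//; last by apply: integral_ge0.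
  by apply: eq_integral => x _; rewrite /fubini_F/= ge0_integralZl.
- apply: emeasurable_funM.
    exact: (measurableT_comp mu measurable_fst).
  exact: (measurableT_comp mv measurable_snd).
- by move=> z; rewrite mule_ge0.
Qed.

Lemma cmeasurable_fst f : measurable_fun setT f ->
  measurable_fun setT (fun z : T1 * T2 => f z.1).
Proof. by move=> mf; exact: (measurableT_comp mf measurable_fst). Qed.

Lemma cmeasurable_snd g : measurable_fun setT g ->
  measurable_fun setT (fun z : T1 * T2 => g z.2).
Proof. by move=> mg; exact: (measurableT_comp mg measurable_snd). Qed.

Lemma cintegrable_tensor f g : cintegrable m1 f -> cintegrable m2 g ->
  cintegrable (m1 \x m2) (fun z => f z.1 * g z.2)%R.
Proof.
move=> [mf foo] [mg goo]; split.
  by apply: cmeasurableM; [exact: cmeasurable_fst|exact: cmeasurable_snd].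
rewrite (_ : \int[m1 \x m2]_z _ =
    \int[m1 \x m2]_z ((fun x => (normc (f x))%:E) z.1 * (fun y => (normc (g y))%:E) z.2)).
  rewrite (ge0_integral_tensor (u := fun x => (normc (f x))%:E) (v := fun y => (normc (g y))%:E)).
  - rewrite lte_mul_pinfty//; last first.
      by rewrite ge0_fin_numE// integral_ge0// => x _; rewrite lee_fin normc_ge0.
    by apply: integral_ge0 => x _; rewrite lee_fin normc_ge0.
  - exact/measurable_EFinP/cmeasurable_normc.
  - exact/measurable_EFinP/cmeasurable_normc.
  - by move=> x; rewrite lee_fin normc_ge0.
  - by move=> x; rewrite lee_fin normc_ge0.
by apply: eq_integral => z _; rewrite normcM.
Qed.

Lemma cintegral_tensor f g : cintegrable m1 f -> cintegrable m2 g ->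
  cintegral (m1 \x m2) (fun z => f z.1 * g z.2)%R = (cintegral m1 f * cintegral m2 g)%R.
Proof.
move=> fi gi; rewrite -cfubini1; last exact: cintegrable_tensor.
rewrite mulrC -cintegralZ//; apply: eq_cintegral => x /=.
by rewrite cintegralZ// mulrC.
Qed.

End complex_tensor.

Lemma ge0_le_poweR (R : realType) (r : R) (x y : \bar R) : 0 <= r ->
  (0 <= x)%E -> (x <= y)%E -> (x `^ r <= y `^ r)%E.
Proof.
move=> r0 x0 xy; apply: gt0_ler_poweR => //; rewrite in_itv/= leey andbT//.
exact: le_trans xy.
Qed.

Lemma poweR_half_sqr (R : realType) (x : \bar R) : (0 <= x -> x `^ 2^-1 * x `^ 2^-1 = x)%E.
Proof.
case: x => [r|_|//]; last by rewrite poweRyr ?mulyy// invr_eq0 pnatr_eq0.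
by rewrite lee_fin => r0; rewrite poweR_EFin powR12_sqrt// -EFinM -expr2 sqr_sqrtr.
Qed.

(** * Square-integrable functions *)

Section complex_L2.
Context d (T : measurableType d) {R : realType} (mu : {measure set T -> \bar R}).
Implicit Types (f g : T -> bC R) (c : R[i]).
Import Normc.
Local Open Scope ereal_scope.

Lemma sqr_integral_ge0 f : 0 <= sqr_integral mu f.
Proof. by apply: integral_ge0 => x _; rewrite lee_fin sqr_ge0. Qed.

Lemma cnorm2_setE (D : set T) f : measurable D -> measurable_fun D f ->
  cnorm mu 2%:E D f = (\int[mu]_(x in D) (normc (f x) ^+ 2)%:E) `^ 2^-1.
Proof.
move=> mD mf; rewrite /cnorm unlock; congr (_ `^ _).
rewrite [RHS]integral_mkcond; apply: eq_integral => x _.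
rewrite /= /patch; case: ifPn => _; last by rewrite normr0 powR0// pnatr_eq0.
by rewrite ger0_norm ?normc_ge0// powR_mulrn// normc_ge0.
Qed.

Lemma cnorm2E f : cnorm mu 2%:E setT f = (sqr_integral mu f) `^ 2^-1.
Proof.
rewrite /cnorm unlock; congr (_ `^ _); apply: eq_integral => x _.
rewrite /= /patch in_setT.
by rewrite ger0_norm ?normc_ge0// powR_mulrn// normc_ge0.
Qed.

Lemma cnorm2_ge0 f : 0 <= cnorm mu 2%:E setT f.
Proof. exact: Lnorm_ge0. Qed.

Lemma sqr_cnorm2 f :
  cnorm mu 2%:E setT f * cnorm mu 2%:E setT f = sqr_integral mu f.
Proof.
by rewrite cnorm2E poweR_half_sqr// sqr_integral_ge0.
Qed.

Lemma cnorm2_lty f : (cnorm mu 2%:E setT f < +oo) = (sqr_integral mu f < +oo).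
Proof.
apply/idP/idP => h; last by rewrite cnorm2E poweR_lty.
by rewrite -sqr_cnorm2 lte_mul_pinfty// ?ge0_fin_numE ?cnorm2_ge0.
Qed.

Lemma cLfun2P f : cLfun mu 2%:E setT f <->
  measurable_fun setT f /\ sqr_integral mu f < +oo.
Proof. by rewrite /cLfun cnorm2_lty. Qed.

Lemma cLfun1P f : cLfun mu 1%:E setT f <-> cintegrable mu f.
Proof.
rewrite /cLfun /cintegrable /cnorm Lnorm1.
rewrite (_ : \int[mu]_x _ = \int[mu]_x (normc (f x))%:E)//.
by apply: eq_integral => x _; rewrite /= patchT ?in_setT// ger0_norm ?normc_ge0.
Qed.

Lemma ae_eq_sqr_integral f g : measurable_fun setT f -> measurable_fun setT g ->
  {ae mu, forall x, f x = g x} -> sqr_integral mu f = sqr_integral mu g.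
Proof.
move=> mf mg fg; apply: ge0_ae_eq_integral => //.
- exact: cmeasurable_sqr_normc.
- exact: cmeasurable_sqr_normc.
- by move=> x _; rewrite lee_fin sqr_ge0.
- by move=> x _; rewrite lee_fin sqr_ge0.
- by apply: filterS fg => x -> _.
Qed.

Lemma sqr_integral_eq0 f : measurable_fun setT f -> sqr_integral mu f = 0 ->
  {ae mu, forall x, f x = 0%R}.
Proof.
move=> mf f0.
have : \int[mu]_x `|(normc (f x) ^+ 2)%:E| = 0.
  by rewrite -[RHS]f0; apply: eq_integral => x _; rewrite gee0_abs// lee_fin sqr_ge0.
move/(ae_eq_integral_abs mu measurableT (cmeasurable_sqr_normc mf)).
apply: filterS => x /(_ I) [/eqP]; rewrite sqrf_eq0 => /eqP; exact: eq0_normc.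
Qed.

Lemma sqr_integral0 : sqr_integral mu (fun _ => 0%R) = 0.
Proof. by rewrite /sqr_integral; under eq_integral do rewrite normc0 expr0n/=; rewrite integral0. Qed.

Lemma sqr_integralZ c f : measurable_fun setT f ->
  sqr_integral mu (fun x => c * f x)%R = (normc c ^+ 2)%:E * sqr_integral mu f.
Proof.
move=> mf; rewrite -ge0_integralZl_EFin ?sqr_ge0//.
- by apply: eq_integral => x _; rewrite normcM exprMn.
- by move=> x _; rewrite lee_fin sqr_ge0.
- exact: cmeasurable_sqr_normc.
Qed.

Lemma le_sqr_integral f g : measurable_fun setT f -> measurable_fun setT g ->
  (forall x, normc (f x) <= normc (g x))%R -> sqr_integral mu f <= sqr_integral mu g.
Proof.
move=> mf mg fg; apply: ge0_le_integral => //.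
- by move=> x _; rewrite lee_fin sqr_ge0.
- exact: cmeasurable_sqr_normc.
- exact: cmeasurable_sqr_normc.
- by move=> x _; rewrite lee_fin ler_pXn2r// nnegrE normc_ge0.
Qed.

Lemma sqr_integralD_le f g : measurable_fun setT f -> measurable_fun setT g ->
  sqr_integral mu (fun x => f x + g x)%R <= 2%:E * (sqr_integral mu f + sqr_integral mu g).
Proof.
move=> mf mg.
have mf2 := cmeasurable_sqr_normc mf; have mg2 := cmeasurable_sqr_normc mg.
rewrite /sqr_integral -ge0_integralD//; last 2 first.
- by move=> x _; rewrite lee_fin sqr_ge0.
- by move=> x _; rewrite lee_fin sqr_ge0.
rewrite -ge0_integralZl_EFin//; last 2 first.
- by move=> x _; rewrite -EFinD lee_fin addr_ge0// sqr_ge0.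
- exact: emeasurable_funD.
apply: ge0_le_integral => //.
- by move=> x _; rewrite lee_fin sqr_ge0.
- by apply: cmeasurable_sqr_normc; exact: cmeasurableD.
- by apply: measurable_funeM; exact: emeasurable_funD.
- by move=> x _; rewrite -EFinD -EFinM lee_fin mulrDr; exact: sqr_normcD.
Qed.

Lemma cLfun2D f g : cLfun mu 2%:E setT f -> cLfun mu 2%:E setT g ->
  cLfun mu 2%:E setT (fun x => f x + g x)%R.
Proof.
move=> /cLfun2P[mf f2] /cLfun2P[mg g2]; apply/cLfun2P.
split; first exact: cmeasurableD.
apply: (le_lt_trans (sqr_integralD_le mf mg)).
by rewrite lte_mul_pinfty// lte_add_pinfty.
Qed.

Lemma cLfun2Z c f : cLfun mu 2%:E setT f -> cLfun mu 2%:E setT (fun x => c * f x)%R.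
Proof.
move=> /cLfun2P[mf f2]; apply/cLfun2P.
split; first by apply: cmeasurableM => //; exact: cmeasurable_cst.
by rewrite sqr_integralZ// lte_mul_pinfty// lee_fin sqr_ge0.
Qed.

Lemma cLfun2B f g : cLfun mu 2%:E setT f -> cLfun mu 2%:E setT g ->
  cLfun mu 2%:E setT (fun x => f x - g x)%R.
Proof.
move=> f2 g2; rewrite (_ : (fun _ => _) = (fun x => f x + (-1) * g x)%R).
  by apply: cLfun2D => //; exact: cLfun2Z.
by apply/funext => x; rewrite mulN1r.
Qed.

Lemma sqr_integral_conj f : sqr_integral mu (fun x => (f x)^*%C) = sqr_integral mu f.
Proof. by apply: eq_integral => x _; rewrite normc_conj. Qed.

Lemma cnorm2_conj f : cnorm mu 2%:E setT (fun x => (f x)^*%C) = cnorm mu 2%:E setT f.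
Proof. by rewrite !cnorm2E sqr_integral_conj. Qed.

Lemma cLfun2_conj f : cLfun mu 2%:E setT f -> cLfun mu 2%:E setT (fun x => (f x)^*%C).
Proof.
by move=> [mf f2]; split; [exact: cmeasurable_conj|rewrite cnorm2_conj].
Qed.

Lemma cnorm2Z c f : measurable_fun setT f ->
  cnorm mu 2%:E setT (fun x => c * f x)%R = (normc c)%:E * cnorm mu 2%:E setT f.
Proof.
move=> mf; rewrite !cnorm2E sqr_integralZ// poweRM ?sqr_integral_ge0 ?lee_fin ?sqr_ge0//.
congr (_ * _); rewrite -powR_mulrn ?normc_ge0// poweR_EFin -powRrM mulfV ?pnatr_eq0//.
by rewrite powRr1// normc_ge0.
Qed.

Lemma cnorm2D f g : measurable_fun setT f -> measurable_fun setT g ->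
  cnorm mu 2%:E setT (fun x => f x + g x)%R <=
  cnorm mu 2%:E setT f + cnorm mu 2%:E setT g.
Proof.
move=> mf mg.
have mnf := cmeasurable_normc mf; have mng := cmeasurable_normc mg.
rewrite /cnorm !(patch_setT) -[X in _ <= X]/(_ + _).
have p1 : (1 <= 2 :> R)%R by rewrite ler1n.
apply: le_trans (minkowski_EFin mu mnf mng p1).
rewrite unlock; apply: ge0_le_poweR; first by rewrite invr_ge0.
  by apply: integral_ge0 => x _; rewrite poweR_ge0.
apply: ge0_le_integral => //.
- by move=> x _; exact: poweR_ge0.
- apply/measurable_EFinP; apply: (measurableT_comp (measurable_powR _)).
  by apply: measurableT_comp => //; apply: cmeasurable_normc; exact: cmeasurableD.
- apply/measurable_EFinP; apply: (measurableT_comp (measurable_powR _)).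
  by apply: measurableT_comp => //; exact: measurable_funD.
- move=> x _; rewrite /= lee_fin ge0_ler_powR// ?nnegrE//.
  rewrite !ger0_norm ?addr_ge0 ?normc_ge0//; exact: le_normcD.
Qed.

Lemma integral_normcM_le f g : measurable_fun setT f -> measurable_fun setT g ->
  \int[mu]_x (normc (f x * g x))%:E <= cnorm mu 2%:E setT f * cnorm mu 2%:E setT g.
Proof.
move=> mf mg.
have mnf := cmeasurable_normc mf; have mng := cmeasurable_normc mg.
have := @hoelder _ _ _ mu _ _ 2 2 mnf mng (ltr0Sn _ _) (ltr0Sn _ _) _.
rewrite /cnorm !patch_setT Lnorm1 => h; apply: le_trans (h _).
  apply: eq_lee; apply: eq_integral => x _.
  by rewrite /= normcM ger0_norm// mulr_ge0 ?normc_ge0.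
by lra.
Qed.

Lemma cintegrable_mul f g : cLfun mu 2%:E setT f -> cLfun mu 2%:E setT g ->
  cintegrable mu (fun x => f x * g x)%R.
Proof.
move=> [mf f2] [mg g2]; split; first exact: cmeasurableM.
apply: le_lt_trans (integral_normcM_le mf mg) _.
by rewrite lte_mul_pinfty// ?ge0_fin_numE ?cnorm2_ge0.
Qed.

Lemma cintegrable_inner f g : cLfun mu 2%:E setT f -> cLfun mu 2%:E setT g ->
  cintegrable mu (fun x => f x * (g x)^*%C)%R.
Proof. by move=> f2 g2; apply: cintegrable_mul => //; exact: cLfun2_conj. Qed.

(** Continuity of the norm; the two bounds of the squeeze are the two halves of the reverse triangle
    inequality. *)
Lemma cvg_cnorm2 (u : nat -> T -> bC R) f : cLfun mu 2%:E setT f ->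
  (forall k, cLfun mu 2%:E setT (u k)) ->
  cnorm mu 2%:E setT (fun x => f x - u k x)%R @[k --> \oo] --> 0 ->
  cnorm mu 2%:E setT (u k) @[k --> \oo] --> cnorm mu 2%:E setT f.
Proof.
move=> f2 u2 fu.
have ffin : cnorm mu 2%:E setT f \is a fin_num by rewrite ge0_fin_numE ?cnorm2_ge0//; case: f2.
have fufin k : cnorm mu 2%:E setT (fun x => f x - u k x)%R \is a fin_num.
  by rewrite ge0_fin_numE ?cnorm2_ge0//; have [] := cLfun2B f2 (u2 k).
apply: (@squeeze_cvge _ _ _ _ (fun k => cnorm mu 2%:E setT f - cnorm mu 2%:E setT (fun x => f x - u k x)%R)
  _ (fun k => cnorm mu 2%:E setT f + cnorm mu 2%:E setT (fun x => f x - u k x)%R)).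
- apply: nearW => k; apply/andP; split.
    rewrite leeBlDr// (le_trans _ (cnorm2D _ _))//; last 2 first.
    + by case: (u2 k).
    + by have [] := cLfun2B f2 (u2 k).
    apply: eq_lee; congr cnorm.
    by apply/funext => x; rewrite subrKC.
  rewrite (_ : cnorm mu 2%:E setT (fun x => f x - u k x)%R =
      cnorm mu 2%:E setT (fun x => u k x - f x)%R); last first.
    by rewrite !cnorm2E; congr (_ `^ _); apply: eq_integral => x _; rewrite normcB_swap.
  rewrite (le_trans _ (cnorm2D _ _))//; last 2 first.
  + by case: f2.
  + by have [] := cLfun2B (u2 k) f2.
  apply: eq_lee; congr cnorm.
  by apply/funext => x; rewrite subrKC.
- rewrite -[X in _ --> X]sube0; apply: cvgeB => //; last exact: cvg_cst.
  by rewrite fin_num_adde_defr.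
- rewrite -[X in _ --> X]adde0; apply: cvgeD => //; last exact: cvg_cst.
  by rewrite fin_num_adde_defr.
Qed.

End complex_L2.

Lemma ge0_cvge0P (R : realType) (a : nat -> \bar R) : (forall k, (0 <= a k)%E) ->
  a @ \oo --> 0%E <-> forall e : R, 0 < e -> \forall k \near \oo, (a k < e%:E)%E.
Proof.
move=> a0; split=> [/fine_cvgP[afin /cvgrPdist_lt acvg] e e0|h].
  have := acvg e e0; apply: filterS2 afin => k kfin.
  rewrite sub0r normrN ger0_norm ?fine_ge0// => ke.
  by rewrite -(fineK kfin) lte_fin.
apply/fine_cvgP; split.
  by apply: filterS (h 1 ltr01) => k k1; rewrite ge0_fin_numE// (lt_trans k1)// ltry.
apply/cvgrPdist_lt => e e0; apply: filterS (h e e0) => k ke.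
rewrite sub0r normrN ger0_norm ?fine_ge0// -lte_fin fineK//.
by rewrite ge0_fin_numE// (lt_trans ke)// ltry.
Qed.

Lemma ge0_cvge0_le (R : realType) (a b : nat -> \bar R) : (forall k, (0 <= a k)%E) ->
  (forall k, (a k <= b k)%E) -> b @ \oo --> 0%E -> a @ \oo --> 0%E.
Proof.
move=> a0 ab b_cvg; apply: (@squeeze_cvge _ _ _ _ (fun=> 0%E) _ b) => //.
  by apply: nearW => k; rewrite a0 ab.
exact: cvg_cst.
Qed.

Section convergence_L2.
Context d (T : measurableType d) {R : realType} (mu : {measure set T -> \bar R}).
Import Normc.
Local Open Scope ereal_scope.

Lemma cnorm2_lt (f : T -> bC R) (e : R) : (0 < e)%R ->
  (cnorm mu 2%:E setT f < e%:E) = (sqr_integral mu f < (e ^+ 2)%:E).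
Proof.
move=> e0; rewrite -sqr_cnorm2; have := cnorm2_ge0 mu f.
case: (cnorm _ _ _ _) => [r| |//]; last by rewrite mulyy.
by rewrite lee_fin => r0; rewrite -EFinM !lte_fin -expr2 ltr_pXn2r ?nnegrE// ltW.
Qed.

Lemma cnorm2_cvg0P (u : nat -> T -> bC R) :
  cnorm mu 2%:E setT (u k) @[k --> \oo] --> 0 <-> sqr_integral mu (u k) @[k --> \oo] --> 0.
Proof.
rewrite !ge0_cvge0P => [|k|k]; [|exact: sqr_integral_ge0|exact: cnorm2_ge0].
split=> h e e0.
  have := h (Num.sqrt e); rewrite sqrtr_gt0 => /(_ e0); apply: filterS => k.
  by rewrite cnorm2_lt ?sqrtr_gt0// sqr_sqrtr// ltW.
by have := h (e ^+ 2)%R (exprn_gt0 2 e0); apply: filterS => k; rewrite cnorm2_lt.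
Qed.

(** Almost everywhere the limit is also the lower limit, so Fatou's lemma bounds its integral by the
    lower limit of the integrals, each of which is at most [c]. This is how Cauchy estimates are
    passed to a pointwise limit below. *)
Lemma fatou_le (a_ : nat -> T -> \bar R) (a : T -> \bar R) (c : \bar R) :
  (forall j, measurable_fun setT (a_ j)) -> (forall j x, 0 <= a_ j x) ->
  measurable_fun setT a -> (forall x, 0 <= a x) ->
  {ae mu, forall x, a_ ^~ x @ \oo --> a x} ->
  (forall j, \int[mu]_x a_ j x <= c) -> \int[mu]_x a x <= c.
Proof.
move=> ma a0 ma' a0' aa ac.
have -> : \int[mu]_x a x = \int[mu]_x limn_einf (a_^~ x).
  apply: ge0_ae_eq_integral => //.
  - rewrite (_ : (fun _ => _) = (fun x => - limn_esup (fun j => - a_ j x))).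
      apply: measurableT_comp => //; apply: measurable_fun_limn_esup => j.
      exact: measurableT_comp.
    by apply/funext => x; rewrite -[limn_esup _]/(limn_esup (-%E \o a_^~ x)) limn_esupN oppeK.
  - move=> x _; rewrite limn_einf_lim; apply: lime_ge; first exact: is_cvg_einfs.
    by apply: nearW => k; apply/ereal_infP => _ [j _ <-].
  - apply: filterS aa => x xa _; apply/esym.
    by rewrite is_cvg_limn_einfE; [apply/cvg_lim|apply: cvgP xa].
apply: le_trans (fatou _ _ _ _) _ => //.
apply: le_trans (limn_einf_sup _) _.
rewrite limn_esup_lim; apply: lime_le; first exact: is_cvg_esups.
by apply: nearW => k; apply/ereal_supP => _ [j _ <-].
Qed.

End convergence_L2.

Section restriction_convergence.
Context d (T : measurableType d) {R : realType} (mu : {measure set T -> \bar R}).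
Import Normc.
Local Open Scope ereal_scope.

(** Truncation is written as a product with the indicator, so that measurability and moduli are
    those of products. *)
Definition crestrict (E : set T) (f : T -> bC R) : T -> bC R := fun x => ((\1_E x)%:C * f x)%R.

Lemma cmeasurable_crestrict E f : measurable E -> measurable_fun setT f ->
  measurable_fun setT (crestrict E f).
Proof.
by move=> mE mf; apply: cmeasurableM => //; apply: cmeasurable_real; exact: measurable_indic.
Qed.

Lemma normc_indic (E : set T) x : normc ((\1_E x)%:C : R[i]) = \1_E x.
Proof. by rewrite normc_real ger0_norm. Qed.

Lemma normc_crestrict_le E f x : (normc (crestrict E f x) <= normc (f x))%R.
Proof.
rewrite /crestrict normcM normc_indic ler_piMl ?normc_ge0//.
Qed.

Lemma normc_sub_crestrict E f x :
  (normc (f x - crestrict E f x) = \1_(~` E) x * normc (f x))%R.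
Proof.
rewrite /crestrict !indicE in_setC; case: (x \in E).
  by rewrite mul1r subrr normc0 /= mul0r.
by rewrite mul0r subr0 mul1r.
Qed.

(** Dominated convergence: at each point the integrand is eventually 0, and [u] itself is the
    majorant. *)
Lemma integral_indic_cvg0 (u : T -> R) (E : nat -> set T) :
  (forall k, measurable (E k)) -> measurable_fun setT u -> (forall x, 0 <= u x)%R ->
  \int[mu]_x (u x)%:E < +oo -> (forall x, \forall k \near \oo, E k x) ->
  \int[mu]_x (\1_(~` (E k)) x * u x)%:E @[k --> \oo] --> 0.
Proof.
move=> mE mu_ u0 ufin Ex.
have ui : mu.-integrable setT (EFin \o u).
  apply/integrableP; split; first exact/measurable_EFinP.
  by under eq_integral do rewrite /= ger0_norm//.
have mk k : measurable_fun setT (fun x => (\1_(~` (E k)) x * u x)%:E).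
  apply/measurable_EFinP; apply: measurable_funM => //; apply: measurable_indic.
  exact: measurableC.
have cvg0 : {ae mu, forall x, setT x -> (\1_(~` (E k)) x * u x)%:E @[k --> \oo] --> (cst 0 x : \bar R)}.
  apply: aeW => x _; apply: cvg_near_cst; apply: filterS (Ex x) => k Ekx.
  by rewrite indicE in_setC mem_set//= mul0r.
have dom : {ae mu, forall x k, setT x -> `|(\1_(~` (E k)) x * u x)%:E| <= (EFin \o u) x}.
  apply: aeW => x k _; rewrite /= lee_fin normrM [X in (_ * X)%R]ger0_norm// ler_piMl//.
  by rewrite ger0_norm// indicE; case: (x \in _).
have [_ _] := dominated_convergence measurableT mk (measurable_cst _) cvg0 ui dom.
by rewrite integral0.
Qed.

Lemma sqr_integral_crestrict_cvg f (E : nat -> set T) : cLfun mu 2%:E setT f ->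
  (forall k, measurable (E k)) -> (forall x, \forall k \near \oo, E k x) ->
  sqr_integral mu (fun x => f x - crestrict (E k) f x)%R @[k --> \oo] --> 0.
Proof.
move=> /cLfun2P[mf f2] mE Ex.
have := @integral_indic_cvg0 (fun x => normc (f x) ^+ 2)%R E mE _ _ f2 Ex.
move=> /(_ (measurable_funX 2 (cmeasurable_normc mf)) (fun x => sqr_ge0 _)).
apply: cvg_trans; apply: near_eq_cvg; apply: nearW => k; apply: eq_integral => x _.
rewrite normc_sub_crestrict exprMn indicE; case: (x \in _) => /=.
  by rewrite expr1n.
by rewrite expr0n.
Qed.

Lemma l1_crestrict_cvg f (E : nat -> set T) : cintegrable mu f ->
  (forall k, measurable (E k)) -> (forall x, \forall k \near \oo, E k x) ->
  \int[mu]_x (normc (f x - crestrict (E k) f x)%R)%:E @[k --> \oo] --> 0.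
Proof.
move=> [mf f1] mE Ex.
have := @integral_indic_cvg0 (fun x => normc (f x)) E mE _ _ f1 Ex.
move=> /(_ (cmeasurable_normc mf) (fun x => normc_ge0 _)).
apply: cvg_trans; apply: near_eq_cvg; apply: nearW => k; apply: eq_integral => x _.
by rewrite normc_sub_crestrict.
Qed.

Lemma cLfun2_crestrict E f : measurable E -> cLfun mu 2%:E setT f ->
  cLfun mu 2%:E setT (crestrict E f).
Proof.
move=> mE /cLfun2P[mf f2]; apply/cLfun2P; split; first exact: cmeasurable_crestrict.
apply: le_lt_trans f2; apply: le_sqr_integral => // [|x].
  exact: cmeasurable_crestrict.
exact: normc_crestrict_le.
Qed.

(** On a set of finite measure L^2 is contained in L^1: the indicator of [E] is then in L^2, and
    Cauchy-Schwarz applies. *)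
Lemma cintegrable_crestrict E f : measurable E -> mu E < +oo ->
  cLfun mu 2%:E setT f -> cintegrable mu (crestrict E f).
Proof.
move=> mE Efin f2; apply: cintegrable_mul => //.
apply/cLfun2P; split; first by apply: cmeasurable_real; exact: measurable_indic.
apply: le_lt_trans Efin; apply: eq_lee.
rewrite -[in RHS](setIT E) -integral_indic//; apply: eq_integral => x _.
by rewrite normc_indic indicE; case: (x \in E); rewrite ?expr1n ?expr0n.
Qed.

End restriction_convergence.

(** * The Plancherel theorem on the line *)

Section lebesgue_affine.
Context {R : realType}.
Local Notation mu := (@lebesgue_measure R).
Local Notation RT := (measurableTypeR R).
Local Open Scope ereal_scope.

Lemma measurable_affine (a b : R) : measurable_fun setT (fun x : RT => a * x + b : RT)%R.
Proof. by apply: measurable_funD => //; exact: mulrl_measurable. Qed.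

Lemma ge0_integral_scale_shift (a b : R) (f : RT -> \bar R) : (0 < a)%R ->
  measurable_fun setT f -> (forall x, 0 <= f x) ->
  \int[mu]_x f (a * x + b)%R = a^-1%:E * \int[mu]_x f x.
Proof.
move=> a0 mf f0.
have ai0 : (0 <= a^-1)%R by rewrite invr_ge0 ltW.
pose phi (x : RT) : RT := (a * x + b)%R.
have mphi : measurable_fun setT phi by exact: measurable_affine.
pose m := pushforward mu phi.
transitivity (\int[m]_x f x).
  by rewrite (ge0_integral_pushforward mphi).
rewrite -(ge0_integral_mscale mu measurableT (NngNum ai0) mf)//.
apply: eq_measure_integral => /= A mA _; apply/esym.
(* Lebesgue measure is determined by half-open intervals, and [phi] pulls such an interval back to
   one whose length is divided by [a]; rescaling by [a] restores the length. *)
have h : (forall X, ocitv X -> mu X = mscale (NngNum (ltW a0)) m X).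
  move=> m0 X [[x y] _ <-].
  rewrite /mscale /= /m /pushforward.
  rewrite (_ : phi @^-1` _ = `](x - b) / a, (y - b) / a]%classic)%R; last first.
    apply/seteqP; split => t /=; rewrite !in_itv/= /phi => /andP[h1 h2].
      by rewrite ltr_pdivrMr// ler_pdivlMr// ltrBlDr lerBrDr mulrC h1.
    move: h1 h2; rewrite ltr_pdivrMr// ler_pdivlMr// ltrBlDr lerBrDr mulrC.
    by move=> -> ->.
  rewrite !lebesgue_measure_itv/= !lte_fin ltr_pM2r ?invr_gt0// ltrD2r.
  case: ifPn => xy; last by rewrite mule0.
  rewrite -EFinD -EFinM; congr EFin; field; exact: lt0r_neq0.
rewrite /mscale /=.
rewrite (lebesgue_measure_unique (h mphi) mA) /mscale /= muleA -EFinM mulVf ?mul1e//.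
exact: lt0r_neq0.
Qed.

Lemma ge0_integral_opp (f : RT -> \bar R) :
  measurable_fun setT f -> (forall x, 0 <= f x) ->
  \int[mu]_x f (- x)%R = \int[mu]_x f x.
Proof.
move=> mf f0; have mN : measurable_fun setT (fun x : RT => - x : RT)%R by exact: oppr_measurable.
transitivity (\int[pushforward mu (fun x : RT => - x : RT)%R]_x f x).
  by rewrite (ge0_integral_pushforward mN).
by apply: eq_measure_integral => /= A mA _; exact: lebesgue_measureN.
Qed.

Lemma ge0_integral_affine (a b : R) (f : RT -> \bar R) : (a != 0)%R ->
  measurable_fun setT f -> (forall x, 0 <= f x) ->
  \int[mu]_x f (a * x + b)%R = `|a|^-1%:E * \int[mu]_x f x.
Proof.
move=> a0 mf f0; have [ap|an] := ltP 0%R a; first by rewrite ge0_integral_scale_shift// gtr0_norm.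
have an0 : (0 < - a)%R by rewrite oppr_gt0 lt_neqAle a0.
rewrite ler0_norm// -(ge0_integral_scale_shift b)// -[RHS]ge0_integral_opp.
- by apply: eq_integral => x _; rewrite mulrNN.
- by apply: measurableT_comp => //; exact: measurable_affine.
- by move=> x.
Qed.

End lebesgue_affine.

(** * The Poisson kernel as the transform of exp(-|x|) *)

Section poisson_kernel.
Context {R : realType}.
Local Notation mu := (@lebesgue_measure R).
Local Notation RT := (measurableTypeR R).

(** A primitive of exp(-x) (1 + cos(b x)). The summand 1 makes the integrand nonnegative, as the
    fundamental theorem of calculus on a half-line requires here; its contribution is subtracted
    again in [fourier_exp_kernel]. *)
Let prim (b x : R) : R :=
  - expR (- x) + expR (- x) * ((b * sin (b * x) - cos (b * x)) / (1 + b ^+ 2)).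

Let b0 (b : R) : 1 + b ^+ 2 != 0.
Proof. by rewrite gt_eqF// ltr_pwDl// sqr_ge0. Qed.

Let is_derive_prim (b x : R) :
  is_derive x (1 : R) (prim b) (expR (- x) * (1 + cos (b * x))).
Proof.
rewrite /prim; apply: is_derive_eq.
rewrite /GRing.scale /=; field; exact: b0.
Qed.

Let prim_cvg b : prim b x @[x --> +oo] --> 0.
Proof.
pose C := 1 + (`|b| + 1) / (1 + b ^+ 2).
have h x : `|prim b x| <= C * expR (- x).
  rewrite /prim [C * _]mulrC /C mulrDr mulr1 (le_trans (ler_normD _ _))//.
  rewrite normrN normrM ger0_norm ?expR_ge0// lerD2l ler_wpM2l ?expR_ge0//.
  have b1 : 0 < 1 + b ^+ 2 by rewrite ltr_pwDl// sqr_ge0.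
  rewrite normrM [`|_^-1|]gtr0_norm ?invr_gt0// ler_wpM2r ?invr_ge0 ?(ltW b1)//.
  rewrite (le_trans (ler_normB _ _))// lerD//; last by rewrite ler_norml cos_le1 cos_geN1.
  by rewrite normrM ler_piMr// ler_norml sin_le1 sin_geN1.
apply/norm_cvg0P.
apply: (@squeeze_cvgr _ _ _ _ (fun _ => 0) (fun x => C * expR (- x))).
- by apply: nearW => x; rewrite normr_ge0 h.
- exact: cvg_cst.
- by rewrite -[X in _ --> X](mulr0 C); apply: cvgM; [exact: cvg_cst|exact: cvgr_expR].
Qed.

Let continuous_integrand b : continuous (fun x : R => expR (- x) * (1 + cos (b * x))).
Proof.
move=> x; apply: cvgM.
  by apply: continuous_comp; [exact: opp_continuous|exact: continuous_expR].
apply: cvgD; first exact: cvg_cst.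
by apply: continuous_comp; [exact: mulrl_continuous|exact: continuous_cos].
Qed.

Lemma integral_expR_cos_half b :
  (\int[mu]_(x in `[0%R, +oo[) (expR (- x) * (1 + cos (b * x)))%:E = (1 + (1 + b ^+ 2)^-1)%:E)%E.
Proof.
rewrite (@ge0_continuous_FTC2y _ _ (prim b) _ 0).
- rewrite -EFinB /prim oppr0 expR0 !mulr0 sin0 cos0; congr EFin; field; exact: b0.
- move=> x _; rewrite mulr_ge0 ?expR_ge0//; have := cos_geN1 (b * x); lra.
- apply: continuous_subspaceT; exact: continuous_integrand.
- exact: prim_cvg.
- by move=> x _; have [] := is_derive_prim b x.
- apply/cvg_at_right_filter/differentiable_continuous/derivable1_diffP; by have [] := is_derive_prim b 0.
- by move=> x _; rewrite derive1E; have [_ ->] := is_derive_prim b x.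
Qed.

Let continuous_even (h : R -> R) : continuous h -> continuous (fun x => expR (- `|x|) * h x).
Proof.
move=> ch x; apply: cvgM; last exact: ch.
apply: continuous_comp; last exact: continuous_expR.
apply: continuous_comp; [exact: norm_continuous|exact: opp_continuous].
Qed.

Lemma integral_expR_cos b :
  (\int[mu]_x (expR (- `|x|) * (1 + cos (b * x)))%:E = (2 * (1 + (1 + b ^+ 2)^-1))%:E)%E.
Proof.
rewrite ge0_symfun_integralT.
- rewrite EFinM -integral_expR_cos_half; congr (_ * _)%E.
  rewrite set_itvcy; apply: eq_integral => x; rewrite inE /= => x0.
  by rewrite ger0_norm.
- by move=> x; rewrite mulr_ge0 ?expR_ge0//; have := cos_geN1 (b * x); lra.
- apply: continuous_even => x; apply: cvgD; first exact: cvg_cst.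
  by apply: continuous_comp; [exact: mulrl_continuous|exact: continuous_cos].
- by move=> x; rewrite /= normrN mulrN cosN.
Qed.

Lemma integral_expR_abs : (\int[mu]_x (expR (- `|x|))%:E = 2%:E)%E.
Proof.
(* At b = 0 the integrand of [integral_expR_cos] is twice the kernel. The identity 2 I = 4 also
   excludes the infinite values of I. *)
have : (2%:E * \int[mu]_x (expR (- `|x|))%:E = 4%:E :> \bar R)%E.
  rewrite -ge0_integralZl_EFin//.
  - have e4 : 2 * (1 + (1 + 0 ^+ 2)^-1) = 4 :> R by rewrite expr0n/= addr0 invr1; lra.
    rewrite -e4 -integral_expR_cos; apply: eq_integral => x _; rewrite -EFinM; congr EFin.
    by rewrite mul0r cos0 mulrC.
  - apply/measurable_EFinP; apply: continuous_measurable_fun => x.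
    apply: continuous_comp; last exact: continuous_expR.
    by apply: continuous_comp; [exact: norm_continuous|exact: opp_continuous].
have e4 : 4 = 2 * 2 :> R by lra.
case: (\int[mu]_x _)%E => [r| |].
- by rewrite -EFinM e4 => -[/mulfI ->//]; rewrite ?pnatr_eq0.
- by rewrite mulry gtr0_sg// mul1e.
- by rewrite mulrNy gtr0_sg// mul1e.
Qed.

Definition exp_kernel (x : RT) : R := expR (- `|x|).

Lemma measurable_exp_kernel : measurable_fun setT exp_kernel.
Proof.
apply: (measurableT_comp (@measurable_expR R)); apply: measurable_funN.
exact: normr_measurable.
Qed.

Lemma exp_kernel_ge0 x : 0 <= exp_kernel x. Proof. exact: expR_ge0. Qed.

Lemma integrable_exp_kernel : mu.-integrable setT (EFin \o exp_kernel).
Proof.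
apply/integrableP; split; first by apply/measurable_EFinP; exact: measurable_exp_kernel.
under eq_integral do rewrite /= ger0_norm ?exp_kernel_ge0//.
by rewrite [ltLHS]integral_expR_abs ltry.
Qed.

Lemma cintegrable_exp_kernel (u : R) :
  cintegrable mu (fun x : RT => (exp_kernel x)%:C * expi (u * x)).
Proof.
apply: (@cintegrable_bounded _ _ _ _ _ _ 1).
- split; first by apply: cmeasurable_real; exact: measurable_exp_kernel.
  under eq_integral do rewrite normc_real ger0_norm ?exp_kernel_ge0//.
  by rewrite integral_expR_abs ltry.
- by apply: cmeasurable_expi; exact: mulrl_measurable.
- by move=> x; rewrite normc_expi.
Qed.

Lemma Re_mulC_real (r : R) (z : R[i]) : complex.Re (r%:C * z) = r * complex.Re z.
Proof. by rewrite ReM /= mul0r subr0. Qed.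

Lemma Im_mulC_real (r : R) (z : R[i]) : complex.Im (r%:C * z) = r * complex.Im z.
Proof. by rewrite ImM /= mul0r addr0. Qed.

(** The transform of exp(-|x|) at frequency [u], with 2 pi in the exponent of the characters. *)
Definition poisson_kernel (u : RT) : R := 2 / (1 + (2 * pi * u) ^+ 2).

Lemma fourier_exp_kernel (u : R) :
  cintegral mu (fun x : RT => (exp_kernel x)%:C * expi (u * x)) = (poisson_kernel u)%:C.
Proof.
have fi := cintegrable_exp_kernel u.
rewrite /cintegral; congr (_ +i* _).
  under eq_Rintegral do rewrite Re_mulC_real.
  have ki := integrable_exp_kernel.
  have kci : mu.-integrable setT (EFin \o (fun x : RT => exp_kernel x * cos (2 * pi * u * x))).
    have := cintegrable_Re fi; apply: eq_integrable => // x _ /=.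
    by rewrite mul0r subr0 mulrA.
  have : \int[mu]_x (exp_kernel x + exp_kernel x * cos (2 * pi * u * x)) = 2 * (1 + (1 + (2 * pi * u) ^+ 2)^-1).
    rewrite /Rintegral -[RHS]/(fine (_%:E)) -integral_expR_cos; congr fine.
    by apply: eq_integral => x _; rewrite [in RHS]mulrDr mulr1.
  rewrite RintegralD//= {1}/Rintegral integral_expR_abs /=.
  rewrite (_ : \int[mu]_x _ = \int[mu]_x (exp_kernel x * complex.Re (expi (u * x)))).
    move: (Rintegral _ _ _) => I /(congr1 (fun x => x - 2)) ; rewrite /poisson_kernel.
    by rewrite [LHS]addrC addKr => ->; ring.
  by apply: eq_Rintegral => x _; rewrite /= mulrA.
under eq_Rintegral do rewrite Im_mulC_real.
(* The imaginary part is the integral of an odd function: the reflection x -> -x shows that it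
   equals its own opposite. *)
have sub (f : RT -> \bar R) : measurable_fun setT f -> (forall x, 0 <= f x)%E ->
    (\int[mu]_x f (- x)%R = 1%:E * \int[mu]_y f y)%E.
  by move=> mf f0; rewrite ge0_integral_opp// mul1e.
have si : mu.-integrable setT (EFin \o (fun x : RT => exp_kernel x * complex.Im (expi (u * x)))).
  have := cintegrable_Im fi; apply: eq_integrable => // x _.
  by rewrite /= mul0r addr0.
have := Rintegral_substitution sub si.
under eq_Rintegral do rewrite /exp_kernel normrN mulrN expiN ImJ mulrN -mulN1r.
rewrite RintegralZl// mul1r; move: (Rintegral _ _ _) => I h; lra.
Qed.

End poisson_kernel.

Section poisson_integral.
Context {R : realType}.
Local Notation mu := (@lebesgue_measure R).
Local Notation RT := (measurableTypeR R).

Let pi20 : 0 < 2 * pi :> R. Proof. by rewrite mulr_gt0// pi_gt0. Qed.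

Let poisson_den (x : R) : 0 < 1 + (2 * pi * x) ^+ 2.
Proof. by rewrite ltr_pwDl// sqr_ge0. Qed.

Lemma poisson_kernel_ge0 (x : R) : 0 <= poisson_kernel x.
Proof. by rewrite divr_ge0// ltW. Qed.

Lemma poisson_kernel_le2 (x : R) : poisson_kernel x <= 2.
Proof.
by rewrite ler_pdivrMr// mulrDr mulr1 lerDl mulr_ge0// sqr_ge0.
Qed.

Let continuous_poisson : continuous (poisson_kernel : R -> R).
Proof.
move=> x; apply: cvgM; first exact: cvg_cst.
apply: cvgV; first by rewrite gt_eqF.
apply: cvgD; first exact: cvg_cst.
by apply: cvgM; exact: mulrl_continuous.
Qed.

Lemma measurable_poisson_kernel : measurable_fun setT (poisson_kernel : RT -> R).
Proof. exact: continuous_measurable_fun continuous_poisson. Qed.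

Let prim (x : R) : R := pi^-1 * atan (2 * pi * x).

Let is_derive_prim (x : R) : is_derive x (1 : R) prim (poisson_kernel x).
Proof.
rewrite /prim; apply: is_derive_eq; rewrite /GRing.scale /= /poisson_kernel.
have := poisson_den x; have := @pi_gt0 R; move: (pi : R) => p p0 h.
by field; rewrite ?gt_eqF.
Qed.

(** Each half-line carries mass 1/2. Total mass 1 is what makes the dilates m P(m t) an approximate
    identity. *)
Lemma integral_poisson_kernel : (\int[mu]_x (poisson_kernel x)%:E = 1)%E.
Proof.
rewrite ge0_symfun_integralT; last 3 first.
- exact: poisson_kernel_ge0.
- exact: continuous_poisson.
- by move=> x; rewrite /= /poisson_kernel mulrN sqrrN.
rewrite -set_itvcy (@ge0_continuous_FTC2y _ _ prim _ 2^-1).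
- by rewrite /prim mulr0 atan0 mulr0 -EFinB subr0 -EFinM mulfV.
- by move=> x _; exact: poisson_kernel_ge0.
- by apply: continuous_subspaceT.
- rewrite (_ : 2^-1 = pi^-1 * (pi / 2)); last first.
    by rewrite mulrA mulVf ?mul1r// gt_eqF// pi_gt0.
  apply: cvgM; first exact: cvg_cst.
  apply: (@cvg_comp _ _ _ (fun x => 2 * pi * x) atan _ (pinfty_nbhs R)); last exact: cvgy_atan.
  exact: gt0_cvgMry.
- by move=> x _; have [] := is_derive_prim x.
- apply/cvg_at_right_filter/differentiable_continuous/derivable1_diffP.
  by have [] := is_derive_prim 0.
- by move=> x _; rewrite derive1E; have [_ ->] := is_derive_prim x.
Qed.

Lemma cintegrable_poisson_kernel : cintegrable mu (fun x : RT => (poisson_kernel x)%:C).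
Proof.
split; first by apply: cmeasurable_real; exact: measurable_poisson_kernel.
under eq_integral do rewrite normc_real ger0_norm ?poisson_kernel_ge0//.
by rewrite [ltLHS]integral_poisson_kernel ltry.
Qed.

End poisson_integral.

(** * Plancherel on the line for bounded continuous functions *)

Section plancherel_line_continuous.
Context {R : realType}.
Local Notation mu := (@lebesgue_measure R).
Local Notation RT := (measurableTypeR R).
Import Normc.

(** The transform on R itself rather than on column vectors of length 1, so that the induction on
    the dimension can apply it to functions of the first coordinate. *)
Definition fourier_line (F : RT -> bC R) (s : RT) : bC R :=
  cintegral mu (fun x : RT => F x * expi (- (s * x))).

Lemma measurable_mulR d (T : measurableType d) (f g : T -> RT) :
  measurable_fun setT f -> measurable_fun setT g ->
  measurable_fun setT (fun x => f x * g x : RT).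
Proof. by move=> mf mg; exact: measurable_funM. Qed.

Lemma measurable_fourier_line F : measurable_fun setT F ->
  measurable_fun setT (fourier_line F).
Proof.
move=> mF; apply: (@measurable_cintegral_snd _ _ RT RT R mu (fun z => F z.2 * expi (- (z.1 * z.2)))).
apply: cmeasurableM; first exact: (measurableT_comp mF measurable_snd).
apply: cmeasurable_expi; apply: measurable_funN; apply: measurable_mulR.
  exact: measurable_fst.
exact: measurable_snd.
Qed.

Lemma cintegrable_character (F : RT -> bC R) (s : R) : cintegrable mu F ->
  cintegrable mu (fun x : RT => F x * expi (- (s * x))).
Proof.
move=> Fi; apply: (@cintegrable_bounded _ _ _ _ _ _ 1) => //.
  by apply: cmeasurable_expi; apply: measurable_funN; exact: mulrl_measurable.
by move=> x; rewrite normc_expi.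
Qed.

Lemma normc_fourier_line_le_integral (F : RT -> bC R) s : cintegrable mu F ->
  ((normc (fourier_line F s))%:E <= \int[mu]_x (normc (F x))%:E)%E.
Proof.
move=> Fi; apply: (le_trans (normc_cintegral_le (cintegrable_character s Fi))).
by apply/eq_lee/eq_integral => x _; rewrite normcM normc_expi mulr1.
Qed.

Variables (F : RT -> bC R) (B : R).
Hypothesis Fi : cintegrable mu F.
Hypothesis FB : forall x, normc (F x) <= B.
Let mF : measurable_fun setT F := proj1 Fi.
Let mu2 := prod_measure mu mu.

(* Damping the spectrum by exp(-|s|/m) makes Fubini's theorem applicable and
   turns the squared norm of the transform into a Poisson average of F. *)
Let damped (m : R) (s : RT) (z : RT * RT) : bC R :=
  (exp_kernel (s / m))%:C * (F z.1 * (F z.2)^*%C * expi (s * (z.2 - z.1))).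

Let measurable_div (m : R) : measurable_fun setT (fun s : RT => s / m : RT).
Proof. exact: mulrr_measurable. Qed.

Let substitution_div (m : R) : 0 < m -> forall f : RT -> \bar R, measurable_fun setT f ->
  (forall x, 0 <= f x)%E -> (\int[mu]_x f (x / m)%R = m%:E * \int[mu]_y f y)%E.
Proof.
move=> m0 f mf f0; have := ge0_integral_affine 0 (lt0r_neq0 _) mf f0.
move=> /(_ m^-1); rewrite invr_gt0 => /(_ m0).
rewrite gtr0_norm ?invr_gt0// invrK => <-.
by apply: eq_integral => x _; rewrite addr0 mulrC.
Qed.

Let integrable_exp_div (m : R) : 0 < m ->
  cintegrable mu (fun s : RT => (exp_kernel (s / m))%:C).
Proof.
move=> m0.
apply: (cintegrable_substitution (ltW m0) (measurable_div m) (substitution_div m0)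
  (F := fun s => (exp_kernel s)%:C)).
rewrite (_ : (fun _ => _) = (fun x : RT => (exp_kernel x)%:C * expi (0 * x))).
  exact: cintegrable_exp_kernel.
by apply/funext => x; rewrite mul0r expi0 mulr1.
Qed.

Let cintegrable_damped (m : R) : 0 < m ->
  cintegrable (mu \x mu2)%E (fun w => damped m w.1 w.2).
Proof.
move=> m0.
have h2 : cintegrable mu2 (fun z => F z.1 * (F z.2)^*%C).
  by apply: (cintegrable_tensor Fi (cintegrable_conj Fi)).
have h := cintegrable_tensor (integrable_exp_div m0) h2.
apply: (le_cintegrable _ h).
  apply: cmeasurableM.
    apply: cmeasurable_real; apply: (measurableT_comp measurable_exp_kernel).
    by apply: (measurableT_comp (measurable_div m)); exact: measurable_fst.
  apply: cmeasurableM.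
    apply: (measurableT_comp (f := fun z => F z.1 * (F z.2)^*%C : bC R)); first by case: h2.
    exact: measurable_snd.
  apply: cmeasurable_expi; apply: measurable_mulR; first exact: measurable_fst.
  apply: measurable_funB.
    exact: (measurableT_comp measurable_snd measurable_snd).
  exact: (measurableT_comp measurable_fst measurable_snd).
by move=> w; rewrite /damped !normcM normc_expi mulr1.
Qed.

(** The squared modulus of the transform is the transform times its conjugate, hence a double
    integral of F(x) conj(F(y)) against the character of y - x. *)
Let cintegral_damped_space (m : R) (s : R) :
  cintegral mu2 (damped m s) = (exp_kernel (s / m) * normc (fourier_line F s) ^+ 2)%:C.
Proof.
have Fsi := cintegrable_character s Fi.
rewrite complexrM -mul_conj /fourier_line -cintegral_conj//.
rewrite -(cintegral_tensor Fsi (cintegrable_conj Fsi)) -cintegralZ; last first.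
  exact: (cintegrable_tensor Fsi (cintegrable_conj Fsi)).
apply: eq_cintegral => z; rewrite /damped; congr (_ * _).
rewrite conjcM -expiN opprK mulrACA -expiD; congr (_ * expi _); ring.
Qed.

(** With s = m t, the integral over the frequency is the transform of exp(-|t|) at m (y - x), with
    Jacobian m. *)
Let cintegral_damped_frequency (m : R) (z : RT * RT) : 0 < m ->
  cintegral mu (fun s => damped m s z) =
  F z.1 * ((F z.2)^*%C * (m * poisson_kernel (m * (z.2 - z.1)))%:C).
Proof.
move=> m0; rewrite complexrM -fourier_exp_kernel.
have ei := cintegrable_exp_kernel (m * (z.2 - z.1)).
rewrite -(cintegral_substitution (substitution_div m0) ei).
have ei' := cintegrable_substitution (ltW m0) (measurable_div m) (substitution_div m0) ei.
rewrite mulrA -cintegralZ//; apply: eq_cintegral => s; rewrite /damped mulrCA.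
congr (_ * (_ * expi _)); field; exact: lt0r_neq0.
Qed.

(** The integrand after y = x + t / m. The kernel no longer depends on m, only the argument of F
    does; so B |F(x)| P(t) is a majorant for all m at once, and continuity of F gives the pointwise
    limit |F(x)|^2 P(t). *)
Let shifted (m : R) (z : RT * RT) : bC R :=
  F z.1 * ((F (z.1 + z.2 / m))^*%C * (poisson_kernel z.2)%:C).

Let measurable_shift (m : R) : measurable_fun setT (fun z : RT * RT => z.1 + z.2 / m : RT).
Proof.
apply: measurable_funD; first exact: measurable_fst.
exact: (measurableT_comp (measurable_div m) measurable_snd).
Qed.

Let cintegrable_shifted (m : R) : cintegrable (mu \x mu)%E (shifted m).
Proof.
have h := cintegrable_tensor (cintegrableZ (B%:C) Fi) (@cintegrable_poisson_kernel R).
apply: (le_cintegrable _ h).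
  apply: cmeasurableM; first exact: (measurableT_comp mF measurable_fst).
  apply: cmeasurableM.
    by apply: cmeasurable_conj; exact: (measurableT_comp mF (measurable_shift m)).
  apply: cmeasurable_real.
  exact: (measurableT_comp (@measurable_poisson_kernel R) measurable_snd).
move=> z; rewrite /shifted !normcM mulrA ler_wpM2r ?normc_ge0//.
rewrite mulrC ler_wpM2r ?normc_ge0// normc_conj normc_real.
exact: le_trans (ler_norm _).
Qed.

Let cintegral_space_poisson (m : R) (x : R) : 0 < m ->
  cintegral mu (fun y : RT => (F y)^*%C * (m * poisson_kernel (m * (y - x)))%:C) =
  cintegral mu (fun t : RT => (F (x + t / m))^*%C * (poisson_kernel t)%:C).
Proof.
move=> m0.
have sub (f : RT -> \bar R) : measurable_fun setT f -> (forall x, 0 <= f x)%E ->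
    (\int[mu]_t f (x + t / m)%R = m%:E * \int[mu]_y f y)%E.
  move=> mf f0; have := ge0_integral_affine x (lt0r_neq0 _) mf f0.
  move=> /(_ m^-1); rewrite invr_gt0 => /(_ m0).
  rewrite gtr0_norm ?invr_gt0// invrK => <-.
  by apply: eq_integral => t _; rewrite addrC mulrC.
have ms : measurable_fun setT (fun t : RT => x + t / m : RT).
  by apply: measurable_funD => //; exact: measurable_div.
have Pi : cintegrable mu (fun y : RT => (F y)^*%C * (poisson_kernel (m * (y - x)))%:C).
  apply: (@cintegrable_bounded _ _ _ _ _ _ 2).
  - exact: cintegrable_conj.
  - apply: cmeasurable_real; apply: (measurableT_comp (@measurable_poisson_kernel R)).
    apply: (measurableT_comp (f := fun y : RT => m * y : RT)); first exact: mulrl_measurable.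
    exact: measurable_funB.
  - by move=> y; rewrite normc_real ger0_norm ?poisson_kernel_ge0 ?poisson_kernel_le2.
have := cintegral_substitution sub Pi.
rewrite -cintegralZ// => h; transitivity
  (cintegral mu (fun t : RT => (F (x + t / m))^*%C * (poisson_kernel (m * (x + t / m - x)))%:C)).
  rewrite h; apply: eq_cintegral => y; rewrite complexrM; ring.
apply: eq_cintegral => t; congr (_ * (poisson_kernel _)%:C); field; exact: lt0r_neq0.
Qed.

Lemma damped_fourier_line (m : R) : 0 < m ->
  (\int[mu]_s (exp_kernel (s / m) * normc (fourier_line F s) ^+ 2))%R =
  (\int[(mu \x mu)%E]_z complex.Re (shifted m z))%R.
Proof.
move=> m0.
have Di := cintegrable_damped m0.
transitivity (complex.Re (cintegral mu (fun s => cintegral mu2 (damped m s)))).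
  rewrite /cintegral /=; apply: eq_Rintegral => s _.
  by rewrite -[LHS]/(complex.Re ((_ * _)%:C)) -cintegral_damped_space.
transitivity (complex.Re (cintegral (mu \x mu)%E (shifted m))); last by [].
congr complex.Re.
(* Fubini's theorem makes the frequency the innermost variable, where it yields the Poisson kernel;
   for fixed x the variable y is then replaced by x + t / m. *)
rewrite (cfubini Di) -(cfubini1 (cintegrable_shifted m)).
have Pi : cintegrable (mu \x mu)%E (fun z => F z.1 * ((F z.2)^*%C *
    (m * poisson_kernel (m * (z.2 - z.1)))%:C)).
  have h2 := cintegrable_tensor Fi (cintegrable_conj Fi).
  rewrite (_ : (fun _ => _) = (fun z : RT * RT => (F z.1 * (F z.2)^*%C) *
    (m * poisson_kernel (m * (z.2 - z.1)))%:C)); last by apply/funext => z; rewrite mulrA.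
  apply: (@cintegrable_bounded _ _ _ _ _ _ (m * 2)) => //.
    apply: cmeasurable_real; apply: measurable_mulR => //.
    apply: (measurableT_comp (@measurable_poisson_kernel R)).
    apply: measurable_mulR => //; apply: measurable_funB.
      exact: measurable_snd.
    exact: measurable_fst.
  move=> z; rewrite normc_real ger0_norm; last by rewrite mulr_ge0 ?poisson_kernel_ge0 ?(ltW m0).
  by rewrite ler_pM2l// poisson_kernel_le2.
transitivity (cintegral mu2 (fun z => F z.1 * ((F z.2)^*%C *
    (m * poisson_kernel (m * (z.2 - z.1)))%:C))).
  by apply: eq_cintegral => z; rewrite -(cintegral_damped_frequency z m0).
transitivity (cintegral (mu \x mu)%E (fun z => F z.1 * ((F z.2)^*%C *
    (m * poisson_kernel (m * (z.2 - z.1)))%:C))); first by [].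
rewrite -(cfubini1 Pi); apply: eq_cintegral => x /=.
rewrite cintegralZ ?cintegral_space_poisson//; last first.
  apply: (@cintegrable_bounded _ _ _ _ _ _ (m * 2)).
  - exact: cintegrable_conj.
  - apply: cmeasurable_real; apply: measurable_mulR => //.
    apply: (measurableT_comp (@measurable_poisson_kernel R)).
    by apply: measurable_mulR => //; exact: measurable_funB.
  - move=> y; rewrite normc_real ger0_norm; last by rewrite mulr_ge0 ?poisson_kernel_ge0 ?(ltW m0).
    by rewrite ler_pM2l// poisson_kernel_le2.
rewrite -cintegralZ//; rewrite [X in cintegrable _ X](_ : _ =
  (fun t : RT => (poisson_kernel t)%:C * (F (x + t / m))^*%C)); last first.
  by apply/funext => t; rewrite mulrC.
apply: (@cintegrable_bounded _ _ _ _ _ _ B).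
- exact: cintegrable_poisson_kernel.
- apply: cmeasurable_conj; apply: (measurableT_comp mF).
  by apply: measurable_funD => //; exact: measurable_div.
- by move=> t; rewrite normc_conj.
Qed.

Lemma normc_fourier_line_le s :
  normc (fourier_line F s) <= fine (\int[mu]_x (normc (F x))%:E)%E.
Proof.
have [_ Foo] := Fi; rewrite -lee_fin fineK; last first.
  by rewrite ge0_fin_numE// integral_ge0// => x _; rewrite lee_fin normc_ge0.
exact: normc_fourier_line_le_integral.
Qed.

(** Equality of the real integrals lifts to the extended ones because both are finite: on the left
    the transform is bounded by the L^1 norm of F and the damping factor is integrable. *)
Lemma integral_damped_fourier_line (m : R) : 0 < m ->
  (\int[mu]_s (exp_kernel (s / m) * normc (fourier_line F s) ^+ 2)%:E =
   \int[(mu \x mu)%E]_z (complex.Re (shifted m z))%:E)%E.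
Proof.
move=> m0; have := damped_fourier_line m0; rewrite /Rintegral => h.
rewrite -[LHS]fineK ?h; first rewrite fineK//.
- exact: integrable_fin_num (cintegrable_Re (cintegrable_shifted m)).
- set C := fine (\int[mu]_x (normc (F x))%:E)%E.
  have mFh := measurable_fourier_line mF.
  have bd (x : RT) : normc ((normc (fourier_line F x) ^+ 2)%:C) <= C ^+ 2.
    rewrite normc_real ger0_norm ?sqr_ge0// ler_pXn2r ?nnegrE ?normc_ge0//.
      exact: normc_fourier_line_le.
    by apply: fine_ge0; apply: integral_ge0 => y _; rewrite lee_fin normc_ge0.
  have /cintegrable_Re ii := cintegrable_bounded (integrable_exp_div m0)
    (cmeasurable_real (measurable_funX 2 (cmeasurable_normc mFh))) bd.
  apply: integrable_fin_num => //.
  by apply: eq_integrable ii => // x _ /=; rewrite mul0r subr0.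
Qed.

Hypothesis ReF_cont : continuous ((fun x => complex.Re (F x)) : R -> R).
Hypothesis ImF_cont : continuous ((fun x => complex.Im (F x)) : R -> R).

Let integral_shifted_cvg :
  (\int[(mu \x mu)%E]_z (complex.Re (shifted k.+1%:R z))%:E @[k --> \oo] -->
   sqr_integral mu F)%E.
Proof.
pose H z := ((normc (F z.1) ^+ 2)%:E * (poisson_kernel z.2)%:E)%E.
have -> : sqr_integral mu F = (\int[(mu \x mu)%E]_z H z)%E.
  rewrite (@ge0_integral_tensor _ _ _ _ _ mu mu (fun x : RT => (normc (F x) ^+ 2)%:E)
    (fun x : RT => (poisson_kernel x)%:E)).
  - by rewrite integral_poisson_kernel mule1.
  - exact: cmeasurable_sqr_normc.
  - by apply/measurable_EFinP; exact: measurable_poisson_kernel.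
  - by move=> x; rewrite lee_fin sqr_ge0.
  - by move=> x; rewrite lee_fin poisson_kernel_ge0.
have /cintegrableP[_ gi] := cintegrable_tensor (cintegrableZ (B%:C) Fi) (@cintegrable_poisson_kernel R).
have mHk k : measurable_fun setT (fun z => (complex.Re (shifted k.+1%:R z))%:E).
  exact: measurable_int (cintegrable_Re (cintegrable_shifted k.+1%:R)).
have mH : measurable_fun setT H.
  apply: emeasurable_funM.
    by apply: (measurableT_comp (cmeasurable_sqr_normc mF)); exact: measurable_fst.
  apply/measurable_EFinP; apply: (measurableT_comp (@measurable_poisson_kernel R)).
  exact: measurable_snd.
have cvgH : {ae (mu \x mu)%E, forall z, setT z ->
    (complex.Re (shifted k.+1%:R z))%:E @[k --> \oo] --> H z}.
  apply: aeW => z _; rewrite /H -EFinM; apply: cvg_EFin; first exact: nearW.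
  have xt : z.1 + z.2 / k.+1%:R @[k --> \oo] --> (z.1 : R).
    rewrite -[X in _ --> X]addr0; apply: cvgD; first exact: cvg_cst.
    rewrite -[X in _ --> X](mulr0 (z.2 : R)); apply: cvgM; first exact: cvg_cst.
    exact: cvg_harmonic.
  suff h : (complex.Re (F z.1) * complex.Re (F (z.1 + z.2 / k.+1%:R)) +
      complex.Im (F z.1) * complex.Im (F (z.1 + z.2 / k.+1%:R))) * poisson_kernel z.2
      @[k --> \oo] --> normc (F z.1) ^+ 2 * poisson_kernel z.2.
    apply: cvg_trans h; apply: near_eq_cvg; apply: nearW => k /=.
    by rewrite /shifted mulrA ReM /= mulr0 subr0 ReM ReJ ImJ mulrN opprK.
  rewrite sqr_normcE.
  apply: cvgM; last exact: cvg_cst.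
  rewrite !expr2; apply: cvgD; apply: cvgM; try exact: cvg_cst.
    exact: (cvg_comp _ _ xt (ReF_cont (x := z.1))).
  exact: (cvg_comp _ _ xt (ImF_cont (x := z.1))).
have domH : {ae (mu \x mu)%E, forall z k, setT z ->
    (`|(complex.Re (shifted k.+1%:R z))%:E| <= (normc (B%:C * F z.1 * (poisson_kernel z.2)%:C))%:E)%E}.
  apply: aeW => z k _; rewrite /= lee_fin (le_trans (Re_le_normc _))//.
  rewrite /shifted !normcM mulrA ler_wpM2r ?normc_ge0//.
  rewrite mulrC ler_wpM2r ?normc_ge0// normc_conj normc_real.
  exact: le_trans (ler_norm _).
by have [] := dominated_convergence measurableT mHk mH cvgH gi domH.
Qed.

Let integral_damped_cvg :
  (\int[mu]_s (exp_kernel (s / k.+1%:R) * normc (fourier_line F s) ^+ 2)%:E @[k --> \oo] -->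
   sqr_integral mu (fourier_line F))%E.
Proof.
have mFh := measurable_fourier_line mF.
rewrite /sqr_integral; set L := (X in _ --> X).
have -> : L = (\int[mu]_s limn (fun k => (exp_kernel (s / k.+1%:R) * normc (fourier_line F s) ^+ 2)%:E))%E.
  apply: eq_integral => s _; apply/esym/cvg_lim => //.
  apply: cvg_EFin; first exact: nearW.
  rewrite -[X in _ --> X]mul1r; apply: cvgM; last exact: cvg_cst.
  rewrite /exp_kernel -[X in _ --> X]expR0.
  apply: continuous_cvg; first exact: continuous_expR.
  rewrite -[X in _ --> X]oppr0; apply: cvgN; rewrite -[X in _ --> X](@normr0 _ R).
  apply: cvg_norm; rewrite -[X in _ --> X](mulr0 (s : R)); apply: cvgM; first exact: cvg_cst.
  exact: cvg_harmonic.
(* The damping factors increase to 1. Monotone convergence is the right tool because square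
   integrability of the transform is still to be proved: no majorant is available. *)
apply: cvg_monotone_convergence => //.
- move=> k; apply/measurable_EFinP; apply: measurable_funM.
    by apply: (measurableT_comp (@measurable_exp_kernel R)); exact: measurable_div.
  by apply: measurable_funX; exact: cmeasurable_normc.
- by move=> k s _; rewrite lee_fin mulr_ge0 ?exp_kernel_ge0 ?sqr_ge0.
- move=> s _ k l kl; rewrite lee_fin ler_wpM2r ?sqr_ge0// ler_expR lerN2.
  rewrite !normrM ler_wpM2l// !gtr0_norm ?invr_gt0// lef_pV2 ?posrE// ler_nat.
  by rewrite ltnS.
Qed.

Lemma plancherel_line_continuous : sqr_integral mu (fourier_line F) = sqr_integral mu F.
Proof.
apply: (cvg_unique _ integral_damped_cvg) => //.
apply: cvg_trans integral_shifted_cvg; apply: near_eq_cvg; apply: nearW => k.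
by rewrite integral_damped_fourier_line.
Qed.

End plancherel_line_continuous.

(** * Density of bounded continuous functions in L^1 and L^2 *)

Section plancherel_line.
Context {R : realType}.
Local Notation mu := (@lebesgue_measure R).
Local Notation RT := (measurableTypeR R).
Import Normc.

(** An L^1 approximation [g k] of [u] is clamped to [-M, M] and multiplied by a cutoff [w] that is 1
    for |x| <= N and 0 for |x| > N + 1. Neither operation increases the distance to [u]: it takes
    values in [-M, M], and it vanishes where the cutoff is not 1. *)
Lemma approximation_continuous_compact (u : RT -> R) (M N e : R) :
  measurable_fun setT u -> (forall x, `|u x| <= M) ->
  (forall x, N < `|x| -> u x = 0) -> 0 < e ->
  exists C : R -> R, [/\ continuous C, forall x, `|C x| <= M,
    forall x, N + 1 < `|x| -> C x = 0 &
    (\int[mu]_x (`|u x - C x|)%:E < e%:E)%E].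
Proof.
move=> mu_ uM uN e0.
have M0 : 0 <= M by exact: le_trans (uM 0).
pose E : set R := `[- (N + 1), N + 1]%classic.
have mE : measurable (E : set RT) by exact: measurable_itv.
have Efin : (mu E < +oo)%E.
  by rewrite lebesgue_measure_itv/=; case: ifPn => _; rewrite ?ltry// -EFinB ltry.
have ui : mu.-integrable E (EFin \o u).
  apply: measurable_bounded_integrable => //; first exact: measurable_funTS.
  exists M; split; first exact: num_real.
  by move=> y My x _; rewrite /= (le_trans (uM x))// ltW.
have [g [gc gi]] := approximation_continuous_integrable mE Efin ui.
rewrite ge0_cvge0P; last by move=> k; exact: integral_ge0.
move=> /(_ e e0)[k _ /(_ k (leqnn _)) /= gk].
pose c : R -> R := cst (- M) \max (g k \min cst M).
pose w : R -> R := cst 0 \max (cst 1 \min (fun x => N + 1 - `|x|)).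
have cc : continuous c.
  move=> x; apply: (@continuous_max R R); first exact: cst_continuous.
  by apply: (@continuous_min R R); [exact: gc|exact: cst_continuous].
have wc : continuous w.
  move=> x; apply: (@continuous_max R R); first exact: cst_continuous.
  apply: (@continuous_min R R); first exact: cst_continuous.
  by apply: cvgB; [exact: cvg_cst|exact: norm_continuous].
have cM x : `|c x| <= M.
  rewrite ler_norml /c le_max lexx/= ge_max ge_min lexx orbT andbT.
  by rewrite (le_trans _ M0)// oppr_le0.
have w01 x : 0 <= w x <= 1.
  by rewrite /w le_max lexx/= ge_max ler01/= ge_min lexx.
have wN x : N + 1 < `|x| -> w x = 0.
  move=> Nx; apply/eqP; rewrite eq_le (andP (w01 x)).1 andbT /w ge_max lexx/=.
  by rewrite ge_min subr_le0 (ltW Nx) orbT.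
exists (fun x => c x * w x); split.
- by move=> x; apply: cvgM; [exact: cc|exact: wc].
- move=> x; have /andP[w0 w1] := w01 x.
  by rewrite normrM (ger0_norm w0) (le_trans _ (cM x))// ler_piMr.
- by move=> x Nx; rewrite wN// mulr0.
- apply: le_lt_trans gk; rewrite [leRHS]integral_mkcond.
  have mg : measurable_fun setT (g k : RT -> R) by exact: continuous_measurable_fun.
  have mug : measurable_fun setT (fun x : RT => `|u x - g k x|%:E).
    apply/measurable_EFinP; apply: (measurableT_comp (f := @Num.norm R R)) => //.
    exact: measurable_funB.
  apply: ge0_le_integral => //.
  + apply/measurable_EFinP; apply: measurableT_comp => //; apply: measurable_funB => //.
    by apply: continuous_measurable_fun => x; apply: cvgM; [exact: cc|exact: wc].
  + by apply/(measurable_restrictT _ _).1 => //; exact: measurable_funTS.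
  + move=> x _; rewrite /patch; case: ifPn => xE; last first.
      have Nx : N + 1 < `|x|.
        move: xE; rewrite notin_setE /E /= in_itv/= => /negP.
        by rewrite -ler_norml -ltNge.
      have Nx' : N < `|x| by apply: lt_trans Nx; rewrite ltrDl.
      by rewrite lee_fin uN// wN// mulr0 subrr normr0.
    rewrite lee_fin.
    have uc : `|u x - c x| <= `|u x - g k x|.
      have := uM x; rewrite ler_norml => /andP[u1 u2].
      rewrite /c/=; have [gM|Mg] := leP (g k x) M.
        have [//|gM'] := leP (- M) (g k x).
        by rewrite !ger0_norm; lra.
      by rewrite max_r ?ler0_norm; lra.
    have [xN|Nx] := leP `|x| N.
      have -> : w x = 1 by rewrite /w/= min_l ?max_r//; lra.
      by rewrite mulr1.
    move: uc; rewrite uN// !sub0r !normrN => uc.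
    have /andP[w0 w1] := w01 x.
    by rewrite normrM (ger0_norm w0) (le_trans _ uc)// ler_piMr.
Qed.

End plancherel_line.

Section plancherel_line_density.
Context {R : realType}.
Local Notation mu := (@lebesgue_measure R).
Local Notation RT := (measurableTypeR R).
Import Normc.

Lemma normc_le_Re_Im (z : R[i]) : normc z <= `|complex.Re z| + `|complex.Im z|.
Proof.
have h := addr_ge0 (normr_ge0 (complex.Re z)) (normr_ge0 (complex.Im z)).
rewrite -(@ler_pXn2r _ 2)// ?nnegrE ?normc_ge0// sqr_normcE.
rewrite -(real_normK (num_real (complex.Re z))) -(real_normK (num_real (complex.Im z))).
by rewrite sqrrD addrAC lerDl mulrn_wge0// mulr_ge0.
Qed.

Definition bounded_continuous (C : RT -> bC R) : Prop :=
  [/\ cintegrable mu C, exists B, forall x, normc (C x) <= B,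
      continuous ((fun x => complex.Re (C x)) : R -> R) &
      continuous ((fun x => complex.Im (C x)) : R -> R)].

(** One function must approximate in both norms: L^1 closeness gives pointwise convergence of the
    transforms, L^2 closeness that of the norms. F is truncated in value and in support at level k,
    and the truncation is approximated in L^1 by functions whose real and imaginary parts are
    bounded by k; the differences of these parts are at most 2 k, so the L^1 error also controls the
    L^2 error. *)
Lemma cintegrable_approximation (F : RT -> bC R) (e : R) : 0 < e ->
  cintegrable mu F -> cLfun mu 2%:E setT F ->
  exists C, [/\ bounded_continuous C,
    (\int[mu]_x (normc (F x - C x))%:E < e%:E)%E &
    (sqr_integral mu (fun x => F x - C x)%R < e%:E)%E].
Proof.
move=> e0 F1 F2; have [mF _] := F1.
pose E (k : nat) : set RT := [set x | normc (F x) <= k%:R] `&` [set x | `|x| <= k%:R].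
have mE k : measurable (E k).
  apply: measurableI.
    have := cmeasurable_normc mF measurableT (measurable_itv `]-oo, k%:R]).
    by rewrite setTI; congr measurable; apply/seteqP; split => x /=; rewrite in_itv.
  have := @normr_measurable R setT measurableT _ (measurable_itv `]-oo, k%:R]).
  by rewrite setTI; congr measurable; apply/seteqP; split => x /=; rewrite in_itv.
have Ex x : \forall k \near \oo, E k x.
  near=> k; split => /=.
    by apply/ltW; near: k; exact: nbhs_infty_gtr.
  by apply/ltW; near: k; exact: nbhs_infty_gtr.
have e2 : 0 < e / 2 by rewrite divr_gt0.
have e4 : 0 < e / 4 by rewrite divr_gt0.
have := l1_crestrict_cvg F1 mE Ex; rewrite ge0_cvge0P; last first.
  by move=> k; apply: integral_ge0 => x _; rewrite lee_fin normc_ge0.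
move=> /(_ _ e2)[k1 _ hk1].
have := sqr_integral_crestrict_cvg F2 mE Ex; rewrite ge0_cvge0P; last first.
  by move=> k; exact: sqr_integral_ge0.
move=> /(_ _ e4)[k2 _ hk2].
pose k := maxn k1 k2; pose Fk := crestrict (E k) F.
have {}hk1 := hk1 k (leq_maxl _ _); have {}hk2 := hk2 k (leq_maxr _ _).
have mFk : measurable_fun setT Fk by exact: cmeasurable_crestrict.
have Fk1 : cintegrable mu Fk by apply: (le_cintegrable mFk F1) => x; exact: normc_crestrict_le.
have FkE x : Fk x = 0 \/ (E k x /\ Fk x = F x).
  rewrite /Fk /crestrict indicE; case: (boolP (x \in E k)) => xE; last by left; rewrite mul0r.
  by right; rewrite mul1r inE in xE *.
have Fkk x : normc (Fk x) <= k%:R.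
  by case: (FkE x) => [->|[[] /= h _ ->//]]; rewrite normc0.
have Fk0 x : k%:R < `|x| -> Fk x = 0.
  by case: (FkE x) => [->//|[[_ /=]]]; rewrite leNgt => /negP.
(* The term 4 gives 2 e' <= e / 2 for the L^1 error, and 32 k gives 4 k e' <= e / 8 for the squared
   L^2 error. With the truncation error e / 4 the latter totals 2 (e / 4 + e / 8) < e. *)
pose e' := e / (4 + 32 * k%:R).
have d0 : 0 < 4 + 32 * k%:R :> R by rewrite ltr_pwDl// mulr_ge0.
have e'0 : 0 < e' by rewrite divr_gt0.
have [C1 [cC1 C1k C10 C1e]] := @approximation_continuous_compact _ (fun x => complex.Re (Fk x)) k%:R k%:R e'
  (cmeasurable_Re mFk) (fun x => le_trans (Re_le_normc _) (Fkk x))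
  (fun x h => congr1 _ (Fk0 x h)) e'0.
have [C2 [cC2 C2k C20 C2e]] := @approximation_continuous_compact _ (fun x => complex.Im (Fk x)) k%:R k%:R e'
  (cmeasurable_Im mFk) (fun x => le_trans (Im_le_normc _) (Fkk x))
  (fun x h => congr1 _ (Fk0 x h)) e'0.
pose C : RT -> bC R := fun x => C1 x +i* C2 x.
have mC : measurable_fun setT C.
  by apply: measurable_fun_bC; exact: continuous_measurable_fun.
have mr : measurable_fun setT (fun x : RT => `|complex.Re (Fk x) - C1 x|%:E).
  apply/measurable_EFinP; apply: measurableT_comp => //; apply: measurable_funB => //.
    exact: cmeasurable_Re.
  exact: continuous_measurable_fun.
have mi : measurable_fun setT (fun x : RT => `|complex.Im (Fk x) - C2 x|%:E).
  apply/measurable_EFinP; apply: measurableT_comp => //; apply: measurable_funB => //.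
    exact: cmeasurable_Im.
  exact: continuous_measurable_fun.
have mFC := cmeasurableB mFk mC.
have sumE : (\int[mu]_x (`|complex.Re (Fk x) - C1 x|%:E + `|complex.Im (Fk x) - C2 x|%:E) <= (2 * e')%:E)%E.
  rewrite ge0_integralD// mulr_natl mulr2n EFinD; apply/ltW; exact: lteD.
have ReB x : complex.Re (Fk x - C x) = complex.Re (Fk x) - C1 x by case: (Fk x).
have ImB x : complex.Im (Fk x - C x) = complex.Im (Fk x) - C2 x by case: (Fk x).
have FC1 : (\int[mu]_x (normc (Fk x - C x))%:E <= (2 * e')%:E)%E.
  apply: le_trans sumE; apply: ge0_le_integral => //.
  - by move=> x _; rewrite lee_fin normc_ge0.
  - exact/measurable_EFinP/cmeasurable_normc.
  - exact: emeasurable_funD.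
  - by move=> x _; rewrite -EFinD lee_fin -ReB -ImB; exact: normc_le_Re_Im.
have FC2 : (sqr_integral mu (fun x => Fk x - C x)%R <= ((2 * k%:R) * (2 * e'))%:E)%E.
  rewrite EFinM; apply: (@le_trans _ _ ((2 * k%:R)%:E * \int[mu]_x (`|complex.Re (Fk x) - C1 x|%:E + `|complex.Im (Fk x) - C2 x|%:E))%E); last first.
    by rewrite lee_wpmul2l// lee_fin mulr_ge0.
  rewrite -ge0_integralZl_EFin ?mulr_ge0//; last 2 first.
  - by move=> x _; rewrite adde_ge0.
  - exact: emeasurable_funD.
  apply: ge0_le_integral => //.
  - by move=> x _; rewrite lee_fin sqr_ge0.
  - exact: cmeasurable_sqr_normc.
  - by apply: measurable_funeM; exact: emeasurable_funD.
  - move=> x _; rewrite -EFinD -EFinM lee_fin sqr_normcE ReB ImB mulrDr.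
    rewrite -(real_normK (num_real (complex.Re (Fk x) - C1 x))).
    rewrite -(real_normK (num_real (complex.Im (Fk x) - C2 x))) !expr2 mulr_natl mulr2n.
    apply: lerD; apply: ler_wpM2r => //; rewrite (le_trans (ler_normB _ _))// lerD//.
      exact: le_trans (Re_le_normc _) _.
    exact: le_trans (Im_le_normc _) _.
have mFF : measurable_fun setT (fun x : RT => F x - Fk x : bC R) by exact: cmeasurableB.
have FCi : cintegrable mu (fun x => Fk x - C x).
  by split=> //; apply: le_lt_trans FC1 _; rewrite ltry.
have h1 : 2 * e' <= e / 2.
  rewrite /e' mulrA ler_pdivrMr//; have : 0 <= e * k%:R by rewrite mulr_ge0 // ltW.
  lra.
have h2 : (2 * k%:R) * (2 * e') <= e / 8.
  rewrite /e' !mulrA ler_pdivrMr//; lra.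
exists C; split.
- split=> //.
  + rewrite (_ : C = fun x => Fk x - (Fk x - C x)); first exact: cintegrableB.
    by apply/funext => x; rewrite subKr.
  + exists (k%:R + k%:R) => x; rewrite (le_trans (normc_le_Re_Im _))//=.
    by rewrite lerD.
- apply: (@le_lt_trans _ _ (\int[mu]_x ((normc (F x - Fk x))%:E + (normc (Fk x - C x))%:E))%E).
    apply: ge0_le_integral => //.
    + by move=> x _; rewrite lee_fin normc_ge0.
    + by apply/measurable_EFinP/cmeasurable_normc; exact: cmeasurableB.
    + by apply: emeasurable_funD; apply/measurable_EFinP/cmeasurable_normc.
    + move=> x _; rewrite -EFinD lee_fin (_ : F x - C x = (F x - Fk x) + (Fk x - C x)).
        exact: le_normcD.
      by rewrite addrA subrK.
  rewrite ge0_integralD//.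
  + rewrite (_ : e = e / 2 + e / 2); last lra.
    rewrite EFinD; apply: lte_leD => //.
      by rewrite ge0_fin_numE ?(le_lt_trans FC1) ?ltry// integral_ge0// => x _; rewrite lee_fin normc_ge0.
    by apply: le_trans FC1 _; rewrite lee_fin.
  + by move=> x _; rewrite lee_fin normc_ge0.
  + exact/measurable_EFinP/cmeasurable_normc.
  + by move=> x _; rewrite lee_fin normc_ge0.
  + exact/measurable_EFinP/cmeasurable_normc.
- rewrite (_ : (fun _ => _) = (fun x => (F x - Fk x) + (Fk x - C x))); last first.
    by apply/funext => x; rewrite addrA subrK.
  apply: le_lt_trans (sqr_integralD_le mu mFF mFC) _.
  apply: (@le_lt_trans _ _ (2%:E * ((e / 4)%:E + (e / 8)%:E))%E).
    rewrite lee_wpmul2l// leeD//; first exact: ltW.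
    by apply: le_trans FC2 _; rewrite lee_fin.
  by rewrite -EFinD -EFinM lte_fin; lra.
Unshelve. all: by end_near.
Qed.

Lemma fourier_lineB (F G : RT -> bC R) s : cintegrable mu F -> cintegrable mu G ->
  fourier_line (fun x => F x - G x) s = fourier_line F s - fourier_line G s.
Proof.
move=> Fi Gi; rewrite /fourier_line -cintegralB; try exact: cintegrable_character.
by apply: eq_cintegral => x; rewrite mulrBl.
Qed.

Lemma bounded_continuousB (C D : RT -> bC R) : bounded_continuous C ->
  bounded_continuous D -> bounded_continuous (fun x => C x - D x).
Proof.
move=> [Ci [BC CB] rC iC] [Di [BD DB] rD iD]; split.
- exact: cintegrableB.
- exists (BC + BD) => x; rewrite (le_trans (le_normcD _ _))// lerD// normcN; exact: DB.
- rewrite (_ : (fun _ => _) = (fun x => complex.Re (C x) - complex.Re (D x))).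
    by move=> x; apply: cvgB; [exact: rC|exact: rD].
  by apply/funext => x; case: (C x); case: (D x).
- rewrite (_ : (fun _ => _) = (fun x => complex.Im (C x) - complex.Im (D x))).
    by move=> x; apply: cvgB; [exact: iC|exact: iD].
  by apply/funext => x; case: (C x); case: (D x).
Qed.

Lemma plancherel_bounded_continuous (C : RT -> bC R) : bounded_continuous C ->
  sqr_integral mu (fourier_line C) = sqr_integral mu C.
Proof. by move=> [Ci [B CB] rC iC]; exact: (plancherel_line_continuous Ci CB rC iC). Qed.

End plancherel_line_density.

Section plancherel_line_theorem.
Context {R : realType}.
Local Notation mu := (@lebesgue_measure R).
Local Notation RT := (measurableTypeR R).
Import Normc.

(* L^2 convergence of the transforms follows from Fatou's lemma, because they
   converge pointwise by L^1 convergence. *)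
Theorem plancherel_line (F : RT -> bC R) : cintegrable mu F -> cLfun mu 2%:E setT F ->
  sqr_integral mu (fourier_line F) = sqr_integral mu F.
Proof.
move=> F1 F2; have [mF _] := F1.
have inv_gt0 (k : nat) : 0 < k.+1%:R^-1 :> R by rewrite invr_gt0.
have app (k : nat) := cintegrable_approximation (inv_gt0 k) F1 F2.
have [C hC] := choice app.
have Cb k : bounded_continuous (C k) by case: (hC k).
have C1 k : cintegrable mu (C k) by case: (Cb k).
have mC k : measurable_fun setT (C k) by case: (C1 k).
have FC1 k : (\int[mu]_x (normc (F x - C k x))%:E < k.+1%:R^-1%:E)%E by case: (hC k).
have FC2 k : (sqr_integral mu (fun x => F x - C k x)%R < k.+1%:R^-1%:E)%E by case: (hC k).
have mFC k : measurable_fun setT (fun x : RT => F x - C k x : bC R) by exact: cmeasurableB.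
have C2 k : cLfun mu 2%:E setT (C k).
  rewrite (_ : C k = fun x => F x - (F x - C k x)).
    apply: cLfun2B => //; apply/cLfun2P; split => //.
    by apply: lt_trans (FC2 k) _; rewrite ltry.
  by apply/funext => x; rewrite subKr.
have mh k : measurable_fun setT (fourier_line (C k)) by exact: measurable_fourier_line.
have mFh : measurable_fun setT (fourier_line F) by exact: measurable_fourier_line.
have hC2 k : cLfun mu 2%:E setT (fourier_line (C k)).
  apply/cLfun2P; split => //; rewrite plancherel_bounded_continuous//.
  by have /cLfun2P[] := C2 k.
have ptw s : normc (fourier_line F s - fourier_line (C k) s) @[k --> \oo] --> (0 : R).
  apply: (@squeeze_cvgr _ _ _ _ (fun=> 0) (fun k => k.+1%:R^-1)).
  - apply: nearW => k; rewrite normc_ge0 andTb -fourier_lineB// -lee_fin.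
    apply: le_trans (normc_fourier_line_le_integral _ (cintegrableB F1 (C1 k))) _.
    exact/ltW/FC1.
  - exact: cvg_cst.
  - exact: cvg_harmonic.
(* [C (j + k)] and [C k] are both within 1 / (k + 1) of F in squared norm, so their difference has
   squared norm at most 2 (1 + 1) / (k + 1). Plancherel carries this to the transforms, and j tends
   to infinity by Fatou's lemma. *)
have tail k : (sqr_integral mu (fun s => fourier_line F s - fourier_line (C k) s)%R <=
    (4 / k.+1%:R)%:E)%E.
  apply: (@fatou_le _ _ _ mu (fun j s => (normc (fourier_line (C (j + k)%N) s - fourier_line (C k) s) ^+ 2)%:E)).
  - by move=> j; apply: cmeasurable_sqr_normc; exact: cmeasurableB.
  - by move=> j s; rewrite lee_fin sqr_ge0.
  - by apply: cmeasurable_sqr_normc; exact: cmeasurableB.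
  - by move=> s; rewrite lee_fin sqr_ge0.
  - apply: aeW => s; apply: cvg_EFin; first exact: nearW.
    rewrite (_ : fine \o _ = (fun j => normc (fourier_line (C (j + k)%N) s - fourier_line (C k) s) *
      normc (fourier_line (C (j + k)%N) s - fourier_line (C k) s)))//.
    have h : normc (fourier_line (C (j + k)%N) s - fourier_line (C k) s) @[j --> \oo] -->
        normc (fourier_line F s - fourier_line (C k) s).
      apply/cvgrPdist_le => e e0; have /cvgr0_norm_le/(_ e e0)[j0 _ hj] := ptw s.
      exists j0 => // j jj0.
      have := hj (j + k)%N (leq_trans jj0 (leq_addr _ _)); rewrite ger0_norm ?normc_ge0// => hb.
      apply: le_trans hb; apply: le_trans (ler_dist_normc _ _) _.
      by rewrite opprB addrA subrK.
    by rewrite expr2; exact: (cvgM h h).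
  - move=> j; rewrite -[leLHS]/(sqr_integral mu (fun s => fourier_line (C (j + k)%N) s - fourier_line (C k) s)%R).
    rewrite (_ : (fun s => _) = fourier_line (fun x => C (j + k)%N x - C k x)); last first.
      by apply/funext => s; rewrite fourier_lineB.
    rewrite plancherel_bounded_continuous; last exact: bounded_continuousB.
    rewrite (_ : (fun x => _) = (fun x => (-1) * (F x - C (j + k)%N x) + (F x - C k x))); last first.
      by apply/funext => x; rewrite mulN1r opprB addrA subrK.
    apply: le_trans (sqr_integralD_le _ _ _) _ => //.
      by apply: cmeasurableM => //; exact: cmeasurable_cst.
    rewrite sqr_integralZ// normcN normc1 expr1n mul1e.
    apply: (@le_trans _ _ (2%:E * (k.+1%:R^-1%:E + k.+1%:R^-1%:E))%E); last first.
      rewrite -EFinD -EFinM lee_fin; set y : R := _^-1; lra.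
    rewrite lee_wpmul2l// leeD// ltW// (lt_le_trans (FC2 _))// lee_fin.
    by rewrite lef_pV2 ?posrE// ler_nat ltnS leq_addl.
have tail0 : sqr_integral mu (fun s => fourier_line F s - fourier_line (C k) s)%R @[k --> \oo] --> 0%E.
  apply: ge0_cvge0_le tail _; first by move=> k; exact: sqr_integral_ge0.
  apply: cvg_EFin; first exact: nearW.
  rewrite -[X in _ --> X](mulr0 4); apply: cvgM; first exact: cvg_cst.
  exact: cvg_harmonic.
have Fh2 : cLfun mu 2%:E setT (fourier_line F).
  rewrite (_ : fourier_line F = fun s => (fourier_line F s - fourier_line (C 0%N) s) + fourier_line (C 0%N) s).
    apply: cLfun2D => //; apply/cLfun2P; split; first exact: cmeasurableB.
    by apply: le_lt_trans (tail 0%N) _; rewrite ltry.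
  by apply/funext => s; rewrite subrK.
have lim1 := cvg_cnorm2 Fh2 hC2 ((cnorm2_cvg0P _ _).2 tail0).
have lim2 : cnorm mu 2%:E setT (C k) @[k --> \oo] --> cnorm mu 2%:E setT F.
  apply: cvg_cnorm2 => //; apply/cnorm2_cvg0P.
  apply: (@ge0_cvge0_le _ _ (fun k => k.+1%:R^-1%:E)).
  - by move=> k; exact: sqr_integral_ge0.
  - by move=> k; exact: ltW.
  - exact: cvge_harmonic.
have : cnorm mu 2%:E setT (fourier_line F) = cnorm mu 2%:E setT F.
  apply: (cvg_unique _ lim1) => //.
  apply: cvg_trans lim2; apply: near_eq_cvg; apply: nearW => k.
  by rewrite !cnorm2E plancherel_bounded_continuous.
by rewrite -!sqr_cnorm2 => ->.
Qed.

End plancherel_line_theorem.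

(** * Lebesgue measure on R^n and linear changes of variables *)

Section lebesgue_vec_integral.
Context {R : realType}.
Local Notation leb := (@lebesgue_measure R).
Local Notation RT := (measurableTypeR R).
Local Notation vol n := (@lebesgue_vec R n).
Import Normc.
Local Open Scope ereal_scope.

Lemma measurable_consv_line n :
  measurable_fun setT (@consv R n : (RT * bvec R n)%type -> bvec R n.+1).
Proof. exact: measurable_consv. Qed.

Lemma ge0_integral_consv n (f : bvec R n.+1 -> \bar R) :
  measurable_fun setT f -> (forall x, 0 <= f x) ->
  \int[vol n.+1]_x f x = \int[leb \x vol n]_z f (consv z).
Proof.
move=> mf f0; etransitivity.
  refine (ge0_integral_pushforward (@measurable_consv_line n) (prod_measure leb (vol n)) _ _ _).
  - exact: measurableT.
  - exact: mf.
  - by move=> x _; exact: f0.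
by rewrite preimage_setT.
Qed.

Lemma measurable_comp_consv n d (T : measurableType d) (f : bvec R n.+1 -> T) :
  measurable_fun setT f -> measurable_fun setT (fun z : RT * bvec R n => f (consv z)).
Proof. by move=> mf; exact: (measurableT_comp mf (@measurable_consv_line n)). Qed.

Lemma ge0_integral_consv1 n (f : bvec R n.+1 -> \bar R) :
  measurable_fun setT f -> (forall x, 0 <= f x) ->
  \int[vol n.+1]_x f x = \int[leb]_t \int[vol n]_y f (consv (t, y)).
Proof.
move=> mf f0; rewrite ge0_integral_consv// (fubini_tonelli1 (fun z : RT * bvec R n => f (consv z)))//.
exact: measurable_comp_consv.
Qed.

Lemma ge0_integral_consv2 n (f : bvec R n.+1 -> \bar R) :
  measurable_fun setT f -> (forall x, 0 <= f x) ->
  \int[vol n.+1]_x f x = \int[vol n]_y \int[leb]_t f (consv (t, y)).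
Proof.
move=> mf f0; rewrite ge0_integral_consv// (fubini_tonelli2 (fun z : RT * bvec R n => f (consv z)))//.
exact: measurable_comp_consv.
Qed.

Lemma consv_substitution n (f : bvec R n.+1 -> \bar R) :
  measurable_fun setT f -> (forall x, 0 <= f x) ->
  \int[leb \x vol n]_z f (consv z) = 1%:E * \int[vol n.+1]_x f x.
Proof. by move=> mf f0; rewrite mul1e ge0_integral_consv. Qed.

Lemma cintegrable_consv n (F : bvec R n.+1 -> bC R) : cintegrable (vol n.+1) F ->
  cintegrable (leb \x vol n) (fun z => F (consv z)).
Proof.
exact: (cintegrable_substitution ler01 (@measurable_consv_line n) (@consv_substitution n)).
Qed.

Lemma cintegral_consv n (F : bvec R n.+1 -> bC R) : cintegrable (vol n.+1) F ->
  cintegral (vol n.+1) F = cintegral (leb \x vol n) (fun z => F (consv z)).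
Proof.
by move=> Fi; rewrite (cintegral_substitution (@consv_substitution n) Fi) mul1r.
Qed.

Lemma measurable_bmx_entry d (T : measurableType d) m n (f : T -> bmx R m n) i j :
  measurable_fun setT f -> measurable_fun setT (fun x => f x i j).
Proof. by move=> mf; exact: (measurableT_comp (measurable_coord i j) mf). Qed.

Lemma measurable_bmxD d (T : measurableType d) m n (f g : T -> bmx R m n) :
  measurable_fun setT f -> measurable_fun setT g ->
  measurable_fun setT (fun x => ((f x : 'M[R]_(m, n)) + g x)%R : bmx R m n).
Proof.
move=> mf mg; apply: measurable_fun_borel_mx => // i j.
under eq_fun do rewrite mxE.
by apply: measurable_funD; exact: measurable_bmx_entry.
Qed.

Lemma measurable_bmxM d (T : measurableType d) m n p (f : T -> bmx R m n) (g : T -> bmx R n p) :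
  measurable_fun setT f -> measurable_fun setT g ->
  measurable_fun setT (fun x => ((f x : 'M[R]_(m, n)) *m g x)%R : bmx R m p).
Proof.
move=> mf mg; apply: measurable_fun_borel_mx => // i j.
under eq_fun do rewrite mxE.
by apply: measurable_sum => k; apply: measurable_funM; exact: measurable_bmx_entry.
Qed.

Lemma measurable_bmx_affine m n (A : 'M[R]_(m, n)) (a : 'cV[R]_m) :
  measurable_fun setT (fun x : bvec R n => (A *m x + a)%R : bvec R m).
Proof.
apply: measurable_bmxD; last exact: measurable_cst.
by apply: measurable_bmxM; [exact: measurable_cst|exact: measurable_id].
Qed.

Lemma consvD n t s (x y : 'cV[R]_n) : consv ((t + s)%R, (x + y)%R) = (consv (t, x) + consv (s, y))%R.
Proof. by apply/colP => i; rewrite !mxE; case: unlift => [j|]//=; rewrite mxE. Qed.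

Lemma unconsvK n : cancel (@unconsv R n) (@consv R n).
Proof.
move=> x; apply/colP => i; rewrite mxE /=; case: unliftP => [j ->|->]//.
by rewrite mxE.
Qed.

Lemma ge0_integral_vec_shift n (a : 'cV[R]_n) (f : bvec R n -> \bar R) :
  measurable_fun setT f -> (forall x, 0 <= f x) ->
  \int[vol n]_x f (x + a)%R = \int[vol n]_x f x.
Proof.
elim: n a f => [|n IH] a f mf f0.
  by apply: eq_integral => x _; congr f; apply/colP => -[].
have ms k (b : 'cV[R]_k) : measurable_fun setT (fun x : bvec R k => (x + b)%R : bvec R k).
  by apply: measurable_bmxD; [exact: measurable_id|exact: measurable_cst].
rewrite ge0_integral_consv1//; last exact: (measurableT_comp mf (ms _ a)).
rewrite -[a]unconsvK; move: (unconsv a) => [s b].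
transitivity (\int[leb]_t \int[vol n]_y f (consv ((t + s)%R, y))).
  apply: eq_integral => t _; rewrite -(IH b (fun y => f (consv ((t + s)%R, y)))).
  - by apply: eq_integral => y _; rewrite consvD.
  - apply: (measurableT_comp mf); apply: (measurableT_comp (@measurable_consv_line n)).
    exact: pair1_measurable.
  - by move=> y.
pose h (t : RT) := \int[vol n]_y f (consv (t, y)).
have mh : measurable_fun setT h.
  apply: (measurable_fun_fubini_tonelli_F (fun z : RT * bvec R n => f (consv z)))=> //.
  exact: measurable_comp_consv.
have h0 t : 0 <= h t by exact: integral_ge0.
have := ge0_integral_affine s (@oner_neq0 R) mh h0.
rewrite normr1 invr1 mul1e (ge0_integral_consv1 mf f0) => <-.
by apply: eq_integral => t _; rewrite mul1r.
Qed.

End lebesgue_vec_integral.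

(** * Linear changes of variables by block elimination *)

Section lebesgue_vec_linear.
Context {R : realType}.
Local Notation leb := (@lebesgue_measure R).
Local Notation RT := (measurableTypeR R).
Local Notation vol n := (@lebesgue_vec R n).
Local Open Scope ereal_scope.

(** The change of variables formula as a property of A. It is stable under products, so it is enough
    to factor A into shears and block diagonal matrices; this is elimination on the first column,
    with induction on the size. *)
Let scales n (A : 'M[R]_n) := forall f : bvec R n -> \bar R,
  measurable_fun setT f -> (forall x, 0 <= f x) ->
  \int[vol n]_x f (A *m x)%R = `|\det A|^-1%:E * \int[vol n]_x f x.

Let measurable_mulmxl n (A : 'M[R]_n) :
  measurable_fun setT (fun x : bvec R n => (A *m x)%R : bvec R n).
Proof. by apply: measurable_bmxM; [exact: measurable_cst|exact: measurable_id]. Qed.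

Let measurable_scales n (A : 'M[R]_n) (f : bvec R n -> \bar R) : measurable_fun setT f ->
  measurable_fun setT (fun x : bvec R n => f (A *m x)%R).
Proof. by move=> mf; exact: (measurableT_comp mf (measurable_mulmxl A)). Qed.

Let scalesM n (A B : 'M[R]_n) : scales A -> scales B -> scales (A *m B).
Proof.
move=> sA sB f mf f0; under eq_integral do rewrite -mulmxA.
rewrite (sB (fun y => f (A *m y)%R))//; last exact: (measurableT_comp mf (measurable_mulmxl _)).
by rewrite sA// muleA -EFinM -invfM -normrM det_mulmx [(\det B * _)%R]mulrC.
Qed.

(** Identifies the coordinates in which the measure is a product with a block column, on which block
    matrices act. *)
Lemma consv_col n (t : R) (y : 'cV[R]_n) :
  consv (t, y) = col_mx (const_mx t : 'cV[R]_1) y :> 'cV[R]_(1 + n).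
Proof.
apply/colP => i; rewrite !mxE; case: splitP => j ij; case: unliftP => [k ik|ik] //=.
- by move: ij; rewrite ik ord1.
- by rewrite mxE.
- by congr (y _ _); apply/val_inj => /=; move: ij; rewrite ik /= => -[].
- by move: ij; rewrite ik /=.
Qed.

(** At a fixed first coordinate t, this shear translates the other coordinates by t c, so the
    integral over them is unchanged. [scales_upper] is the same with the opposite order of
    integration. *)
Let scales_lower n (c : 'cV[R]_n) : scales (block_mx (1%:M : 'M[R]_1) 0 c 1%:M : 'M[R]_(1 + n)).
Proof.
move=> f mf f0; rewrite det_lblock !det1 mulr1 normr1 invr1 mul1e.
rewrite (ge0_integral_consv1 (measurable_scales _ mf) (fun x => f0 _)) (ge0_integral_consv1 mf f0).
apply: eq_integral => t _.
rewrite -[RHS](ge0_integral_vec_shift (c *m const_mx t)).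
- apply: eq_integral => y _; rewrite !consv_col mul_block_col.
  by rewrite !mul1mx mul0mx addr0 addrC.
- apply: (measurableT_comp mf); apply: (measurableT_comp (@measurable_consv_line R n)).
  exact: pair1_measurable.
- by move=> y.
Qed.

Let scales_upper n (b : 'rV[R]_n) : scales (block_mx (1%:M : 'M[R]_1) b 0 1%:M : 'M[R]_(1 + n)).
Proof.
move=> f mf f0; rewrite det_ublock !det1 mulr1 normr1 invr1 mul1e.
rewrite (ge0_integral_consv2 (measurable_scales _ mf) (fun x => f0 _)) (ge0_integral_consv2 mf f0).
apply: eq_integral => y _.
have mg : measurable_fun setT (fun t : RT => f (consv (t, y))).
  apply: (measurableT_comp mf); apply: (measurableT_comp (@measurable_consv_line R n)).
  exact: pair2_measurable.
have := ge0_integral_affine ((b *m y) ord0 ord0)%R (@oner_neq0 R) mg (fun t => f0 _).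
rewrite normr1 invr1 mul1e => <-.
apply: eq_integral => t _; rewrite !consv_col mul_block_col.
rewrite !mul1mx mul0mx add0r; congr (f (col_mx _ _)).
by apply/matrixP => i j; rewrite !mxE !ord1 mul1r.
Qed.

Let scales_diag n (a : R) (D : 'M[R]_n) : (a != 0)%R -> scales D ->
  scales (block_mx (a%:M : 'M[R]_1) 0 0 D : 'M[R]_(1 + n)).
Proof.
move=> a0 sD f mf f0; rewrite det_ublock det_scalar1.
rewrite (ge0_integral_consv1 (measurable_scales _ mf) (fun x => f0 _)) (ge0_integral_consv1 mf f0).
pose h (t : RT) := \int[vol n]_y f (consv (t, y)).
have mh : measurable_fun setT h.
  apply: (measurable_fun_fubini_tonelli_F (fun z : RT * bvec R n => f (consv z)))=> //.
  exact: measurable_comp_consv.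
have h0 t : 0 <= h t by exact: integral_ge0.
transitivity (\int[leb]_t (`|\det D|^-1%:E * h (a * t + 0)%R)).
  apply: eq_integral => t _; rewrite -(sD (fun y => f (consv ((a * t + 0)%R, y)))).
  - apply: eq_integral => y _; rewrite !consv_col mul_block_col !mul0mx addr0 add0r.
    by congr (f (col_mx _ _)); apply/matrixP => i j; rewrite mul_scalar_mx !mxE addr0.
  - apply: (measurableT_comp mf); apply: (measurableT_comp (@measurable_consv_line R n)).
    exact: pair1_measurable.
  - by move=> y.
have mha : measurable_fun setT (fun t : RT => h (a * t + 0)%R).
  exact: (measurableT_comp mh (measurable_affine a 0)).
rewrite (ge0_integralZl_EFin leb measurableT (fun t _ => h0 (a * t + 0)%R) mha) ?invr_ge0//.
by rewrite ge0_integral_affine// muleA -EFinM -invfM -normrM mulrC.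
Qed.

(** Block LDU factorization: with an invertible pivot a, the lower right block becomes the Schur
    complement D - c b / a, which is invertible because the determinant is multiplicative, and falls
    under the induction hypothesis. *)
Let scales_pivot n (a : R) (b : 'rV[R]_n) (c : 'cV[R]_n) (D : 'M[R]_n) : (a != 0)%R ->
  (block_mx a%:M b c D : 'M[R]_(1 + n)) \in unitmx ->
  (forall B : 'M[R]_n, B \in unitmx -> scales B) ->
  scales (block_mx a%:M b c D : 'M[R]_(1 + n)).
Proof.
move=> a0 Au IH.
have E : block_mx a%:M b c D = (block_mx (1%:M : 'M[R]_1) 0 (a^-1 *: c) 1%:M *m
    block_mx (a%:M : 'M[R]_1) 0 0 (D - a^-1 *: (c *m b)) *m
    block_mx (1%:M : 'M[R]_1) (a^-1 *: b) 0 1%:M)%R.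
  rewrite !mulmx_block !mul1mx !mulmx1 !mul0mx !mulmx0 !addr0 !add0r.
  congr block_mx.
  - by rewrite mul_scalar_mx scalerA mulfV// scale1r.
  - by rewrite mul_mx_scalar scalerA mulfV// scale1r.
  - rewrite mul_mx_scalar scalerA mulfV// scale1r -scalemxAr addrC subrK//.
rewrite E; apply: scalesM; last exact: scales_upper.
apply: scalesM; first exact: scales_lower.
apply: scales_diag => //; apply: IH.
move: Au; rewrite E !unitmx_mul => /andP[/andP[_ + _]].
by rewrite !unitmxE det_ublock unitrM => /andP[].
Qed.

Lemma ge0_integral_mulmx n (A : 'M[R]_n) (f : bvec R n -> \bar R) : A \in unitmx ->
  measurable_fun setT f -> (forall x, 0 <= f x) ->
  \int[vol n]_x f (A *m x)%R = `|\det A|^-1%:E * \int[vol n]_x f x.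
Proof.
suff h : A \in unitmx -> scales A by move=> /h; apply.
elim: n A {f} => [|n IH] A Au.
  move=> f mf f0; rewrite det_mx00 normr1 invr1 mul1e.
  by apply: eq_integral => x _; congr f; apply/colP => -[].
move: A Au; rewrite -[n.+1]/(1 + n)%N => A Au.
rewrite -(submxK A) in Au *; move: (ulsubmx A) (ursubmx A) (dlsubmx A) (drsubmx A) Au => a b c D.
rewrite [a]mx11_scalar; move: (a ord0 ord0) => {}a Au.
have [a0|a0] := eqVneq a 0%R; last exact: scales_pivot.
(* A zero pivot is replaced by a nonzero entry of the first column, by adding
   the row of that entry to the first row. *)
have [i ci] : exists i, c i ord0 != 0%R.
  apply/existsP; apply: contraT; rewrite negb_exists => /forallP c0.
  have c_0 : c = 0%R.
    by apply/colP => i; have := c0 i; rewrite negbK => /eqP ->; rewrite mxE.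
  by move: Au; rewrite unitmxE a0 c_0 (_ : 0%:M = 0 :> 'M[R]_1)%R ?raddf0// det_ublock det0 mul0r unitr0.
pose r : 'rV[R]_n := delta_mx ord0 i.
have rc : (r *m c)%R = (c i ord0)%:M.
  by rewrite -rowE; apply/matrixP => k l; rewrite !ord1 !mxE.
have E : block_mx a%:M b c D = (block_mx (1%:M : 'M[R]_1) (- r) 0 1%:M *m
    block_mx (c i ord0)%:M (b + r *m D) c D)%R.
  rewrite mulmx_block !mul1mx !mul0mx !add0r !mulNmx rc subrr addrK.
  by rewrite a0 raddf0.
rewrite E; apply: scalesM; first exact: scales_upper.
apply: scales_pivot => //.
by move: Au; rewrite E unitmx_mul => /andP[].
Qed.

Lemma ge0_integral_vec_affine n (A : 'M[R]_n) (a : 'cV[R]_n) (f : bvec R n -> \bar R) :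
  A \in unitmx -> measurable_fun setT f -> (forall x, 0 <= f x) ->
  \int[vol n]_x f (A *m x + a)%R = `|\det A|^-1%:E * \int[vol n]_x f x.
Proof.
move=> Au mf f0.
have mfa : measurable_fun setT (fun x : bvec R n => f (x + a)%R).
  apply: (measurableT_comp mf).
  by apply: measurable_bmxD; [exact: measurable_id|exact: measurable_cst].
rewrite (ge0_integral_mulmx Au mfa (fun x => f0 _)); congr (_ * _).
exact: ge0_integral_vec_shift.
Qed.

End lebesgue_vec_linear.

(** * The Fourier-Plancherel transform on R^n *)

Section plancherel_vec.
Context {R : realType}.
Local Notation leb := (@lebesgue_measure R).
Local Notation RT := (measurableTypeR R).
Local Notation vol n := (@lebesgue_vec R n).
Import Normc.
Local Open Scope ereal_scope.

Lemma ge0_integral_lty_ae d (T : measurableType d) (mu : {measure set T -> \bar R})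
    (f : T -> \bar R) : measurable_fun setT f -> (forall x, 0 <= f x) ->
  \int[mu]_x f x < +oo -> {ae mu, forall x, f x < +oo}.
Proof.
move=> mf f0 foo.
have /(integrable_ae measurableT) : mu.-integrable setT f.
  by apply/integrableP; split => //; under eq_integral do rewrite gee0_abs//.
by apply: filterS => x /(_ I) xfin; rewrite ltey_eq xfin.
Qed.

Lemma measurable_dot d (T : measurableType d) n (f g : T -> bvec R n) :
  measurable_fun setT f -> measurable_fun setT g ->
  measurable_fun setT (fun x => dot (f x) (g x)).
Proof.
move=> mf mg; apply: measurable_sum => i.
by apply: measurable_funM; exact: measurable_bmx_entry.
Qed.

Lemma dot_consv n (s t : R) (x y : 'cV[R]_n) :
  dot (consv (s, x)) (consv (t, y)) = (s * t + dot x y)%R.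
Proof.
rewrite /dot big_ord_recl !mxE unlift_none; congr (_ + _)%R.
by apply: eq_bigr => i _; rewrite !mxE liftK.
Qed.

Lemma cintegrable_vec_character n (F : bvec R n -> bC R) (gamma : 'cV[R]_n) :
  cintegrable (vol n) F ->
  cintegrable (vol n) (fun x => F x * expi (- dot gamma x))%R.
Proof.
move=> Fi; apply: (@cintegrable_bounded _ _ _ _ _ _ 1%R) => //.
  apply: cmeasurable_expi; apply: measurable_funN.
  by apply: measurable_dot; [exact: measurable_cst|exact: measurable_id].
by move=> x; rewrite normc_expi.
Qed.

Lemma measurable_fourier n (F : bvec R n -> bC R) : measurable_fun setT F ->
  measurable_fun setT (fourier F : bvec R n -> bC R).
Proof.
move=> mF; apply: (@measurable_cintegral_snd _ _ _ _ _ (vol n)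
  (fun z : bvec R n * bvec R n => F z.2 * expi (- dot z.1 z.2))%R).
apply: cmeasurableM; first exact: (measurableT_comp mF measurable_snd).
apply: cmeasurable_expi; apply: measurable_funN.
by apply: measurable_dot; [exact: measurable_fst|exact: measurable_snd].
Qed.

Lemma normc_fourier_le n (F : bvec R n -> bC R) gamma : cintegrable (vol n) F ->
  (normc (fourier F gamma))%:E <= \int[vol n]_x (normc (F x))%:E.
Proof.
move=> Fi; apply: (le_trans (normc_cintegral_le (cintegrable_vec_character gamma Fi))).
by apply/eq_lee/eq_integral => x _; rewrite normcM normc_expi mulr1.
Qed.

Lemma cintegral_cst d (T : measurableType d) (mu : {measure set T -> \bar R}) (c : R[i]) :
  mu setT = 1 -> cintegral mu (fun=> c) = c.
Proof.
by move=> mu1; rewrite /cintegral !Rintegral_cst// mu1 /= !mulr1; case: c.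
Qed.

(** R^0 is one point of mass 1 and its only character is 1, so the transform is the identity. *)
Let plancherel_vec0 (F : bvec R 0 -> bC R) :
  sqr_integral (vol 0) (fourier F : bvec R 0 -> bC R) = sqr_integral (vol 0) F.
Proof.
apply: eq_integral => x _; congr ((normc _ ^+ 2)%:E).
have x0 (y : 'cV[R]_0) : y = x by apply/colP => -[].
rewrite /fourier (_ : (fun y => _) = fun=> F x); last first.
  by apply/funext => y; rewrite (x0 y) /dot big_ord0 oppr0 expi0 mulr1.
by rewrite cintegral_cst//= diracT.
Qed.

Section step.
Variables (n : nat) (F : bvec R n.+1 -> bC R).
Hypothesis IH : forall F : bvec R n -> bC R, cintegrable (vol n) F ->
  cLfun (vol n) 2%:E setT F ->
  sqr_integral (vol n) (fourier F : bvec R n -> bC R) = sqr_integral (vol n) F.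
Hypothesis F1 : cintegrable (vol n.+1) F.
Hypothesis F2 : cLfun (vol n.+1) 2%:E setT F.

Let Fc (z : RT * bvec R n) : bC R := F (consv z).
Let mFc : measurable_fun setT Fc.
Proof. by apply: measurable_comp_consv; case: F1. Qed.

Let Fslice t : bvec R n -> bC R := fun y => Fc (t, y).

Let mFslice t : measurable_fun setT (Fslice t).
Proof. exact: (measurableT_comp mFc (pair1_measurable _)). Qed.

Let Fc1 : cintegrable (leb \x vol n) Fc.
Proof. exact: cintegrable_consv. Qed.

(** The partial transform in the last n coordinates. The full transform is the one-dimensional
    transform of P in its first variable. *)
Let P (z : RT * bvec R n) : bC R := fourier (Fslice z.1) z.2.

Let mP : measurable_fun setT P.
Proof.
apply: (@measurable_cintegral_snd _ _ _ _ _ (vol n)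
  (fun w : (RT * bvec R n) * bvec R n => Fc (w.1.1, w.2) * expi (- dot w.1.2 w.2))%R).
apply: cmeasurableM.
  apply: (measurableT_comp mFc); apply: measurable_fun_pair => //=.
  exact: (measurableT_comp measurable_fst measurable_fst).
apply: cmeasurable_expi; apply: measurable_funN.
apply: measurable_dot => //.
exact: (measurableT_comp measurable_snd measurable_fst).
Qed.

Let mPl gamma : measurable_fun setT (fun t : RT => P (t, gamma)).
Proof. exact: (measurableT_comp mP (pair2_measurable _)). Qed.

Let slice1 : {ae leb, forall t, cintegrable (vol n) (Fslice t)}.
Proof. exact: ae_cintegrable_snd Fc1. Qed.

Let sqrF : sqr_integral (vol n.+1) F = \int[leb]_t sqr_integral (vol n) (Fslice t).
Proof.
rewrite /sqr_integral ge0_integral_consv1//.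
- by apply: cmeasurable_sqr_normc; case: F1.
- by move=> x; rewrite lee_fin sqr_ge0.
Qed.

Let msqr_slice : measurable_fun setT (fun t : RT => sqr_integral (vol n) (Fslice t)).
Proof.
apply: (measurable_fun_fubini_tonelli_F (fun z : RT * bvec R n => (normc (Fc z) ^+ 2)%:E)).
  exact: cmeasurable_sqr_normc.
by move=> x; rewrite lee_fin sqr_ge0.
Qed.

Let slice2 : {ae leb, forall t, cLfun (vol n) 2%:E setT (Fslice t)}.
Proof.
have /cLfun2P[_] := F2; rewrite sqrF.
move/(ge0_integral_lty_ae msqr_slice (fun t => sqr_integral_ge0 _ _)).
by apply: filterS => t h; apply/cLfun2P.
Qed.

Let fourier_slice s gamma :
  fourier F (consv (s, gamma)) = fourier_line (fun t => P (t, gamma)) s.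
Proof.
rewrite /fourier cintegral_consv; last exact: cintegrable_vec_character.
have ch := cintegrable_consv (cintegrable_vec_character (consv (s, gamma)) F1).
rewrite -(cfubini1 ch); apply: ae_eq_cintegral.
- by case: ch => mch _; exact: (measurable_cintegral_snd (vol n) mch).
- apply: cmeasurableM; first exact: mPl.
  by apply: cmeasurable_expi; apply: measurable_funN; exact: mulrl_measurable.
(* Only almost every slice is integrable, so the factor depending on t alone can be taken out of the
   inner integral almost everywhere only. *)
- apply: filterS slice1 => t ti.
  rewrite mulrC /P /fourier -cintegralZ; last exact: cintegrable_vec_character.
  apply: eq_cintegral => y.
  by rewrite dot_consv opprD expiD mulrCA.
Qed.

(** The induction hypothesis applies to almost every slice; Tonelli's theorem then makes t the inner
    variable, ready for the theorem on the line. *)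
Let sqrP : \int[vol n]_gamma sqr_integral leb (fun t : RT => P (t, gamma)) =
  sqr_integral (vol n.+1) F.
Proof.
rewrite sqrF -(fubini_tonelli (fun z : RT * bvec R n => (normc (P z) ^+ 2)%:E)).
- apply: ge0_ae_eq_integral => //.
  + apply: (measurable_fun_fubini_tonelli_F (fun z : RT * bvec R n => (normc (P z) ^+ 2)%:E)).
      exact: cmeasurable_sqr_normc.
    by move=> x; rewrite lee_fin sqr_ge0.
  + by move=> t _; apply: integral_ge0 => y _; rewrite lee_fin sqr_ge0.
  + by move=> t _; exact: sqr_integral_ge0.
  + by apply: filterS2 slice1 slice2 => t t1 t2 _; exact: (IH t1 t2).
- exact: cmeasurable_sqr_normc.
- by move=> x; rewrite lee_fin sqr_ge0.
Qed.

(** Holds for every gamma: |P(t, gamma)| is at most the L^1 norm of the slice at t, which is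
    integrable in t. Square integrability, in [P2], comes from a double integral and holds for
    almost every gamma only. *)
Let P1 gamma : cintegrable leb (fun t : RT => P (t, gamma)).
Proof.
split; first exact: mPl.
have [_] := Fc1; rewrite fubini_tonelli1.
- apply: le_lt_trans; apply: ae_ge0_le_integral => //.
  + by move=> t _; rewrite lee_fin normc_ge0.
  + by apply/measurable_EFinP/cmeasurable_normc; exact: mPl.
  + by move=> t _; apply: integral_ge0 => y _; rewrite lee_fin normc_ge0.
  + apply: measurable_fun_fubini_tonelli_F.
      exact/measurable_EFinP/cmeasurable_normc.
    by move=> x; rewrite lee_fin normc_ge0.
  + by apply: filterS slice1 => t ti _; exact: normc_fourier_le.
- exact/measurable_EFinP/cmeasurable_normc.
- by move=> x; rewrite lee_fin normc_ge0.
Qed.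

Let msqrP : measurable_fun setT (fun gamma => sqr_integral leb (fun t : RT => P (t, gamma))).
Proof.
apply: (measurable_fun_fubini_tonelli_G (fun z : RT * bvec R n => (normc (P z) ^+ 2)%:E)).
  exact: cmeasurable_sqr_normc.
by move=> x; rewrite lee_fin sqr_ge0.
Qed.

Let P2 : {ae vol n, forall gamma, cLfun leb 2%:E setT (fun t : RT => P (t, gamma))}.
Proof.
have /cLfun2P[_] := F2; rewrite -sqrP.
move/(ge0_integral_lty_ae msqrP (fun t => sqr_integral_ge0 _ _)).
by apply: filterS => t h; apply/cLfun2P.
Qed.

Lemma plancherel_vec_step :
  sqr_integral (vol n.+1) (fourier F : bvec R n.+1 -> bC R) = sqr_integral (vol n.+1) F.
Proof.
have mF : measurable_fun setT F by case: F1.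
have mFh := measurable_fourier mF.
rewrite -sqrP [LHS]ge0_integral_consv2; last 2 first.
- exact: cmeasurable_sqr_normc.
- by move=> x; rewrite lee_fin sqr_ge0.
apply: ge0_ae_eq_integral => //.
- apply: (measurable_fun_fubini_tonelli_G (fun z : RT * bvec R n => (normc (fourier F (consv z)) ^+ 2)%:E)).
    by apply: cmeasurable_sqr_normc; exact: (measurable_comp_consv mFh).
  by move=> x; rewrite lee_fin sqr_ge0.
- by move=> t _; apply: integral_ge0 => y _; rewrite lee_fin sqr_ge0.
- by move=> t _; exact: sqr_integral_ge0.
- apply: filterS P2 => gamma h _; rewrite -(plancherel_line (P1 gamma) h).
  by apply: eq_integral => s _; rewrite fourier_slice.
Qed.

End step.

Theorem plancherel_vec n (F : bvec R n -> bC R) : cintegrable (vol n) F ->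
  cLfun (vol n) 2%:E setT F ->
  sqr_integral (vol n) (fourier F : bvec R n -> bC R) = sqr_integral (vol n) F.
Proof.
by elim: n F => [F _ _|n IH F F1 F2]; [exact: plancherel_vec0|exact: plancherel_vec_step].
Qed.

End plancherel_vec.

(** * Completeness of L^2 for geometrically Cauchy sequences *)

Section riesz_fischer.
Context d (T : measurableType d) {R : realType} (mu : {measure set T -> \bar R}).
Import Normc.

Lemma is_cvg_geometric_steps (s : nat -> R) (M : R) :
  (forall k, `|s k.+1 - s k| <= M * 2^-1 ^+ k) -> cvgn s.
Proof.
move=> sM; have M0 : 0 <= M.
  by have := sM 0%N; rewrite expr0 mulr1; exact: le_trans.
have : cvgn (series (telescope s)).
  apply: normed_cvg; apply: (@series_le_cvg _ _ (geometric M 2^-1)) => //.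
  - by move=> k; exact: normr_ge0.
  - by move=> k; rewrite /geometric /= mulr_ge0// exprn_ge0// invr_ge0.
  - by apply: is_cvg_geometric_series; rewrite ger0_norm ?invr_ge0// invf_lt1// ltr1n.
rewrite telescopeK => h.
rewrite (_ : s = (fun n => s n - s 0%N) + cst (s 0%N)).
  by apply: is_cvgD => //; exact: is_cvg_cst.
by apply/funext => k; rewrite /= fctE subrK.
Qed.

Variables (v : nat -> T -> bC R) (C : R).
Hypothesis mv : forall k, measurable_fun setT (v k).
(** The rate 16^-k is fast enough to leave a summable 4^-k after multiplication by 4^k; a pointwise
    bound on 4^k |v(k+1) - v(k)|^2 then gives steps of size 2^-k. *)
Hypothesis vC : forall k j, (k <= j)%N ->
  (sqr_integral mu (fun x => v j x - v k x)%R <= (C * 16^-1 ^+ k)%:E)%E.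

(* The weights 4 ^ k keep S integrable and force geometric convergence of v
   wherever S is finite. *)
Let a k x : \bar R := ((4 ^+ k * normc (v k.+1 x - v k x) ^+ 2)%:E)%E.

Let ma k : measurable_fun setT (a k).
Proof.
apply/measurable_EFinP; apply: measurable_funM => //; apply: measurable_funX.
by apply: cmeasurable_normc; exact: cmeasurableB.
Qed.

Let a0 k x : (0 <= a k x)%E.
Proof. by rewrite lee_fin; apply: mulr_ge0; [exact: exprn_ge0|exact: sqr_ge0]. Qed.

Let S x : \bar R := (\sum_(k <oo) a k x)%E.

Let intS : (\int[mu]_x S x < +oo)%E.
Proof.
rewrite integral_nneseries//.
apply: (@le_lt_trans _ _ (\sum_(k <oo) (C * 4^-1 ^+ k)%:E)%E).
  apply: lee_nneseries => [k _ _|k _].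
    exact: integral_ge0.
  rewrite /a; under eq_integral do rewrite EFinM.
  rewrite ge0_integralZl_EFin ?exprn_ge0//.
  - apply: (@le_trans _ _ ((4 ^+ k)%:E * (C * 16^-1 ^+ k)%:E)%E).
      by rewrite lee_wpmul2l ?lee_fin ?exprn_ge0//; exact: vC.
    rewrite -EFinM lee_fin mulrCA -exprMn.
    by rewrite (_ : 4 * 16^-1 = 4^-1)//; lra.
  - by move=> x _; rewrite lee_fin sqr_ge0.
  - by apply: cmeasurable_sqr_normc; exact: cmeasurableB.
have h : cvgn (series (geometric C (4^-1 : R))).
  by apply: is_cvg_geometric_series; rewrite ger0_norm ?invr_ge0// invf_lt1// ltr1n.
rewrite (_ : (\sum_(k <oo) _)%E = (limn (series (geometric C (4^-1 : R))))%:E) ?ltry//.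
rewrite -EFin_lim//; congr (limn _); apply/funext => k.
by rewrite /= /series /= sumEFin.
Qed.

Let mS : measurable_fun setT S.
Proof. exact: ge0_emeasurable_sum. Qed.

Let A := [set x | (S x < +oo)%E].

Let mA : measurable A.
Proof. by rewrite -[A]setTI; exact: emeasurable_fun_infty_o. Qed.

Let ptw_bound x k : A x ->
  normc (v k.+1 x - v k x) <= Num.sqrt (fine (S x)) * 2^-1 ^+ k.
Proof.
move=> Ax; have S0 : (0 <= S x)%E by exact: nneseries_ge0.
have aS : (a k x <= S x)%E.
  rewrite /S (nneseries_split 0 k.+1)// big_mkord big_ord_recr/= -addeA addeCA leeDl//.
  by rewrite adde_ge0// ?sume_ge0// nneseries_ge0.
have Sfin : S x \is a fin_num by rewrite ge0_fin_numE.
have {}aS : 4 ^+ k * normc (v k.+1 x - v k x) ^+ 2 <= fine (S x) by rewrite -lee_fin fineK.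
rewrite -(@ler_pXn2r _ 2)// ?nnegrE ?normc_ge0 ?mulr_ge0 ?exprn_ge0 ?sqrtr_ge0 ?invr_ge0//.
rewrite exprMn sqr_sqrtr ?fine_ge0// -exprM mulnC exprM.
rewrite (_ : 2^-1 ^+ 2 = 4^-1 :> R); last by rewrite exprVn -natrX.
by rewrite exprVn ler_pdivlMr ?exprn_gt0// mulrC.
Qed.

(** Set to 0 where [S] is infinite, so that the limits exist at every point and define a measurable
    function. *)
Let w k := crestrict A (v k).

Let ptw_cvg x : cvgn (fun k => complex.Re (w k x)) /\ cvgn (fun k => complex.Im (w k x)).
Proof.
have wB k : normc (w k.+1 x - w k x) <= (if x \in A then Num.sqrt (fine (S x)) else 0) * 2^-1 ^+ k.
  rewrite /w /crestrict -mulrBr normcM normc_indic indicE.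
  case: ifPn => [/set_mem|_]; last by rewrite !mul0r.
  by rewrite mul1r; exact: ptw_bound.
have ReB (z z' : R[i]) : complex.Re (z - z') = complex.Re z - complex.Re z'.
  by case: z => ? ?; case: z'.
have ImB (z z' : R[i]) : complex.Im (z - z') = complex.Im z - complex.Im z'.
  by case: z => ? ?; case: z'.
split; apply: is_cvg_geometric_steps => k.
  by rewrite -ReB; exact: le_trans (Re_le_normc _) (wB k).
by rewrite -ImB; exact: le_trans (Im_le_normc _) (wB k).
Qed.

Lemma riesz_fischer : exists2 g : T -> bC R, measurable_fun setT g &
  forall k, (sqr_integral mu (fun x => g x - v k x)%R <= (C * 16^-1 ^+ k)%:E)%E.
Proof.
pose g x : bC R := limn (fun k => complex.Re (w k x)) +i* limn (fun k => complex.Im (w k x)).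
have mw k : measurable_fun setT (w k) by exact: cmeasurable_crestrict.
have mg : measurable_fun setT g.
  apply: measurable_fun_bC => /=.
    apply: (measurable_fun_cvg (fun k => cmeasurable_Re (mw k))) => x _.
    by have [] := ptw_cvg x.
  apply: (measurable_fun_cvg (fun k => cmeasurable_Im (mw k))) => x _.
  by have [] := ptw_cvg x.
exists g => // k.
(* The hypothesis [vC] for the indices j + k and k passes to the limit in j. *)
apply: (@fatou_le _ _ _ mu (fun j x => (normc (v (j + k)%N x - v k x) ^+ 2)%:E)).
- by move=> j; apply: cmeasurable_sqr_normc; exact: cmeasurableB.
- by move=> j x; rewrite lee_fin sqr_ge0.
- by apply: cmeasurable_sqr_normc; exact: cmeasurableB.
- by move=> x; rewrite lee_fin sqr_ge0.
- have := ge0_integral_lty_ae mS (fun x => nneseries_ge0 (fun k _ _ => a0 k x)) intS.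
  apply: filterS => x Ax; apply: cvg_EFin; first exact: nearW.
  have wv j : w j x = v j x by rewrite /w /crestrict indicE mem_set// mul1r.
  have [cR cI] := ptw_cvg x.
  have shiftR : complex.Re (w (j + k)%N x) @[j --> \oo] --> limn (fun k => complex.Re (w k x)).
    by rewrite (cvg_shiftn k (fun j => complex.Re (w j x))).
  have shiftI : complex.Im (w (j + k)%N x) @[j --> \oo] --> limn (fun k => complex.Im (w k x)).
    by rewrite (cvg_shiftn k (fun j => complex.Im (w j x))).
  rewrite sqr_normcE.
  suff h : (complex.Re (w (j + k)%N x) - complex.Re (v k x)) * (complex.Re (w (j + k)%N x) - complex.Re (v k x)) +
      (complex.Im (w (j + k)%N x) - complex.Im (v k x)) * (complex.Im (w (j + k)%N x) - complex.Im (v k x)) @[j --> \oo] -->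
      complex.Re (g x - v k x) ^+ 2 + complex.Im (g x - v k x) ^+ 2.
    apply: cvg_trans h; apply: near_eq_cvg; apply: nearW => j /=.
    rewrite !wv sqr_normcE !expr2.
    by case: (v (j + k)%N x) => ? ?; case: (v k x).
  rewrite (_ : complex.Re (g x - v k x) = limn (fun k => complex.Re (w k x)) - complex.Re (v k x)); last by case: (v k x).
  rewrite (_ : complex.Im (g x - v k x) = limn (fun k => complex.Im (w k x)) - complex.Im (v k x)); last by case: (v k x).
  rewrite !expr2; apply: cvgD; apply: cvgM; apply: cvgB => //; exact: cvg_cst.
- by move=> j; exact: vC (leq_addl _ _).
Qed.

End riesz_fischer.

(** * The Plancherel transform as an operator on L^2 *)

Section plancherel_operator.
Context {R : realType} {n : nat}.
Local Notation vol := (@lebesgue_vec R n).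
Implicit Types (f g u : bvec R n -> bC R).
Import Normc.

Let N2 f := cnorm vol 2%:E setT f.

Lemma cLfun12_fourier f : cintegrable vol f -> lebesgue_L2 f ->
  lebesgue_L2 (fourier f : bvec R n -> bC R).
Proof.
move=> f1 f2; apply/cLfun2P; split; first by apply: measurable_fourier; case: f1.
by rewrite plancherel_vec//; have /cLfun2P[] := f2.
Qed.

Lemma fourierD (a : R[i]) f g gamma : cintegrable vol f -> cintegrable vol g ->
  fourier (fun x => a * f x + g x) gamma = a * fourier f gamma + fourier g gamma.
Proof.
move=> fi gi; rewrite /fourier -cintegralZ; last exact: cintegrable_vec_character.
rewrite -cintegralD; last exact: cintegrable_vec_character.
  by apply: eq_cintegral => x; rewrite mulrDl mulrA.
by apply: cintegrableZ; exact: cintegrable_vec_character.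
Qed.

Lemma fourierB f g gamma : cintegrable vol f -> cintegrable vol g ->
  fourier (fun x => f x - g x) gamma = fourier f gamma - fourier g gamma.
Proof.
move=> fi gi; rewrite /fourier -cintegralB; try exact: cintegrable_vec_character.
by apply: eq_cintegral => x; rewrite mulrBl.
Qed.

Lemma is_plancherelP f g : is_plancherel f g <-> lebesgue_L2 g /\
  exists u : nat -> bvec R n -> bC R,
    [/\ forall k, cintegrable vol (u k) /\ lebesgue_L2 (u k),
        N2 (fun x => f x - u k x) @[k --> \oo] --> 0%E &
        N2 (fun x => g x - fourier (u k) x) @[k --> \oo] --> 0%E].
Proof.
split=> -[g2 [u [u12 fu gu]]]; split => //; exists u; split => // k.
  by have [/cLfun1P] := u12 k.
by have [/cLfun1P] := u12 k.
Qed.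

(** Restrictions of f to sets of finite measure lie in L^1 and in L^2. They are chosen within 16^-k
    of f in squared norm, so that their transforms, isometric images, satisfy the hypothesis of
    [riesz_fischer] with C = 4. *)
Lemma is_plancherel_exists f : lebesgue_L2 f -> exists g, is_plancherel f g.
Proof.
move=> f2; have [mf _] := f2.
have /sigma_finiteP[E [ET ndE Efin]] := sigma_finiteT vol.
have mE k : measurable (E k) by case: (Efin k).
have Ex x : \forall k \near \oo, E k x.
  have : (\bigcup_k E k) x by rewrite -ET.
  move=> [k0 _ Ek0]; exists k0 => // k /= k0k.
  by move: Ek0; apply/subsetPset; exact: ndE.
have pos k : 0 < 16^-1 ^+ k :> R by rewrite exprn_gt0// invr_gt0.
have app k : exists m, (sqr_integral vol (fun x => f x - crestrict (E m) f x)%R < (16^-1 ^+ k)%:E)%E.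
  have := sqr_integral_crestrict_cvg f2 mE Ex.
  rewrite ge0_cvge0P; last by move=> m; exact: sqr_integral_ge0.
  by move=> /(_ _ (pos k))[m _ hm]; exists m; exact: (hm m (leqnn m)).
have [m hm] := choice app.
pose u k := crestrict (E (m k)) f.
have u1 k : cintegrable vol (u k).
  by apply: cintegrable_crestrict => //; case: (Efin (m k)).
have u2 k : lebesgue_L2 (u k) by exact: cLfun2_crestrict.
have mu_ k : measurable_fun setT (u k) by case: (u1 k).
have fu2 k : lebesgue_L2 (fun x => f x - u k x) by apply: cLfun2B => //; exact: u2.
have mfu k : measurable_fun setT (fun x => f x - u k x : bC R) by exact: cmeasurableB.
have mh k : measurable_fun setT (fourier (u k) : bvec R n -> bC R) by exact: measurable_fourier.
have dist k j : (k <= j)%N ->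
    (sqr_integral vol (fun x => fourier (u j) x - fourier (u k) x)%R <= (4 * 16^-1 ^+ k)%:E)%E.
  move=> kj; rewrite (_ : (fun x => _) = fourier (fun x => u j x - u k x)); last first.
    by apply/funext => x; rewrite fourierB.
  rewrite plancherel_vec; [|exact: cintegrableB|exact: (cLfun2B (u2 j) (u2 k))].
  rewrite (_ : (fun x => _) = (fun x => (-1) * (f x - u j x) + (f x - u k x))); last first.
    by apply/funext => x; rewrite mulN1r opprB addrA subrK.
  apply: le_trans (sqr_integralD_le _ _ _) _ => //.
    by apply: cmeasurableM => //; exact: cmeasurable_cst.
  rewrite sqr_integralZ// normcN normc1 expr1n mul1e.
  apply: (@le_trans _ _ (2%:E * ((16^-1 ^+ k)%:E + (16^-1 ^+ k)%:E))%E); last first.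
    rewrite -EFinD -EFinM lee_fin; set y : R := _ ^+ k; lra.
  rewrite lee_wpmul2l// leeD// ltW// (lt_le_trans (hm _))// lee_fin.
  by rewrite ler_wiXn2l// ?invr_ge0// invf_le1// ler1n.
have [g mg gu] := riesz_fischer mh dist.
have small (c : R) (a : nat -> \bar R) : (forall k, 0 <= a k)%E ->
    (forall k, a k <= (c * 16^-1 ^+ k)%:E)%E -> a @ \oo --> 0%E.
  move=> a0 ac; apply: ge0_cvge0_le a0 ac _; apply: cvg_EFin; first exact: nearW.
  by apply: cvg_geometric; rewrite ger0_norm ?invr_ge0// invf_lt1// ltr1n.
exists g; apply/is_plancherelP; split.
  have h2 : lebesgue_L2 (fourier (u 0%N) : bvec R n -> bC R) by exact: cLfun12_fourier.
  rewrite (_ : g = fun x => (g x - fourier (u 0%N) x) + fourier (u 0%N) x).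
    apply: cLfun2D => //; apply/cLfun2P; split; first exact: cmeasurableB.
    by apply: le_lt_trans (gu 0%N) _; rewrite ltry.
  by apply/funext => x; rewrite subrK.
exists u; split=> //; apply/cnorm2_cvg0P.
  apply: (small 1) => k; first exact: sqr_integral_ge0.
  by rewrite mul1r ltW// hm.
by apply: (small 4) => k; [exact: sqr_integral_ge0|exact: gu].
Qed.

Lemma is_plancherel_isometry f g : lebesgue_L2 f -> is_plancherel f g -> N2 g = N2 f.
Proof.
move=> f2 /is_plancherelP[g2 [u [u12 fu gu]]].
have u1 k : cintegrable vol (u k) by case: (u12 k).
have u2 k : lebesgue_L2 (u k) by case: (u12 k).
have lim1 := cvg_cnorm2 g2 (fun k => cLfun12_fourier (u1 k) (u2 k)) gu.
have lim2 := cvg_cnorm2 f2 u2 fu.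
rewrite /N2; apply: (cvg_unique _ lim1) => //.
apply: cvg_trans lim2; apply: near_eq_cvg; apply: nearW => k.
by rewrite !cnorm2E (plancherel_vec (u1 k) (u2 k)).
Qed.

Let N2_lin_cvg (a : R[i]) (f1 f2 : bvec R n -> bC R) (u1 u2 : nat -> bvec R n -> bC R) :
  measurable_fun setT f1 -> measurable_fun setT f2 ->
  (forall k, measurable_fun setT (u1 k)) -> (forall k, measurable_fun setT (u2 k)) ->
  N2 (fun x => f1 x - u1 k x) @[k --> \oo] --> 0%E ->
  N2 (fun x => f2 x - u2 k x) @[k --> \oo] --> 0%E ->
  N2 (fun x => (a * f1 x + f2 x) - (a * u1 k x + u2 k x)) @[k --> \oo] --> 0%E.
Proof.
move=> mf1 mf2 mu1 mu2 c1 c2.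
apply: (@ge0_cvge0_le _ _ (fun k => (normc a)%:E * N2 (fun x => f1 x - u1 k x)%R + N2 (fun x => f2 x - u2 k x)%R)%E).
- by move=> k; exact: cnorm2_ge0.
- move=> k; rewrite /N2 -cnorm2Z; last exact: cmeasurableB.
  rewrite (_ : (fun x => _) = (fun x => a * (f1 x - u1 k x) + (f2 x - u2 k x))); last first.
    by apply/funext => x; rewrite mulrBr addrACA -opprD.
  apply: cnorm2D; last exact: cmeasurableB.
  by apply: cmeasurableM; [exact: cmeasurable_cst|exact: cmeasurableB].
- rewrite -[X in _ --> X]adde0; apply: cvgeD => //.
  by rewrite -[X in _ --> X](mule0 (normc a)%:E); apply: cvgeZl.
Qed.

Lemma is_plancherelD (a : R[i]) f1 g1 f2 g2 : lebesgue_L2 f1 -> lebesgue_L2 f2 ->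
  is_plancherel f1 g1 -> is_plancherel f2 g2 ->
  is_plancherel (fun x => a * f1 x + f2 x) (fun x => a * g1 x + g2 x).
Proof.
move=> f12 f22 /is_plancherelP[g12 [u1 [u112 fu1 gu1]]] /is_plancherelP[g22 [u2 [u212 fu2 gu2]]].
have mu1 k : measurable_fun setT (u1 k) by case: (u112 k) => -[].
have mu2 k : measurable_fun setT (u2 k) by case: (u212 k) => -[].
apply/is_plancherelP; split; first by apply: cLfun2D => //; exact: cLfun2Z.
exists (fun k x => a * u1 k x + u2 k x); split.
- move=> k; have [? ?] := u112 k; have [? ?] := u212 k; split.
    by apply: cintegrableD => //; exact: cintegrableZ.
  by apply: cLfun2D => //; exact: cLfun2Z.
- by apply: N2_lin_cvg => //; [case: f12|case: f22].
- rewrite (_ : (fun k => _) = (fun k => N2 (fun x => (a * g1 x + g2 x) -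
      (a * fourier (u1 k) x + fourier (u2 k) x)))).
    apply: N2_lin_cvg => //; [by case: g12|by case: g22| |].
      by move=> k; exact: measurable_fourier.
    by move=> k; exact: measurable_fourier.
  apply/funext => k; congr N2; apply/funext => x.
  by rewrite fourierD//; [case: (u112 k)|case: (u212 k)].
Qed.

Lemma is_plancherel_ae f g g' : is_plancherel f g -> measurable_fun setT g' ->
  {ae vol, forall x, g x = g' x} -> is_plancherel f g'.
Proof.
move=> /is_plancherelP[g2 [u [u12 fu gu]]] mg' gg'; apply/is_plancherelP.
have [mg _] := g2; split.
  apply/cLfun2P; split => //; rewrite -(ae_eq_sqr_integral mg mg' gg').
  by have /cLfun2P[] := g2.
exists u; split => //; apply: cvg_trans gu; apply: near_eq_cvg; apply: nearW => k.
have mh : measurable_fun setT (fourier (u k) : bvec R n -> bC R).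
  by apply: measurable_fourier; case: (u12 k) => -[].
rewrite /N2 !cnorm2E; congr (_ `^ _)%E; apply: ae_eq_sqr_integral.
- exact: cmeasurableB.
- exact: cmeasurableB.
- by apply: filterS gg' => x ->.
Qed.

(** Both directions are one isometry: f2 - f1 and g2 - g1 have the same norm, so one vanishes almost
    everywhere exactly when the other does. Read one way this is uniqueness of the transform, read
    the other way its injectivity. *)
Lemma is_plancherel_ae_uniq f1 f2 g1 g2 : lebesgue_L2 f1 -> lebesgue_L2 f2 ->
  is_plancherel f1 g1 -> is_plancherel f2 g2 ->
  {ae vol, forall x, f1 x = f2 x} <-> {ae vol, forall x, g1 x = g2 x}.
Proof.
move=> f12 f22 h1 h2; have [g12 _] := h1; have [g22 _] := h2.
have [[mf1 _] [mf2 _]] := (f12, f22).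
have [[mg1 _] [mg2 _]] := (g12, g22).
have d2 : lebesgue_L2 (fun x => -1 * f1 x + f2 x) by apply: cLfun2D => //; exact: cLfun2Z.
have := is_plancherel_isometry d2 (is_plancherelD (-1) f12 f22 h1 h2).
move/(congr1 (fun x => x * x)%E); rewrite /N2 !sqr_cnorm2 => e.
have key (h k : bvec R n -> bC R) : measurable_fun setT h -> measurable_fun setT k ->
    {ae vol, forall x, h x = k x} <-> sqr_integral vol (fun x => -1 * h x + k x)%R = 0%E.
  move=> mh mk.
  have mhk : measurable_fun setT (fun x => -1 * h x + k x : bC R).
    by apply: cmeasurableD => //; apply: cmeasurableM => //; exact: cmeasurable_cst.
  split=> [hk|/(sqr_integral_eq0 mhk)].
    rewrite -(sqr_integral0 vol); apply: ae_eq_sqr_integral => //.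
    by apply: filterS hk => x ->; rewrite mulN1r addNr.
  by apply: filterS => x /eqP; rewrite mulN1r addrC subr_eq0 => /eqP ->.
by rewrite key// key// e.
Qed.

Lemma plancherelP f : lebesgue_L2 f -> is_plancherel f (plancherel f).
Proof. by move=> f2; have [g fg] := is_plancherel_exists f2; rewrite /plancherel; apply: getPex; exists g. Qed.

Lemma plancherel_ae f g : lebesgue_L2 f -> is_plancherel f g ->
  {ae vol, forall x, plancherel f x = g x}.
Proof.
move=> f2 fg; apply/(is_plancherel_ae_uniq f2 f2 (plancherelP f2) fg).
exact: aeW.
Qed.

Lemma dotC (x y : 'cV[R]_n) : dot x y = dot y x.
Proof. by apply: eq_bigr => i _; rewrite mulrC. Qed.

Let fourier_exchange u v : cintegrable vol u -> cintegrable vol v ->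
  cintegral vol (fun x => fourier u x * v x) = cintegral vol (fun x => u x * fourier v x).
Proof.
move=> ui vi.
pose K (z : bvec R n * bvec R n) : bC R := u z.1 * v z.2 * expi (- dot z.2 z.1).
have Ki : cintegrable (vol \x vol)%E K.
  apply: (@cintegrable_bounded _ _ _ _ _ _ 1).
  - exact: cintegrable_tensor.
  - apply: cmeasurable_expi; apply: measurable_funN; apply: measurable_dot.
      exact: measurable_snd.
    exact: measurable_fst.
  - by move=> z; rewrite normc_expi.
transitivity (cintegral vol (fun y => cintegral vol (fun x => K (x, y)))).
  apply: eq_cintegral => y; rewrite mulrC -cintegralZ; last exact: cintegrable_vec_character.
  by apply: eq_cintegral => x; rewrite /K mulrCA mulrA.
rewrite -(cfubini Ki); apply: eq_cintegral => x.
rewrite -cintegralZ; last exact: cintegrable_vec_character.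
by apply: eq_cintegral => y; rewrite /K mulrA dotC.
Qed.

Let normc_cintegral_mulB f g u v : lebesgue_L2 f -> lebesgue_L2 g ->
  lebesgue_L2 u -> lebesgue_L2 v ->
  ((normc (cintegral vol (fun x => f x * g x) - cintegral vol (fun x => u x * v x)))%:E
   <= N2 (fun x => f x - u x)%R * N2 g + N2 u * N2 (fun x => g x - v x)%R)%E.
Proof.
move=> f2 g2 u2 v2.
have [[mf _] [mg _]] := (f2, g2); have [[mu _] [mv _]] := (u2, v2).
have i1 : cintegrable vol (fun x => (f x - u x) * g x).
  by apply: cintegrable_mul => //; exact: cLfun2B.
have i2 : cintegrable vol (fun x => u x * (g x - v x)).
  by apply: cintegrable_mul => //; exact: cLfun2B.
rewrite -cintegralB; [|exact: cintegrable_mul|exact: cintegrable_mul].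
rewrite [X in cintegral _ X](_ : _ = (fun x => (f x - u x) * g x + u x * (g x - v x))); last first.
  by apply/funext => x; rewrite mulrBl mulrBr addrA subrK.
rewrite cintegralD//; apply: (@le_trans _ _ ((normc (cintegral vol (fun x => (f x - u x) * g x)))%:E +
   (normc (cintegral vol (fun x => u x * (g x - v x))))%:E)%E).
  by rewrite -EFinD lee_fin le_normcD.
apply: leeD; apply: le_trans (normc_cintegral_le _) _ => //.
  by apply: integral_normcM_le => //; exact: cmeasurableB.
by apply: integral_normcM_le => //; exact: cmeasurableB.
Qed.

Let cvg_cintegral_mul f g (u v : nat -> bvec R n -> bC R) :
  lebesgue_L2 f -> lebesgue_L2 g -> (forall k, lebesgue_L2 (u k)) ->
  (forall k, lebesgue_L2 (v k)) -> N2 (fun x => f x - u k x) @[k --> \oo] --> 0%E ->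
  N2 (fun x => g x - v k x) @[k --> \oo] --> 0%E ->
  (normc (cintegral vol (fun x => f x * g x) - cintegral vol (fun x => u k x * v k x)%R))%:E
    @[k --> \oo] --> 0%E.
Proof.
move=> f2 g2 u2 v2 fu gv.
have fin h : lebesgue_L2 h -> N2 h \is a fin_num.
  by move=> [_ h2]; rewrite ge0_fin_numE ?cnorm2_ge0.
apply: (@ge0_cvge0_le _ _ (fun k => N2 (fun x => f x - u k x)%R * N2 g + N2 (u k) * N2 (fun x => g x - v k x)%R)%E).
- by move=> k; rewrite lee_fin normc_ge0.
- by move=> k; exact: normc_cintegral_mulB.
- rewrite -[X in _ --> X]adde0; apply: cvgeD => //.
    by rewrite -[X in _ --> X](mul0e (N2 g)); apply: cvgeZr => //; exact: fin.
  rewrite -[X in _ --> X](mule0 (N2 f)); apply: cvgeM => //.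
    by rewrite mule_def_fin//; exact: fin.
  exact: cvg_cnorm2.
Qed.

(** The multiplication formula. For L^1 functions it is Fubini's theorem with a symmetric kernel; it
    passes to L^2 limits because the integral of a product is continuous in both factors by
    Cauchy-Schwarz. *)
Lemma is_plancherel_exchange f g f' g' : lebesgue_L2 f -> lebesgue_L2 f' ->
  is_plancherel f g -> is_plancherel f' g' ->
  cintegral vol (fun x => g x * f' x) = cintegral vol (fun x => f x * g' x).
Proof.
move=> f2 f'2 /is_plancherelP[g2 [u [u12 fu gu]]] /is_plancherelP[g'2 [v [v12 fv gv]]].
have u1 k : cintegrable vol (u k) by case: (u12 k).
have u2 k : lebesgue_L2 (u k) by case: (u12 k).
have v1 k : cintegrable vol (v k) by case: (v12 k).
have v2 k : lebesgue_L2 (v k) by case: (v12 k).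
have := cvg_cintegral_mul g2 f'2 (fun k => cLfun12_fourier (u1 k) (u2 k)) v2 gu fv.
have := cvg_cintegral_mul f2 g'2 u2 (fun k => cLfun12_fourier (v1 k) (v2 k)) fu gv.
set x := cintegral _ _; set y := cintegral _ _ => hx hy.
apply/eqP; rewrite -subr_eq0 -normc_eq0; apply/eqP.
suff : (normc (y - x))%:E @[k --> \oo] --> (0%E : \bar R).
  by move=> h; apply: EFin_inj; exact: (cvg_unique (@ereal_hausdorff R) (cvg_cst (normc (y - x))%:E) h).
pose a k := cintegral vol (fun t => fourier (u k) t * v k t).
apply: (@ge0_cvge0_le _ _ (fun k => (normc (y - a k))%:E + (normc (x - a k))%:E)%E).
- by move=> k; rewrite lee_fin normc_ge0.
- move=> k; rewrite -EFinD lee_fin [X in _ <= _ + X]normcB_swap.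
  apply: le_trans (le_normcD _ _); by rewrite addrA subrK.
- rewrite -[X in _ --> X]adde0; apply: cvgeD => //.
  apply: cvg_trans hx; apply: near_eq_cvg; apply: nearW => k.
  by rewrite /a fourier_exchange.
Qed.

End plancherel_operator.

Section inner_product.
Context d (T : measurableType d) {R : realType} (mu : {measure set T -> \bar R}).
Implicit Types (f g : T -> bC R).
Import Normc.

Lemma integrable_sqr_normc f : cLfun mu 2%:E setT f ->
  mu.-integrable setT (EFin \o (fun x => normc (f x) ^+ 2)).
Proof.
move=> /cLfun2P[mf f2]; apply/integrableP; split.
  exact: cmeasurable_sqr_normc.
by under eq_integral do rewrite /= ger0_norm ?sqr_ge0//.
Qed.

Lemma sqr_normcB (z w : R[i]) :
  normc (z - w) ^+ 2 = normc z ^+ 2 + normc w ^+ 2 - 2 * complex.Re (z * w^*%C).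
Proof. by rewrite !sqr_normcE; case: z => a b; case: w => c e /=; ring. Qed.

Lemma fine_sqr_integralB f g : cLfun mu 2%:E setT f -> cLfun mu 2%:E setT g ->
  fine (sqr_integral mu (fun x => f x - g x)) =
  fine (sqr_integral mu f) + fine (sqr_integral mu g) -
  2 * complex.Re (inner mu f g).
Proof.
move=> f2 g2; have fi := integrable_sqr_normc f2; have gi := integrable_sqr_normc g2.
have fgi := cintegrable_Re (cintegrable_inner f2 g2).
have fgi2 : mu.-integrable setT (EFin \o (fun x => 2 * complex.Re (f x * (g x)^*%C))).
  exact: integrableZl fgi.
transitivity (\int[mu]_x ((normc (f x) ^+ 2 + normc (g x) ^+ 2) - 2 * complex.Re (f x * (g x)^*%C)))%R.
  by apply: eq_Rintegral => x _; rewrite sqr_normcB.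
rewrite RintegralB//; last exact: integrableD fi gi.
by rewrite RintegralD// RintegralZl.
Qed.

Lemma inner_self f : cLfun mu 2%:E setT f ->
  inner mu f f = (fine (sqr_integral mu f))%:C.
Proof.
move=> f2; rewrite /inner (_ : (fun x => _) = (fun x => (normc (f x) ^+ 2)%:C)).
  exact: cintegral_real.
by apply/funext => x; rewrite mul_conj.
Qed.

Lemma sqr_integral_fin_num f : cLfun mu 2%:E setT f -> sqr_integral mu f \is a fin_num.
Proof. by move=> /cLfun2P[_ f2]; rewrite ge0_fin_numE ?sqr_integral_ge0. Qed.

End inner_product.

(** * Unitarity, and conjugation of the group action by the transform *)

Section plancherel_unitary.
Context {R : realType} {n : nat}.
Local Notation vol := (@lebesgue_vec R n).
Implicit Types (f g u : bvec R n -> bC R).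
Import Normc.

Lemma is_plancherel_sqr_integral f g : lebesgue_L2 f -> is_plancherel f g ->
  sqr_integral vol g = sqr_integral vol f.
Proof. by move=> f2 fg; rewrite -!sqr_cnorm2 (is_plancherel_isometry f2 fg). Qed.

(* The exchange formula says that the adjoint of the transform is its
   conjugate; an isometry whose adjoint is an isometry is onto. *)
Lemma is_plancherel_inverse g h : lebesgue_L2 g ->
  is_plancherel (fun x => (g x)^*%C) h -> is_plancherel (fun x => (h x)^*%C) g.
Proof.
move=> g2 gh; have gc2 : lebesgue_L2 (fun x => (g x)^*%C : bC R) by exact: cLfun2_conj.
have [h2 _] := gh.
have hc2 : lebesgue_L2 (fun x => (h x)^*%C : bC R) by exact: cLfun2_conj.
have [k hk] := is_plancherel_exists hc2; have [k2 _] := hk.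
have sk : sqr_integral vol k = sqr_integral vol g.
  rewrite (is_plancherel_sqr_integral hc2 hk) sqr_integral_conj.
  by rewrite (is_plancherel_sqr_integral gc2 gh) sqr_integral_conj.
have innerkg : inner vol k g = (fine (sqr_integral vol g))%:C.
  rewrite /inner (is_plancherel_exchange hc2 gc2 hk gh).
  transitivity (inner vol h h).
    by apply: eq_cintegral => x; rewrite mulrC.
  rewrite (inner_self h2).
  by rewrite (is_plancherel_sqr_integral gc2 gh) sqr_integral_conj.
have [[mk _] [mg _]] := (k2, g2).
have d2 : lebesgue_L2 (fun x => k x - g x) by exact: cLfun2B.
(* k and g have the same norm, and their inner product is the square of that norm; expanding the
   square shows that k - g has norm 0. *)
have := fine_sqr_integralB k2 g2; rewrite sk innerkg /= => d0.
have {}d0 : sqr_integral vol (fun x => k x - g x) = 0%E.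
  rewrite -[LHS](fineK (sqr_integral_fin_num d2)) d0; congr EFin.
  by move: (fine _) => r; lra.
apply: (is_plancherel_ae hk) => //.
apply: filterS (sqr_integral_eq0 (cmeasurableB mk mg) d0) => x.
by move/eqP; rewrite subr_eq0 => /eqP.
Qed.

Lemma is_plancherel_onto g : lebesgue_L2 g ->
  exists2 f, lebesgue_L2 f & is_plancherel f g.
Proof.
move=> g2; have gc2 : lebesgue_L2 (fun x => (g x)^*%C : bC R) by exact: cLfun2_conj.
have [h gh] := is_plancherel_exists gc2; have [h2 _] := gh.
by exists (fun x => (h x)^*%C); [exact: cLfun2_conj|exact: is_plancherel_inverse].
Qed.

(** Let k be a transform of conj(g2). The inversion formula identifies conj(k) with f2 almost
    everywhere, and the multiplication formula moves the transform from f1 to conj(g2). *)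
Lemma is_plancherel_inner f1 g1 f2 g2 : lebesgue_L2 f1 -> lebesgue_L2 f2 ->
  is_plancherel f1 g1 -> is_plancherel f2 g2 -> inner vol f1 f2 = inner vol g1 g2.
Proof.
move=> f12 f22 h1 h2; have [g12 _] := h1; have [g22 _] := h2.
have gc2 : lebesgue_L2 (fun x => (g2 x)^*%C : bC R) by exact: cLfun2_conj.
have [k gk] := is_plancherel_exists gc2; have [k2 _] := gk.
have kc2 : lebesgue_L2 (fun x => (k x)^*%C : bC R) by exact: cLfun2_conj.
have kg := is_plancherel_inverse g22 gk.
have kf : {ae vol, forall x, (k x)^*%C = f2 x}.
  by apply/(is_plancherel_ae_uniq kc2 f22 kg h2); exact: aeW.
rewrite {2}/inner (is_plancherel_exchange f12 gc2 h1 gk).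
have [[mf1 _] [mf2 _]] := (f12, f22); have [mk _] := k2.
apply: ae_eq_cintegral.
- by apply: cmeasurableM => //; exact: cmeasurable_conj.
- exact: cmeasurableM.
- by apply: filterS kf => x <-; rewrite conjcK.
Qed.

Lemma dot_tr (x y : 'cV[R]_n) : dot x y = (x^T *m y) ord0 ord0.
Proof. by rewrite mxE; apply: eq_bigr => i _; rewrite mxE. Qed.

Lemma dot_mulmx (A : 'M[R]_n) (x y : 'cV[R]_n) : dot x (A *m y) = dot (A^T *m x) y.
Proof. by rewrite !dot_tr trmx_mul trmxK mulmxA. Qed.

Lemma dotDr (x y z : 'cV[R]_n) : dot x (y + z) = dot x y + dot x z.
Proof. by rewrite !dot_tr mulmxDr mxE. Qed.

Lemma dotBl (x y z : 'cV[R]_n) : dot (x - y) z = dot x z - dot y z.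
Proof. by rewrite !dot_tr linearB /= mulmxBl !mxE. Qed.

Lemma dotNl (x y : 'cV[R]_n) : dot (- x) y = - dot x y.
Proof. by rewrite !dot_tr linearN /= mulNmx !mxE. Qed.

Variables (x xi : 'cV[R]_n) (h : 'M[R]_n).
Hypothesis hu : h \in unitmx.

Let dh : R := `|\det h|.

Let dh0 : 0 < dh.
Proof. by rewrite normr_gt0 -unitfE -unitmxE. Qed.

Definition time_frequency_shift f : bvec R n -> bC R := quasi_regular (1, x, xi, h) f.

(** The conjugate of T_x M_xi D_h by the transform: T_x becomes modulation by -x, M_xi becomes
    translation by xi, and D_h becomes the dilation by h^-T, whence the factor |det h|^(1/2) and the
    dual action in the argument. *)
Definition dual_time_frequency_shift g : bvec R n -> bC R := fun gamma =>
  (Num.sqrt dh)%:C * (expi (- dot gamma x) * g (h^T *m (gamma - xi))).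

Let phi (y : bvec R n) : bvec R n := invmx h *m y + (- (invmx h *m x)).

Let mphi : measurable_fun setT phi.
Proof. exact: measurable_bmx_affine. Qed.

Let phiE (k : bvec R n -> \bar R) : measurable_fun setT k -> (forall x, 0 <= k x)%E ->
  (\int[vol]_y k (phi y) = dh%:E * \int[vol]_y k y)%E.
Proof.
move=> mk k0; rewrite ge0_integral_vec_affine ?unitmx_inv//.
by rewrite det_inv normfV invrK.
Qed.

Let phiB y : invmx h *m ((y : 'cV[R]_n) - x) = phi y.
Proof. by rewrite mulmxBr. Qed.

Let phiK (y : 'cV[R]_n) : h *m phi y + x = y.
Proof. by rewrite -phiB mulKVmx// subrK. Qed.

Lemma time_frequency_shiftE f y : time_frequency_shift f y =
  (Num.sqrt dh)^-1%:C * (expi (dot (y - x) xi) * f (phi y)).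
Proof.
rewrite /time_frequency_shift /quasi_regular /translation /modulation /dilation.
by rewrite mul1r phiB mulrCA.
Qed.

Lemma cmeasurable_time_frequency_shift f : measurable_fun setT f ->
  measurable_fun setT (time_frequency_shift f).
Proof.
move=> mf; rewrite (funext (time_frequency_shiftE f)).
apply: cmeasurableM; first exact: cmeasurable_cst.
apply: cmeasurableM; last exact: (measurableT_comp mf mphi).
apply: cmeasurable_expi; apply: measurable_dot; last exact: measurable_cst.
by apply: measurable_bmxD; [exact: measurable_id|exact: measurable_cst].
Qed.

Let sqrt_dh2 : Num.sqrt dh ^+ 2 = dh. Proof. by rewrite sqr_sqrtr// ltW. Qed.

Lemma sqr_integral_time_frequency_shift f : measurable_fun setT f ->
  sqr_integral vol (time_frequency_shift f) = sqr_integral vol f.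
Proof.
move=> mf; transitivity (sqr_integral vol (fun y => (Num.sqrt dh)^-1%:C * f (phi y))).
  apply: eq_integral => y _; rewrite time_frequency_shiftE.
  by rewrite !normcM normc_expi mul1r.
rewrite sqr_integralZ; last exact: (measurableT_comp mf mphi).
rewrite (sqr_integral_substitution phiE mf) muleA -EFinM normc_real.
rewrite ger0_norm ?invr_ge0 ?sqrtr_ge0// exprVn sqrt_dh2 mulVf ?mul1e//.
exact: lt0r_neq0.
Qed.

Let psi (gamma : bvec R n) : bvec R n := h^T *m (gamma - xi).

Let psi_affine gamma : psi gamma = h^T *m gamma + (- (h^T *m xi)).
Proof. by rewrite /psi mulmxBr. Qed.

Let mpsi : measurable_fun setT psi.
Proof. by rewrite (funext psi_affine); exact: measurable_bmx_affine. Qed.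

Let psiE (k : bvec R n -> \bar R) : measurable_fun setT k -> (forall x, 0 <= k x)%E ->
  (\int[vol]_y k (psi y) = dh^-1%:E * \int[vol]_y k y)%E.
Proof.
move=> mk k0; under eq_integral do rewrite psi_affine.
by rewrite ge0_integral_vec_affine ?unitmx_tr// det_tr.
Qed.

Lemma cmeasurable_dual_time_frequency_shift g : measurable_fun setT g ->
  measurable_fun setT (dual_time_frequency_shift g).
Proof.
move=> mg; apply: cmeasurableM; first exact: cmeasurable_cst.
apply: cmeasurableM; last exact: (measurableT_comp mg mpsi).
apply: cmeasurable_expi; apply: measurable_funN; apply: measurable_dot; last exact: measurable_cst.
exact: measurable_id.
Qed.

Lemma sqr_integral_dual_time_frequency_shift g : measurable_fun setT g ->
  sqr_integral vol (dual_time_frequency_shift g) = sqr_integral vol g.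
Proof.
move=> mg; transitivity (sqr_integral vol (fun y => (Num.sqrt dh)%:C * g (psi y))).
  by apply: eq_integral => y _; rewrite !normcM normc_expi mul1r.
rewrite sqr_integralZ; last exact: (measurableT_comp mg mpsi).
rewrite (sqr_integral_substitution psiE mg) muleA -EFinM normc_real.
rewrite ger0_norm ?sqrtr_ge0// sqrt_dh2 mulfV ?mul1e//.
exact: lt0r_neq0.
Qed.

Lemma cintegrable_time_frequency_shift f : cintegrable vol f ->
  cintegrable vol (time_frequency_shift f).
Proof.
move=> fi; have [mf _] := fi.
have h1 := cintegrable_substitution (ltW dh0) mphi phiE fi.
apply: (le_cintegrable (cmeasurable_time_frequency_shift mf) (cintegrableZ ((Num.sqrt dh)^-1%:C) h1)).
by move=> y; rewrite time_frequency_shiftE !normcM normc_expi mul1r.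
Qed.

Lemma fourier_time_frequency_shift f gamma : cintegrable vol f ->
  fourier (time_frequency_shift f) gamma = dual_time_frequency_shift (fourier f) gamma.
Proof.
move=> fi.
pose G (w : bvec R n) : bC R := ((Num.sqrt dh)^-1%:C * expi (- dot gamma x)) *
  (f w * expi (- dot (h^T *m (gamma - xi)) w)).
have Gi : cintegrable vol G by apply: cintegrableZ; exact: cintegrable_vec_character.
transitivity (cintegral vol (fun y => G (phi y))).
  apply: eq_cintegral => y; rewrite time_frequency_shiftE /G.
  (* Substituting y = h phi(y) + x turns both characters into functions of phi(y), up to a constant,
     so that the integrand is G composed with [phi]. *)
  have -> : expi (- dot gamma y) = expi (- dot (h^T *m gamma) (phi y)) * expi (- dot gamma x).
    by rewrite -expiD -opprD -dot_mulmx -dotDr phiK.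
  have -> : expi (dot (y - x) xi) = expi (dot (h^T *m xi) (phi y)).
    by rewrite -dot_mulmx dotC -[y in LHS]phiK addrK.
  rewrite mulmxBr dotBl opprB addrC expiD.
  move: (expi _) (expi _) (expi _) (f _) (_%:C) => a b c e k.
  ring.
rewrite (cintegral_substitution phiE Gi) /G cintegralZ; last exact: cintegrable_vec_character.
rewrite /dual_time_frequency_shift !mulrA -complexrM; congr (_%:C * _ * _).
by rewrite -{1}sqrt_dh2 expr2 mulfK// gt_eqF// sqrtr_gt0.
Qed.

Lemma is_plancherel_time_frequency_shift f g : lebesgue_L2 f -> is_plancherel f g ->
  is_plancherel (time_frequency_shift f) (dual_time_frequency_shift g).
Proof.
move=> f2 /is_plancherelP[g2 [u [u12 fu gu]]]; have [mf _] := f2; have [mg _] := g2.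
have mu_ k : measurable_fun setT (u k) by case: (u12 k) => -[].
have L2 k : lebesgue_L2 k -> lebesgue_L2 (time_frequency_shift k).
  move=> /cLfun2P[mk k2]; apply/cLfun2P; split; first exact: cmeasurable_time_frequency_shift.
  by rewrite sqr_integral_time_frequency_shift.
apply/is_plancherelP; split.
  have /cLfun2P[_ gf] := g2; apply/cLfun2P; split.
    exact: cmeasurable_dual_time_frequency_shift.
  by rewrite sqr_integral_dual_time_frequency_shift.
exists (fun k => time_frequency_shift (u k)); split.
- by move=> k; have [u1 u2] := u12 k; split; [exact: cintegrable_time_frequency_shift|exact: L2].
- apply: cvg_trans fu; apply: near_eq_cvg; apply: nearW => k; rewrite !cnorm2E.
  rewrite -[in LHS]sqr_integral_time_frequency_shift; last exact: cmeasurableB.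
  congr (_ `^ _)%E; apply: eq_integral => y _.
  by rewrite !time_frequency_shiftE -!mulrBr.
- apply: cvg_trans gu; apply: near_eq_cvg; apply: nearW => k; rewrite !cnorm2E.
  have mh : measurable_fun setT (fourier (u k) : bvec R n -> bC R) by exact: measurable_fourier.
  rewrite -[in LHS]sqr_integral_dual_time_frequency_shift; last exact: cmeasurableB.
  congr (_ `^ _)%E; apply: eq_integral => y _.
  rewrite fourier_time_frequency_shift; last by case: (u12 k).
  by rewrite /dual_time_frequency_shift -!mulrBr.
Qed.

End plancherel_unitary.

(** * The wavelet transform and its energy *)

Section density_integral.
Context d (T : measurableType d) {R : realType}.
Variables (m : {measure set T -> \bar R}) (w : T -> R).
Hypotheses (mw : measurable_fun setT w) (w0 : forall x, (0 <= w x)%R).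
Local Open Scope ereal_scope.
Import HBNNSimple.

(** Simple functions first, where it reduces to the definition of the density on their level sets;
    then monotone convergence on both sides. *)
Lemma ge0_integral_density (f : T -> \bar R) : measurable_fun setT f ->
  (forall x, 0 <= f x) ->
  \int[density m mw w0]_x f x = \int[m]_x ((w x)%:E * f x).
Proof.
move=> mf f0; pose f_ := nnsfun_approx measurableT mf.
have mwE : measurable_fun setT (fun x => (w x)%:E) by exact/measurable_EFinP.
have step (g : {nnsfun T >-> R}) :
    \int[density m mw w0]_x (g x)%:E = \int[m]_x ((w x)%:E * (g x)%:E).
  under [LHS]eq_integral do rewrite fimfunE -fsumEFin//.
  rewrite ge0_integral_fsum//; last 2 first.
  - by move=> r; exact/measurable_EFinP/measurable_funM.
  - by move=> r x _; rewrite EFinM nnfun_muleindic_ge0.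
  transitivity (\int[m]_x (\sum_(r \in range g) (w x)%:E * (r * \1_(g @^-1` [set r]) x)%:E)); last first.
    apply: eq_integral => x _; rewrite fimfunE -fsumEFin// ge0_mule_fsumr// => r.
    by rewrite EFinM nnfun_muleindic_ge0.
  rewrite [RHS]ge0_integral_fsum//; last 2 first.
  - move=> r; apply: emeasurable_funM => //.
    exact/measurable_EFinP/measurable_funM.
  - by move=> r x _; rewrite mule_ge0 ?lee_fin// -lee_fin EFinM nnfun_muleindic_ge0.
  apply: eq_fsbigr => r; rewrite inE => -[y _ gy]; rewrite integralZl_indic_nnsfun// integral_indic// setIT.
  have r0 : (0 <= r)%R by rewrite -gy.
  rewrite [X in _ * X](_ : _ = \int[m]_(x in g @^-1` [set r]) (w x)%:E)//.
  rewrite integral_mkcond -ge0_integralZl//; last 2 first.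
  - by apply/(measurable_restrictT _ _).1 => //; exact: measurable_funTS.
  - by move=> x _; apply: erestrict_ge0 => z _; rewrite lee_fin.
  apply: eq_integral => x _; rewrite patchE indicE.
  by case: ifPn => _; rewrite ?mulr1 ?mulr0 ?mule0// muleC.
transitivity (limn (fun n => \int[density m mw w0]_x (f_ n x)%:E)).
  rewrite -monotone_convergence//.
  - by apply: eq_integral => y _; apply/esym/cvg_lim => //; exact: cvg_nnsfun_approx.
  - by move=> n; exact/measurable_EFinP/measurable_funP.
  - by move=> n y _; rewrite lee_fin.
  - by move=> y _ k l kl; rewrite lee_fin; exact/lefP/nd_nnsfun_approx.
rewrite (_ : (fun n => _) = (fun n => \int[m]_x ((w x)%:E * (f_ n x)%:E))); last first.
  by apply/funext => n; rewrite step.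
rewrite -monotone_convergence//.
- apply: eq_integral => y _; apply/cvg_lim => //.
  by apply: cvgeZl => //; exact: cvg_nnsfun_approx.
- by move=> n; apply: emeasurable_funM => //; exact/measurable_EFinP/measurable_funP.
- by move=> n y _; rewrite mule_ge0 ?lee_fin.
- move=> y _ k l kl; rewrite lee_wpmul2l ?lee_fin//; exact/lefP/nd_nnsfun_approx.
Qed.
End density_integral.

(** * Borel measurability of subgroups, subspaces and matrix operations *)

Section borel_matrix_sets.
Context {R : realType}.
Implicit Types (n : nat).

Lemma measurable_bmx_closed m n (C : set (bmx R m n)) :
  closed (C : set 'M[R]_(m, n)) -> measurable C.
Proof.
move=> cC; rewrite -(setCK C); apply: measurableC.
by apply: sub_sigma_algebra; exact: closed_openC.
Qed.

Lemma measurable_unitmx n : measurable [set h : bmx R n n | (h : 'M[R]_n) \in unitmx].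
Proof.
have mdet : measurable_fun setT (fun h : bmx R n n => \det (h : 'M[R]_n)).
  by apply: measurable_det => i j; exact: measurable_coord.
rewrite (_ : [set _ | _] = setT `&` (fun h : bmx R n n => \det (h : 'M[R]_n)) @^-1` (~` [set 0])).
  by apply: mdet => //; exact: measurableC.
by apply/seteqP; split => h /=; rewrite unitmxE unitfE; [move/eqP|move=> [_ /eqP]].
Qed.

(** H is closed in GL only, so it is its closure among all matrices cut with the Borel set of
    invertible ones. *)
Lemma measurable_closed_subgroup n (H : set (bmx R n n)) :
  closed_subgroup_GL (H : set 'M[R]_n) -> measurable H.
Proof.
move=> [Hu _ _ _ clH].
have -> : H = closure (H : set 'M[R]_n) `&` [set h : 'M[R]_n | h \in unitmx].
  by apply/seteqP; split => [h Hh|//]; split; [exact: subset_closure|exact: Hu].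
apply: measurableI; last exact: measurable_unitmx.
by apply: measurable_bmx_closed; exact: closed_closure.
Qed.

(** V is the set of fixed points of a measurable map: expand in the basis of V and sum again. *)
Lemma measurable_vspace n (V : {vspace 'cV[R]_n}) :
  measurable [set v : bvec R n | (v : 'cV[R]_n) \in V].
Proof.
pose p (v : bvec R n) : bvec R n := vspace_param (vspace_coord V v).
have mp : measurable_fun setT p.
  exact: (measurableT_comp (@measurable_vspace_param _ _ V) (@measurable_vspace_coord _ _ V)).
rewrite (_ : [set _ | _] = \bigcap_(i in [set: 'I_n]) [set v : bvec R n | v i 0 - p v i 0 = 0]).
  apply: fin_bigcap_measurable => // i _.
  have mi : measurable_fun setT (fun v : bvec R n => v i 0 - p v i 0).
    apply: measurable_funB; first exact: measurable_coord.
    exact: (measurable_bmx_entry i 0 mp).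
  by have := mi measurableT [set 0] (measurable_set1 _); rewrite setTI.
have pE v : p v = \sum_i coord (vbasis V) i v *: (vbasis V)`_i.
  by rewrite /p /vspace_param; apply: eq_bigr => i _; rewrite mxE.
apply/seteqP; split => v /=.
  by move=> vV i _; rewrite /= pE -coord_vbasis// subrr.
move=> vE; have -> : v = p v.
  by apply/colP => i; apply/eqP; rewrite -subr_eq0; apply/eqP; exact: vE.
by rewrite pE; apply: rpred_sum => i _; apply: rpredZ; apply: vbasis_mem; exact: memt_nth.
Qed.

Lemma measurable_invmx d (T : measurableType d) n (h : T -> bmx R n n) :
  measurable_fun setT h -> measurable_fun setT (fun x => invmx (h x : 'M[R]_n) : bmx R n n).
Proof.
move=> mh; apply: measurable_fun_borel_mx => // i j.
have me k l : measurable_fun setT (fun x => h x k l) by exact: measurable_bmx_entry.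
have md : measurable_fun setT (fun x => \det (h x : 'M[R]_n)) by exact: measurable_det.
(* The cofactor formula gives measurability on invertible matrices; on singular ones [invmx] returns
   its argument. *)
rewrite (_ : (fun x => _) = (fun x => if \det (h x : 'M[R]_n) != 0 then
  (\det (h x : 'M[R]_n))^-1 * cofactor (h x : 'M[R]_n) j i else h x i j)); last first.
  apply/funext => x; rewrite /invmx unitmxE unitfE.
  by case: ifPn => // _; rewrite !mxE.
apply: measurable_fun_ifT => //.
- apply: (measurable_fun_bool true).
  rewrite (_ : _ @^-1` _ = (fun x => \det (h x : 'M[R]_n)) @^-1` (~` [set 0])).
    by apply: md => //; exact: measurableC.
  by apply/seteqP; split => x /= /eqP.
- apply: measurable_funM; first exact: (measurableT_comp measurable_inv md).
  apply: measurable_funM; first exact: measurable_cst.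
  apply: measurable_det => k l.
  by rewrite (_ : (fun _ => _) = (fun x => h x (lift j k) (lift i l)))//; apply/funext => x; rewrite !mxE.
Qed.

Lemma measurable_trmx d (T : measurableType d) m n (h : T -> bmx R m n) :
  measurable_fun setT h -> measurable_fun setT (fun x => (h x : 'M[R]_(m, n))^T : bmx R n m).
Proof.
move=> mh; apply: measurable_fun_borel_mx => // i j.
by rewrite (_ : (fun x => _) = (fun x => h x j i)); [exact: measurable_bmx_entry|apply/funext => x; rewrite mxE].
Qed.

Lemma measurable_bmxB d (T : measurableType d) m n (f g : T -> bmx R m n) :
  measurable_fun setT f -> measurable_fun setT g ->
  measurable_fun setT (fun x => ((f x : 'M[R]_(m, n)) - g x)%R : bmx R m n).
Proof.
move=> mf mg; apply: measurable_fun_borel_mx => // i j.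
rewrite (_ : (fun x => _) = (fun x => f x i j - g x i j)); last first.
  by apply/funext => x; rewrite !mxE.
by apply: measurable_funB; exact: measurable_bmx_entry.
Qed.

End borel_matrix_sets.

Section wavelet_measurable.
Context {R : realType} {n : nat}.
Local Notation vol := (@lebesgue_vec R n).
Local Notation BG := (bC R * bvec R n * bvec R n * bmx R n n)%type.
Import Normc.

Lemma measurable_unit_circle : measurable [set z : bC R | normc z = 1].
Proof.
rewrite (_ : [set _ | _] = setT `&` @normc R @^-1` [set 1]); last by rewrite setTI.
exact: measurable_normc.
Qed.

Lemma cmeasurable_quasi_regular d (T : measurableType d) (z : T -> bC R)
    (x xi y : T -> bvec R n) (h : T -> bmx R n n) (psi : bvec R n -> bC R) :
  measurable_fun setT z -> measurable_fun setT x -> measurable_fun setT xi ->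
  measurable_fun setT y -> measurable_fun setT h -> measurable_fun setT psi ->
  measurable_fun setT (fun t => quasi_regular (z t, x t, xi t, h t) psi (y t) : bC R).
Proof.
move=> mz mx mxi my mh mpsi.
have myx : measurable_fun setT (fun t => ((y t : 'cV[R]_n) - x t)%R : bvec R n).
  exact: measurable_bmxB.
rewrite /quasi_regular /translation /modulation /dilation.
apply: cmeasurableM => //; apply: cmeasurableM.
  by apply: cmeasurable_expi; exact: measurable_dot.
apply: cmeasurableM.
  apply: cmeasurable_real; apply: (measurableT_comp measurable_inv).
  apply: (measurableT_comp (f := @Num.sqrt R)).
    by apply: continuous_measurable_fun; exact: sqrt_continuous.
  apply: (measurableT_comp (f := @Num.norm R R)) => //.
  by apply: measurable_det => i j; exact: measurable_bmx_entry.
apply: (measurableT_comp mpsi); apply: measurable_bmxM => //.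
exact: measurable_invmx.
Qed.

(** The integrand is jointly measurable in the group element and the integration variable;
    integrating out the latter preserves measurability. *)
Lemma cmeasurable_wavelet (psi f : bvec R n -> bC R) :
  measurable_fun setT psi -> measurable_fun setT f ->
  measurable_fun setT (wavelet psi f : bawh (R := R) (n := n) -> bC R).
Proof.
move=> mpsi mf.
have m1 : measurable_fun setT (fun p : BG * bvec R n => p.1.1.1.1).
  do 3!(apply: (measurableT_comp measurable_fst)); exact: measurable_fst.
have m2 : measurable_fun setT (fun p : BG * bvec R n => p.1.1.1.2).
  apply: (measurableT_comp measurable_snd); do 2!(apply: (measurableT_comp measurable_fst)); exact: measurable_fst.
have m3 : measurable_fun setT (fun p : BG * bvec R n => p.1.1.2).
  apply: (measurableT_comp measurable_snd); apply: (measurableT_comp measurable_fst); exact: measurable_fst.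
have m4 : measurable_fun setT (fun p : BG * bvec R n => p.1.2).
  apply: (measurableT_comp measurable_snd); exact: measurable_fst.
have m5 : measurable_fun setT (fun p : BG * bvec R n => p.2) by exact: measurable_snd.
have mF := cmeasurableM (measurableT_comp mf m5)
  (cmeasurable_conj (cmeasurable_quasi_regular m1 m2 m3 m5 m4 mpsi)).
rewrite (_ : wavelet psi f = fun g => cintegral vol (fun y =>
   f y * (quasi_regular (g.1.1.1, g.1.1.2, g.1.2, g.2) psi y)^*%C)); last first.
  by apply/funext => -[[[z x] xi] h].
exact: (measurable_cintegral_snd vol mF).
Qed.

End wavelet_measurable.

Section wavelet_fiber.
Context {R : realType} {n : nat}.
Local Notation vol := (@lebesgue_vec R n).
Implicit Types (f g psi : bvec R n -> bC R).
Import Normc.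

(** Up to the factor |det h|, the energy of the wavelet transform on the fibre over (xi, h). *)
Definition overlap g psih (xi : 'cV[R]_n) (h : 'M[R]_n) : \bar R :=
  (\int[vol]_gamma (normc (g gamma) ^+ 2 * normc (psih (h^T *m (gamma - xi))) ^+ 2)%:E)%E.

Lemma cLfun2_time_frequency_shift x xi (h : 'M[R]_n) psi : h \in unitmx ->
  lebesgue_L2 psi -> lebesgue_L2 (time_frequency_shift x xi h psi).
Proof.
move=> hu psi2; have /cLfun2P[mpsi psioo] := psi2; apply/cLfun2P.
split; first exact: cmeasurable_time_frequency_shift.
by rewrite sqr_integral_time_frequency_shift.
Qed.

Lemma cLfun2_quasi_regular z x xi (h : 'M[R]_n) psi : h \in unitmx ->
  lebesgue_L2 psi -> lebesgue_L2 (quasi_regular (z, x, xi, h) psi).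
Proof.
move=> hu psi2.
rewrite (_ : quasi_regular _ _ = fun y => z * time_frequency_shift x xi h psi y).
  exact: (cLfun2Z z (cLfun2_time_frequency_shift x xi hu psi2)).
by apply/funext => y; rewrite /time_frequency_shift /quasi_regular mul1r.
Qed.

Lemma waveletD (a : R[i]) psi f g z x xi (h : 'M[R]_n) : h \in unitmx ->
  lebesgue_L2 psi -> lebesgue_L2 f -> lebesgue_L2 g ->
  wavelet psi (fun y => a * f y + g y) (z, x, xi, h) =
  a * wavelet psi f (z, x, xi, h) + wavelet psi g (z, x, xi, h).
Proof.
move=> hu psi2 f2 g2; have q2 := cLfun2_quasi_regular z x xi hu psi2.
have fq := cintegrable_inner f2 q2; have gq := cintegrable_inner g2 q2.
rewrite /wavelet /inner -cintegralZ// -cintegralD//; last exact: cintegrableZ.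
by apply: eq_cintegral => y; rewrite mulrDl mulrA.
Qed.

Lemma normc_wavelet psi f z x xi (h : 'M[R]_n) : h \in unitmx ->
  lebesgue_L2 psi -> lebesgue_L2 f -> normc z = 1 ->
  normc (wavelet psi f (z, x, xi, h)) = normc (wavelet psi f (1, x, xi, h)).
Proof.
move=> hu psi2 f2 z1; have s2 := cLfun2_time_frequency_shift x xi hu psi2.
have -> : wavelet psi f (z, x, xi, h) = (z^*%C) * wavelet psi f (1, x, xi, h).
  rewrite /wavelet /inner -cintegralZ; last exact: (cintegrable_inner f2 s2).
  by apply: eq_cintegral => y; rewrite /quasi_regular mul1r conjcM mulrCA.
by rewrite normcM normc_conj z1 mul1r.
Qed.

Section fiber.
Variables (f g psi psih : bvec R n -> bC R) (xi : 'cV[R]_n) (h : 'M[R]_n).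
Hypotheses (f2 : lebesgue_L2 f) (psi2 : lebesgue_L2 psi).
Hypotheses (fg : is_plancherel f g) (psip : is_plancherel psi psih).
Hypothesis hu : h \in unitmx.

(** The dual shift is taken at x = 0. The character carrying x, once conjugated, is the kernel of
    the Fourier transform at -x. *)
Let F : bvec R n -> bC R := fun gamma =>
  g gamma * (dual_time_frequency_shift 0 xi h psih gamma)^*%C.

Lemma wavelet_fourier x : wavelet psi f (1, x, xi, h) = fourier F (- x).
Proof.
rewrite /wavelet (is_plancherel_inner f2 (cLfun2_time_frequency_shift x xi hu psi2) fg
  (is_plancherel_time_frequency_shift x xi hu psi2 psip)).
apply: eq_cintegral => gamma; rewrite /F /dual_time_frequency_shift.
rewrite dotNl opprK !conjcM -(expiN (- dot gamma x)) opprK -expiN opprK.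
have -> : dot gamma 0 = 0 by rewrite /dot big1// => i _; rewrite mxE mulr0.
by rewrite expi0 mul1r [dot x gamma]dotC; ring.
Qed.

Lemma sqr_integral_wavelet z : normc z = 1 -> (overlap g psih xi h < +oo)%E ->
  (\int[vol]_x (normc (wavelet psi f (z, x, xi, h)) ^+ 2)%:E =
   `|\det h|%:E * overlap g psih xi h)%E.
Proof.
move=> z1 Loo; have [g2 _] := fg; have [psih2 _] := psip.
have [[mg _] [mpsih _]] := (g2, psih2).
have d2 : lebesgue_L2 (dual_time_frequency_shift 0 xi h psih).
  by have [] := is_plancherel_time_frequency_shift 0 xi hu psi2 psip.
have F1 : cintegrable vol F by exact: cintegrable_inner.
have [mF _] := F1.
have FE : sqr_integral vol F = (`|\det h|%:E * overlap g psih xi h)%E.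
  rewrite /overlap -ge0_integralZl_EFin//; last 2 first.
  - by move=> gamma _; rewrite lee_fin mulr_ge0 ?sqr_ge0.
  - apply/measurable_EFinP; apply: measurable_funM; apply: measurable_funX; apply: cmeasurable_normc => //.
    apply: (measurableT_comp mpsih); apply: measurable_bmxM; first exact: measurable_cst.
    by apply: measurable_bmxB; [exact: measurable_id|exact: measurable_cst].
  apply: eq_integral => gamma _; rewrite -EFinM; congr EFin.
  rewrite /F /dual_time_frequency_shift normcM normc_conj !normcM normc_expi mul1r normc_real.
  rewrite ger0_norm ?sqrtr_ge0// !exprMn sqr_sqrtr ?normr_ge0//; ring.
(* Finiteness of the overlap enters here: it provides the square integrability of F under which
   [plancherel_vec] applies. *)
have F2 : lebesgue_L2 F.
  by apply/cLfun2P; split => //; rewrite FE lte_mul_pinfty.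
pose S (x : bvec R n) : \bar R := (normc (fourier F (- (x : 'cV[R]_n))) ^+ 2)%:E.
transitivity (\int[vol]_x S x)%E.
  by apply: eq_integral => x _; rewrite normc_wavelet// wavelet_fourier.
(* The reflection x -> -x is undone by the change of variables with the matrix -1, whose determinant
   has modulus 1. *)
have uN1 : (- 1%:M : 'M[R]_n) \in unitmx by rewrite unitmxE -scaleN1r detZ det1 mulr1 unitrX// unitrN1.
rewrite -FE -(plancherel_vec F1 F2) [RHS]/sqr_integral.
have mS : measurable_fun setT (fun x : bvec R n => (normc (fourier F x) ^+ 2)%:E).
  by apply: cmeasurable_sqr_normc; exact: measurable_fourier.
have S0 (x : bvec R n) : (0 <= (normc (fourier F x) ^+ 2)%:E)%E by rewrite lee_fin sqr_ge0.
have := ge0_integral_mulmx uN1 mS S0.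
rewrite -scaleN1r detZ det1 mulr1 normrX normrN1 expr1n invr1 mul1e => <-.
by apply: eq_integral => x _; rewrite scaleN1r mulNmx mul1mx.
Qed.

End fiber.

End wavelet_fiber.

(** * Iterated integrals over the factors of the group *)

Section iterated_integrals.
Context {R : realType}.
Local Open Scope ereal_scope.

Section two.
Context d1 d2 (T1 : measurableType d1) (T2 : measurableType d2).
Variables (m1 : {sigma_finite_measure set T1 -> \bar R}).
Variables (m2 : {sigma_finite_measure set T2 -> \bar R}).
Variable f : T1 * T2 -> \bar R.
Hypotheses (mf : measurable_fun setT f) (f0 : forall z, 0 <= f z).

Lemma ge0_integral_prod1 :
  \int[prod_measure m1 m2]_z f z = \int[m1]_x \int[m2]_y f (x, y).
Proof. exact: (fubini_tonelli1 f mf f0). Qed.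

Lemma ge0_integral_prod2 :
  \int[prod_measure m1 m2]_z f z = \int[m2]_y \int[m1]_x f (x, y).
Proof. exact: (fubini_tonelli2 f mf f0). Qed.

Lemma measurable_ge0_integral_snd : measurable_fun setT (fun x => \int[m2]_y f (x, y)).
Proof. exact: (measurable_fun_fubini_tonelli_F f mf f0). Qed.

Lemma measurable_ge0_integral_fst : measurable_fun setT (fun y => \int[m1]_x f (x, y)).
Proof. exact: (measurable_fun_fubini_tonelli_G f mf f0). Qed.

End two.

Section four.
Context d1 d2 d3 d4 (T1 : measurableType d1) (T2 : measurableType d2)
  (T3 : measurableType d3) (T4 : measurableType d4).
Variables (m1 : {sigma_finite_measure set T1 -> \bar R}).
Variables (m2 : {sigma_finite_measure set T2 -> \bar R}).
Variables (m3 : {sigma_finite_measure set T3 -> \bar R}).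
Variables (m4 : {sigma_finite_measure set T4 -> \bar R}).
Variable f : T1 * T2 * T3 * T4 -> \bar R.
Hypotheses (mf : measurable_fun setT f) (f0 : forall z, 0 <= f z).

Let F (z : T3 * T4 * (T1 * T2)) := f (z.2, z.1.1, z.1.2).

Let mF : measurable_fun setT F.
Proof.
apply: (measurableT_comp mf); apply: measurable_fun_pair.
  apply: measurable_fun_pair; first exact: measurable_snd.
  by apply: (measurableT_comp measurable_fst); exact: measurable_fst.
by apply: (measurableT_comp measurable_snd); exact: measurable_fst.
Qed.

Let FE p : \int[prod_measure m1 m2]_z F (p, z) =
  \int[m1]_x \int[m2]_y f (x, y, p.1, p.2).
Proof.
exact: (ge0_integral_prod1 m1 m2 (measurableT_comp mF (pair1_measurable p)) (fun z => f0 _)).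
Qed.

Lemma measurable_ge0_integral_fiber :
  measurable_fun setT (fun p => \int[m1]_x \int[m2]_y f (x, y, p.1, p.2)).
Proof.
rewrite -(funext FE); apply: (@measurable_ge0_integral_snd _ _ _ _ (prod_measure m1 m2) F mF).
by move=> z; exact: f0.
Qed.

(** The Haar measure is nested as ((z, x), xi), h. This order puts z and x inside, over a fixed (xi,
    h), where Plancherel in x is applied. *)
Lemma ge0_integral_prod4 :
  \int[prod_measure (prod_measure (prod_measure m1 m2) m3) m4]_z f z =
  \int[prod_measure m3 m4]_p \int[m1]_x \int[m2]_y f (x, y, p.1, p.2).
Proof.
rewrite -(funext FE) ge0_integral_prod2//.
rewrite (ge0_integral_prod2 m3 m4); last 2 first.
- exact: (@measurable_ge0_integral_snd _ _ _ _ (prod_measure m1 m2) F mF (fun z => f0 _)).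
- by move=> p; apply: integral_ge0 => z _; exact: f0.
apply: eq_integral => s _.
exact: (ge0_integral_prod2 (prod_measure m1 m2) m3
  (measurableT_comp mf (pair2_measurable s)) (fun z => f0 _)).
Qed.

End four.

End iterated_integrals.

Section wavelet_energy.
Context {R : realType} {n : nat}.
Local Notation vol := (@lebesgue_vec R n).
Variables (V : {vspace 'cV[R]_n}) (H : set (bmx R n n)).
Variable muH : {sigma_finite_measure set (bmx R n n) -> \bar R}.
Hypothesis hH : closed_subgroup_GL (H : set 'M[R]_n).
Import Normc.
Local Open Scope ereal_scope.
Local Notation mVH := (prod_measure (lebesgue_vspace V) muH).

Let VV : set (bvec R n) := [set xi | (xi : 'cV[R]_n) \in V].

Let mVV : measurable VV. Proof. exact: measurable_vspace. Qed.
Let mH : measurable H. Proof. exact: measurable_closed_subgroup. Qed.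

(** The Haar weight without 1 / |det h|, which cancels against the |det h| produced by Plancherel in
    x. The indicators extend the integrals over V and H to the whole product space. *)
Definition fiber_weight (p : bvec R n * bmx R n n) : R :=
  (`|det_on V (p.2 : 'M[R]_n)^T| * (\1_VV p.1 * \1_H p.2))%R.

Lemma fiber_weight_ge0 p : (0 <= fiber_weight p)%R.
Proof. by rewrite !mulr_ge0 ?normr_ge0. Qed.

Lemma measurable_fiber_weight : measurable_fun setT fiber_weight.
Proof.
apply: measurable_funM.
  apply: (measurableT_comp (f := @Num.norm R R)) => //; apply: measurable_det_on => i j.
  apply: (measurable_bmx_entry i j (f := fun p : bvec R n * bmx R n n => (p.2 : 'M[R]_n)^T : bmx R n n)).
  exact: (measurable_trmx (@measurable_snd _ _ _ _)).
apply: measurable_funM.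
  exact: (measurableT_comp (measurable_indic mVV) measurable_fst).
exact: (measurableT_comp (measurable_indic mH) measurable_snd).
Qed.

Lemma cmeasurable_dual_action (k : bvec R n -> bC R) : measurable_fun setT k ->
  measurable_fun setT (fun z : bvec R n * (bvec R n * bmx R n n) =>
    k ((z.2.2 : 'M[R]_n)^T *m (z.1 - z.2.1))%R).
Proof.
move=> mk; apply: (measurableT_comp mk); apply: measurable_bmxM.
  apply: measurable_trmx; apply: (measurableT_comp measurable_snd); exact: measurable_snd.
apply: measurable_bmxB; first exact: measurable_fst.
by apply: (measurableT_comp measurable_fst); exact: measurable_snd.
Qed.

Lemma overlap_ge0 (g k : bvec R n -> bC R) (xi : 'cV[R]_n) (h : 'M[R]_n) :
  0 <= overlap g k xi h.
Proof. by apply: integral_ge0 => y _; rewrite lee_fin mulr_ge0 ?sqr_ge0. Qed.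

Lemma measurable_overlap (g k : bvec R n -> bC R) :
  measurable_fun setT g -> measurable_fun setT k ->
  measurable_fun setT (fun p : bvec R n * bmx R n n => overlap g k p.1 p.2).
Proof.
move=> mg mk.
pose F (z : bvec R n * (bvec R n * bmx R n n)) := (normc (g z.1) ^+ 2 *
  normc (k ((z.2.2 : 'M[R]_n)^T *m (z.1 - z.2.1))) ^+ 2)%:E.
have mF : measurable_fun setT F.
  apply/measurable_EFinP; apply: measurable_funM; apply: measurable_funX; apply: cmeasurable_normc.
    exact: (measurableT_comp mg measurable_fst).
  exact: cmeasurable_dual_action.
have F0 z : 0 <= F z by rewrite lee_fin mulr_ge0 ?sqr_ge0.
exact: (measurable_ge0_integral_fst vol mF F0).
Qed.

Section density_function.
Variable psi : bvec R n -> bC R.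
Hypothesis psi2 : lebesgue_L2 psi.
Let psih : bvec R n -> bC R := plancherel psi.

Let mpsih : measurable_fun setT psih.
Proof. by have [[]] := plancherelP psi2. Qed.

Let K (u : bvec R n -> R) (z : bvec R n * (bvec R n * bmx R n n)) : \bar R :=
  (u z.1 * (normc (psih ((z.2.2 : 'M[R]_n)^T *m (z.1 - z.2.1))) ^+ 2 * fiber_weight z.2))%:E.

Let mK u : measurable_fun setT u -> measurable_fun setT (K u).
Proof.
move=> mu; apply/measurable_EFinP; apply: measurable_funM.
  exact: (measurableT_comp mu measurable_fst).
apply: measurable_funM; last exact: (measurableT_comp measurable_fiber_weight measurable_snd).
by apply: measurable_funX; apply: cmeasurable_normc; exact: cmeasurable_dual_action.
Qed.

Let K0 u : (forall x, 0 <= u x)%R -> forall z, 0 <= K u z.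
Proof.
move=> u0 z; rewrite lee_fin; apply: mulr_ge0; first exact: u0.
by apply: mulr_ge0; [exact: sqr_ge0|exact: fiber_weight_ge0].
Qed.

Let K1 : bvec R n * (bvec R n * bmx R n n) -> \bar R := K (fun=> 1%R).

Let mK1 : measurable_fun setT K1. Proof. exact: (mK (measurable_cst _)). Qed.

Let K10 z : 0 <= K1 z. Proof. by apply: K0. Qed.

Let mK1s gamma : measurable_fun setT (fun p => K1 (gamma, p)).
Proof. exact: (measurableT_comp mK1 (pair1_measurable gamma)). Qed.

Lemma Phi_prod gamma : Phi V H muH psi gamma = \int[mVH]_p K1 (gamma, p).
Proof.
rewrite (ge0_integral_prod1 _ _ (f := fun p => K1 (gamma, p))); last 2 first.
- exact: mK1s.
- by move=> p; exact: K10.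
rewrite /Phi [LHS]integral_mkcond; apply: eq_integral => xi _.
rewrite patchE; case: ifPn => [xiV|xiV].
  rewrite [LHS]integral_mkcond; apply: eq_integral => h _.
  rewrite patchE /K1 /K /fiber_weight mul1r; case: ifPn => [hH'|hH'].
    by rewrite !indicE hH' xiV !mulr1.
  by rewrite !indicE (negbTE hH') !mulr0.
rewrite integral0_eq// => h _.
by rewrite /K1 /K /fiber_weight !indicE (negbTE xiV) mul0r !mulr0.
Qed.

Lemma Phi_ge0 gamma : 0 <= Phi V H muH psi gamma.
Proof. by rewrite Phi_prod; apply: integral_ge0 => p _; exact: K10. Qed.

Lemma measurable_Phi : measurable_fun setT (Phi V H muH psi : bvec R n -> \bar R).
Proof.
rewrite (funext Phi_prod).
exact: (measurable_ge0_integral_snd mVH mK1 K10).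
Qed.

(** Tonelli's theorem between gamma and (xi, h). For u = |g|^2 the inner integral on the right is
    the overlap of g with psi^ at p. *)
Lemma ge0_integral_Phi (u : bvec R n -> R) : measurable_fun setT u -> (forall x, 0 <= u x)%R ->
  \int[vol]_gamma ((u gamma)%:E * Phi V H muH psi gamma) =
  \int[mVH]_p ((fiber_weight p)%:E * \int[vol]_gamma
     (u gamma * normc (psih ((p.2 : 'M[R]_n)^T *m (gamma - p.1))) ^+ 2)%:E).
Proof.
move=> mu u0.
transitivity (\int[vol]_gamma \int[mVH]_p K u (gamma, p)).
  apply: eq_integral => gamma _; rewrite Phi_prod -ge0_integralZl_EFin//.
  by apply: eq_integral => p _; rewrite -EFinM /K1 /K mul1r.
rewrite -(ge0_integral_prod1 vol mVH (mK mu) (K0 u0)) (ge0_integral_prod2 vol mVH (mK mu) (K0 u0)).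
apply: eq_integral => p _; rewrite -ge0_integralZl_EFin ?fiber_weight_ge0//.
- by apply: eq_integral => gamma _; rewrite -EFinM /K mulrA mulrC.
- by move=> gamma _; rewrite lee_fin mulr_ge0 ?sqr_ge0.
- apply/measurable_EFinP; apply: measurable_funM => //; apply: measurable_funX; apply: cmeasurable_normc.
  exact: (measurableT_comp (cmeasurable_dual_action mpsih) (pair2_measurable p)).
Qed.

End density_function.

End wavelet_energy.

Lemma ge0_integral_haar_awh (R : realType) (n : nat) (V : {vspace 'cV[R]_n})
    (muH : {sigma_finite_measure set (bmx R n n) -> \bar R})
    (f : bawh (R := R) (n := n) -> \bar R) : measurable_fun setT f ->
  (forall x, 0 <= f x)%E ->
  (\int[haar_awh V muH]_x f x =
   \int[prod_measure (prod_measure (prod_measure (@circle_measure R) (@lebesgue_vec R n))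
       (lebesgue_vspace V)) muH]_x ((haar_weight V x)%:E * f x))%E.
Proof.
by move=> mf f0; rewrite /haar_awh; apply: ge0_integral_density; [exact: mf|exact: f0].
Qed.

Section wavelet_energy_identity.
Context {R : realType} {n : nat}.
Local Notation vol := (@lebesgue_vec R n).
Variables (V : {vspace 'cV[R]_n}) (H : set (bmx R n n)).
Variable muH : {sigma_finite_measure set (bmx R n n) -> \bar R}.
Variable G : set (bC R * bvec R n * bvec R n * bmx R n n).
Hypothesis hH : closed_subgroup_GL (H : set 'M[R]_n).
Hypothesis GE : forall z x xi h, G (z, x, xi, h) <->
  [/\ Normc.normc z = 1, (xi : 'cV[R]_n) \in V & H h].
Import Normc.
Local Open Scope ereal_scope.
Local Notation mVH := (prod_measure (lebesgue_vspace V) muH).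
Local Notation w := (fiber_weight V H).

Lemma measurable_translation_complete : measurable G.
Proof.
rewrite (_ : G = [set z : bC R | normc z = 1%R] `*` [set: bvec R n] `*`
    [set xi : bvec R n | (xi : 'cV[R]_n) \in V] `*` H); last first.
  by apply/seteqP; split => -[[[z x] xi] h] /=; rewrite GE/=; [case|move=> [[[]]]].
apply: measurableX; last exact: measurable_closed_subgroup.
apply: measurableX; last exact: measurable_vspace.
by apply: measurableX => //; exact: measurable_unit_circle.
Qed.

(** The measure dz lives on C; all values of [expi] have modulus 1, so its whole mass 1 sits on the
    unit circle. *)
Lemma circle_measure_unit (c : \bar R) : 0 <= c ->
  \int[@circle_measure R]_z ((\1_[set z : bC R | normc z = 1%R] z)%:E * c) = c.
Proof.
move=> c0; have mC := @measurable_unit_circle R.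
rewrite ge0_integralZr//; last by apply/measurable_EFinP; exact: measurable_indic.
rewrite integral_indic// setIT -[LHS]/(circle_measure _ * c) /circle_measure /pushforward.
rewrite (_ : expi @^-1` _ = setT); last first.
  by apply/seteqP; split => // t _ /=; exact: normc_expi.
have := @circle_measureT R; rewrite /circle_measure /pushforward preimage_setT => ->.
by rewrite mul1e.
Qed.

Variables (psi f g : bvec R n -> bC R).
Hypotheses (psi2 : lebesgue_L2 psi) (f2 : lebesgue_L2 f) (fg : is_plancherel f g).

Let mpsi : measurable_fun setT psi. Proof. by case: psi2. Qed.
Let mf : measurable_fun setT f. Proof. by case: f2. Qed.
Let mg : measurable_fun setT g. Proof. by case: fg => -[]. Qed.

Let W (x : bC R * bvec R n * bvec R n * bmx R n n) : \bar R :=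
  (normc (wavelet psi f x) ^+ 2)%:E.

Let mW : measurable_fun setT W.
Proof. exact: (cmeasurable_sqr_normc (cmeasurable_wavelet mpsi mf)). Qed.

Let Q x : \bar R := (haar_weight V x)%:E * (W \_ G) x.

Let Q0 x : 0 <= Q x.
Proof.
rewrite mule_ge0 ?lee_fin ?haar_weight_ge0//.
by apply: erestrict_ge0 => y _; rewrite lee_fin sqr_ge0.
Qed.

Let mWG : measurable_fun setT (W \_ G).
Proof.
apply/(measurable_restrictT _ _).1; first exact: measurable_translation_complete.
exact: measurable_funTS.
Qed.

Let mQ : measurable_fun setT Q.
Proof.
apply: emeasurable_funM; last exact: mWG.
by apply/measurable_EFinP; exact: measurable_haar_weight.
Qed.

Lemma wavelet_energy_fiber (p : bvec R n * bmx R n n) :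
  (w p)%:E * overlap g (plancherel psi) p.1 p.2 < +oo ->
  \int[@circle_measure R]_z \int[vol]_x Q (z, x, p.1, p.2) =
  (w p)%:E * overlap g (plancherel psi) p.1 p.2.
Proof.
case: p => xi h /= Loo; set L := overlap _ _ _ _ in Loo *.
have L0 : 0 <= L by exact: overlap_ge0.
rewrite -[RHS]circle_measure_unit; last by rewrite mule_ge0 ?lee_fin ?fiber_weight_ge0.
apply: eq_integral => z _.
(* Membership in G does not depend on the translation, so it is decided at x = 0 for the whole
   fibre. *)
have [Gz|Gz] := pselect (G (z, 0%R, xi, h)); last first.
  rewrite integral0_eq => [|x _].
    apply/esym; rewrite /fiber_weight !indicE.
    have [/set_mem z1|z1] := boolP (z \in _); last by rewrite mul0e.
    have [/set_mem xV|xV] := boolP (xi \in _); last by rewrite mul0r mulr0 mul0e mule0.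
    have [/set_mem hh|hh] := boolP (h \in _); last by rewrite !mulr0 mul0e mule0.
    by case: Gz; apply/GE.
  rewrite /Q patchE ifF ?mule0//; apply/negbTE/negP => /set_mem /GE ?.
  by apply: Gz; apply/GE.
have /GE[z1 xV hh] := Gz.
have hu : (h : 'M[R]_n) \in unitmx by case: hH => Hu _ _ _ _; exact: Hu.
have wE : w (xi, h) = `|det_on V (h : 'M[R]_n)^T|%R.
  by rewrite /fiber_weight !indicE !mem_set// !mulr1.
rewrite indicE mem_set// mul1e.
have QE x : Q (z, x, xi, h) = (haar_weight V (z, x, xi, h))%:E * W (z, x, xi, h).
  by rewrite /Q patchE mem_set//; apply/GE.
under eq_integral do rewrite QE /haar_weight /=.
(* A finite weighted overlap says nothing about the overlap itself when the weight is 0, but then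
   both sides vanish. Otherwise the overlap is finite. *)
have [w0|w0] := eqVneq (w (xi, h)) 0%R.
  rewrite w0 mul0e integral0_eq// => x _.
  by rewrite -wE w0 mul0r mul0e.
have Lfin : L < +oo.
  rewrite ltey; apply: contraTN Loo => /eqP ->.
  by rewrite gt0_muley// lte_fin lt0r w0 fiber_weight_ge0.
have m4 : measurable_fun setT (fun x : bvec R n => ((z, x), xi, h) : bC R * bvec R n * bvec R n * bmx R n n).
  apply: measurable_fun_pair; last exact: measurable_cst.
  apply: measurable_fun_pair; last exact: measurable_cst.
  by apply: measurable_fun_pair; [exact: measurable_cst|exact: measurable_id].
have mWx : measurable_fun setT (fun x : bvec R n => W (z, x, xi, h)).
  exact: (measurableT_comp mW m4).
rewrite (@ge0_integralZl_EFin _ _ _ vol setT measurableT (fun x => W (z, x, xi, h)))//; last first.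
  by move=> x _; rewrite lee_fin sqr_ge0.
rewrite (sqr_integral_wavelet f2 psi2 fg (plancherelP psi2) hu z1 Lfin) muleA -EFinM wE -mulrA mulVf ?mulr1//.
by rewrite normr_eq0 -unitfE -unitmxE.
Qed.

(** Both sides are integrals over (xi, h); the fibre identity holds wherever the weighted overlap is
    finite, and almost everywhere is enough to equate them. *)
Lemma wavelet_energy :
  {ae mVH, forall p, (w p)%:E * overlap g (plancherel psi) p.1 p.2 < +oo} ->
  \int[haar_awh V muH]_(x in G) (normc (wavelet psi f x) ^+ 2)%:E =
  \int[vol]_gamma ((normc (g gamma) ^+ 2)%:E * Phi V H muH psi gamma).
Proof.
move=> ae_fin.
rewrite integral_mkcond.
have WG0 x : 0 <= (W \_ G) x by apply: erestrict_ge0 => y _; rewrite lee_fin sqr_ge0.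
rewrite (ge0_integral_haar_awh V muH mWG WG0).
rewrite (ge0_integral_prod4 _ _ _ _ mQ Q0).
have mu : measurable_fun setT (fun gamma => normc (g gamma) ^+ 2)%R.
  by apply: measurable_funX; exact: cmeasurable_normc.
rewrite (ge0_integral_Phi V muH hH psi2 mu); last by move=> x; exact: sqr_ge0.
apply: ge0_ae_eq_integral => //.
- exact: measurable_ge0_integral_fiber.
- apply: emeasurable_funM; last by apply: measurable_overlap => //; have [[]] := plancherelP psi2.
  by apply/measurable_EFinP; exact: measurable_fiber_weight.
- by move=> p _; do 2!(apply: integral_ge0 => ? _); exact: Q0.
- by move=> p _; rewrite mule_ge0 ?lee_fin ?fiber_weight_ge0// overlap_ge0.
- by apply: filterS ae_fin => p pfin _; exact: wavelet_energy_fiber.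
Qed.

End wavelet_energy_identity.

(** * Admissibility *)

Section sqr_norm_on_set.
Context d (T : measurableType d) {R : realType} (mu : {measure set T -> \bar R}).
Import Normc.
Local Open Scope ereal_scope.

Lemma sqr_cnorm2_set (D : set T) (f : T -> bC R) : measurable D -> measurable_fun D f ->
  cnorm mu 2%:E D f * cnorm mu 2%:E D f = \int[mu]_(x in D) (normc (f x) ^+ 2)%:E.
Proof.
move=> mD mf; rewrite cnorm2_setE//.
by rewrite poweR_half_sqr// integral_ge0// => x _; rewrite lee_fin sqr_ge0.
Qed.

Lemma integral_sqr_normc_eq0 (D : set T) (f : T -> bC R) :
  measurable D -> measurable_fun setT f ->
  \int[mu]_(x in D) (normc (f x) ^+ 2)%:E = 0 <-> {ae mu, forall x, D x -> f x = 0%R}.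
Proof.
move=> mD mf.
have -> : \int[mu]_(x in D) (normc (f x) ^+ 2)%:E = \int[mu]_(x in D) `|(normc (f x) ^+ 2)%:E|.
  by apply: eq_integral => x _; rewrite gee0_abs// lee_fin sqr_ge0.
have mf2 : measurable_fun D (fun x => (normc (f x) ^+ 2)%:E).
  by apply: measurable_funTS; exact: cmeasurable_sqr_normc.
split.
  move/(ae_eq_integral_abs mu mD mf2); apply: filterS => x h /h [/eqP].
  by rewrite sqrf_eq0 => /eqP; exact: eq0_normc.
move=> f0; apply/(ae_eq_integral_abs mu mD mf2); apply: filterS f0 => x h /h ->.
by rewrite normc0 expr0n.
Qed.

End sqr_norm_on_set.

(** Reduces a null set claim to subsets of finite measure, whose indicators are in L^2 and can serve
    as transforms of test functions. *)
Lemma sigma_finite_negligible d (T : measurableType d) {R : realType}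
    (mu : {sigma_finite_measure set T -> \bar R}) (N : set T) : measurable N ->
  (forall B, measurable B -> B `<=` N -> (mu B < +oo)%E -> mu B = 0%E) ->
  {ae mu, forall x, ~ N x}.
Proof.
move=> mN N0; have [E ET Efin] := sigma_finiteT mu.
have : mu.-negligible (\bigcup_k (N `&` E k)).
  apply: negligible_bigcup => k; have [mE Ek] := Efin k.
  have mNE : measurable (N `&` E k) by exact: measurableI.
  apply/negligibleP => //; apply: N0 => //.
  by apply: le_lt_trans Ek; apply: le_measure; rewrite ?inE//; exact: subIsetr.
apply: negligibleS => x /= /contrapT Nx.
by have : [set: T] x by []; rewrite ET => -[k _ Ex]; exists k.
Qed.

Section admissibility_criterion.
Context {R : realType} {n : nat}.
Local Notation vol := (@lebesgue_vec R n).
Variables (V : {vspace 'cV[R]_n}) (H : set (bmx R n n)).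
Variable muH : {sigma_finite_measure set (bmx R n n) -> \bar R}.
Variable G : set (bC R * bvec R n * bvec R n * bmx R n n).
Variables (U : set (bvec R n)) (psi : bvec R n -> bC R).
Hypothesis hH : closed_subgroup_GL (H : set 'M[R]_n).
Hypothesis GE : forall z x xi h, G (z, x, xi, h) <->
  [/\ Normc.normc z = 1, (xi : 'cV[R]_n) \in V & H h].
Hypothesis mU : measurable U.
Import Normc.
Local Open Scope ereal_scope.
Local Notation S := (spectral_subspace U).
Local Notation muG := (haar_awh V muH).
Local Notation Phi := (Phi V H muH psi).
Hypothesis clS : closed_subspace S.
Hypothesis psiS : S psi.

Let psi2 : lebesgue_L2 psi. Proof. by case: psiS. Qed.
Let mpsi : measurable_fun setT psi. Proof. by case: psi2. Qed.
Let S2 f : S f -> lebesgue_L2 f. Proof. by case. Qed.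

Let mPhi : measurable_fun setT (Phi : bvec R n -> \bar R).
Proof. exact: (measurable_Phi V muH hH psi2). Qed.

Let Phi0 gamma : 0 <= Phi gamma. Proof. exact: (Phi_ge0 V muH hH psi2 gamma). Qed.

Let mG : measurable (G : set bawh). Proof. exact: (measurable_translation_complete hH GE). Qed.

Let energy f := \int[muG]_(x in G) (normc (wavelet psi f x) ^+ 2)%:E.

Let energy_ge0 f : 0 <= energy f.
Proof. by apply: integral_ge0 => x _; rewrite lee_fin sqr_ge0. Qed.

Let mwavelet f : lebesgue_L2 f -> measurable_fun setT (wavelet psi f : bawh -> bC R).
Proof. by move=> [mf _]; exact: cmeasurable_wavelet. Qed.

(** By Tonelli's theorem the finite right-hand side is an integral of the weighted overlaps, so
    almost all of them are finite and [wavelet_energy] applies. *)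
Let energy_finite f g : lebesgue_L2 f -> is_plancherel f g ->
  \int[vol]_gamma ((normc (g gamma) ^+ 2)%:E * Phi gamma) < +oo ->
  energy f = \int[vol]_gamma ((normc (g gamma) ^+ 2)%:E * Phi gamma).
Proof.
move=> f2 fg; have [[mg _] _] := fg.
have mu : measurable_fun setT (fun gamma => normc (g gamma) ^+ 2)%R.
  by apply: measurable_funX; exact: cmeasurable_normc.
rewrite {1}(ge0_integral_Phi V muH hH psi2 mu); last by move=> x; exact: sqr_ge0.
move=> foo; apply: (wavelet_energy hH GE psi2 f2 fg).
have mpsih : measurable_fun setT (plancherel psi : bvec R n -> bC R) by have [[]] := plancherelP psi2.
apply: (ge0_integral_lty_ae (f := fun p : bvec R n * bmx R n n => (fiber_weight V H p)%:E * overlap g (plancherel psi) p.1 p.2)) foo.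
  apply: emeasurable_funM; last exact: measurable_overlap.
  by apply/measurable_EFinP; exact: measurable_fiber_weight.
by move=> p; rewrite mule_ge0 ?lee_fin ?fiber_weight_ge0// overlap_ge0.
Qed.

(* For a transform equal to an indicator function, the overlap integrals are
   bounded by the norm of psi, so no finiteness of the energy is needed. *)
Let test_function B : measurable B -> vol B < +oo -> B `<=` U ->
  exists f, [/\ S f, sqr_integral vol f = vol B & energy f = \int[vol]_(gamma in B) Phi gamma].
Proof.
move=> mB Boo BU.
pose g : bvec R n -> bC R := fun gamma => ((\1_B gamma : R)%:C)%C.
have mg : measurable_fun setT g by apply: cmeasurable_real; exact: measurable_indic.
have gE gamma : (normc (g gamma) ^+ 2)%R = \1_B gamma.
  by rewrite normc_indic !indicE; case: (_ \in _); rewrite ?expr1n ?expr0n.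
have gB : sqr_integral vol g = vol B.
  by rewrite /sqr_integral; under eq_integral do rewrite gE; rewrite integral_indic// setIT.
have g2 : lebesgue_L2 g by apply/cLfun2P; split => //; rewrite gB.
have [f f2 fg] := is_plancherel_onto g2.
exists f; split.
- split => //; apply: filterS (plancherel_ae f2 fg) => gamma -> Ug.
  by rewrite /g indicE memNset// => /BU.
- by rewrite -(is_plancherel_sqr_integral f2 fg).
rewrite [LHS](wavelet_energy hH GE psi2 f2 fg); last first.
  have [psih2 _] := plancherelP psi2; have /cLfun2P[mpsih psihoo] := psih2.
  apply: aeW => -[xi h] /=; have [hh|hh] := pselect (H h); last first.
    by rewrite /fiber_weight !indicE [h \in H]memNset// !mulr0 mul0e ltry.
  have hu : (h : 'M[R]_n) \in unitmx by case: hH => Hu _ _ _ _; exact: Hu.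
  have hu' : (h : 'M[R]_n)^T \in unitmx by rewrite unitmx_tr.
  have mq : measurable_fun setT (fun y => (normc (plancherel psi y) ^+ 2)%:E).
    exact: cmeasurable_sqr_normc.
  have q0 y : 0 <= (normc (plancherel psi y) ^+ 2)%:E by rewrite lee_fin sqr_ge0.
  have hE := ge0_integral_vec_affine (- ((h : 'M[R]_n)^T *m xi)) hu' mq q0.
  apply: lte_mul_pinfty; rewrite ?lee_fin ?fiber_weight_ge0//.
  (* Bounding the indicator by 1 leaves the integral of |psi^|^2 along an invertible affine map. *)
  apply: (@le_lt_trans _ _ (`|\det (h : 'M[R]_n)^T|^-1%:E * sqr_integral vol (plancherel psi))).
    rewrite -hE; apply: ge0_le_integral => //.
    + by move=> y _; rewrite lee_fin mulr_ge0 ?sqr_ge0.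
    + apply/measurable_EFinP; apply: measurable_funM; apply: measurable_funX; apply: cmeasurable_normc => //.
      exact: (measurableT_comp (cmeasurable_dual_action mpsih) (pair2_measurable (xi, h))).
    + exact: (measurableT_comp mq (measurable_bmx_affine _ _)).
    + move=> y _; rewrite gE mulmxBr lee_fin ler_piMl ?sqr_ge0//.
  by rewrite lte_mul_pinfty// lee_fin invr_ge0.
rewrite [RHS]integral_mkcond; apply: eq_integral => gamma _.
by rewrite gE indicE patchE; case: ifPn; rewrite ?mul1e ?mul0e.
Qed.

Let energy_le f M : lebesgue_L2 f ->
  cnorm muG 2%:E (G : set bawh) (wavelet psi f) <= M%:E * L2norm f ->
  energy f <= (M * M)%:E * sqr_integral vol f.
Proof.
move=> f2 fM; have mW := measurable_funTS (D := (G : set bawh)) (mwavelet f2).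
rewrite /energy -(sqr_cnorm2_set muG mG mW) -sqr_cnorm2 EFinM muleACA.
by apply: lee_pmul => //; exact: Lnorm_ge0.
Qed.

Let bounded_Phi : bounded_wavelet (G : set (awh R n)) muG S psi ->
  exists2 C : R, (0 < C)%R & {ae vol, forall gamma, U gamma -> Phi gamma < C%:E}.
Proof.
(* On a set B where Phi is at least M^2 + 1 the test function has energy at least (M^2 + 1) vol(B),
   while boundedness allows only M^2 vol(B); hence vol(B) = 0. *)
move=> [M hM]; exists (M * M + 1)%R; first by rewrite ltr_wpDl// -expr2 sqr_ge0.
pose N := U `&` [set x | (M * M + 1)%:E <= Phi x].
have mN : measurable N by exact: (emeasurable_fun_c_infty mU (measurable_funTS mPhi)).
suff : {ae vol, forall x, ~ N x}.
  apply: filterS => x Nx Ux; rewrite ltNge; apply/negP => h; exact: Nx.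
apply: sigma_finite_negligible => // B mB BN Boo.
have [f [Sf f2 fe]] := test_function mB Boo (fun x Bx => (BN x Bx).1).
have [_ /(energy_le (S2 Sf))] := hM _ Sf.
rewrite fe f2 => h.
have h2 : (M * M + 1)%:E * vol B <= \int[vol]_(gamma in B) Phi gamma.
  rewrite -integral_cst//; apply: ge0_le_integral => //.
  - by move=> x _; rewrite lee_fin addr_ge0// -expr2 sqr_ge0.
  - exact: measurable_funTS.
  - by move=> x /BN[].
have {h h2} := le_trans h2 h.
have Bfin : vol B \is a fin_num by rewrite ge0_fin_numE.
rewrite -(fineK Bfin) -!EFinM lee_fin mulrDl mul1r gerDl => le0.
by congr EFin; apply/eqP; rewrite eq_le le0 fine_ge0.
Qed.

Let wavelet0 x : wavelet psi (fun=> 0%R) x = 0%R :> R[i].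
Proof.
rewrite /wavelet /inner (_ : (fun y => _) = (fun=> 0%R)); last by apply/funext => y; rewrite mul0r.
by rewrite /cintegral /Rintegral !integral0.
Qed.

(** A function whose transform is the indicator of a set on which Phi vanishes has energy 0, hence
    the same wavelet transform as 0; injectivity makes it null, and the set with it. *)
Let injective_Phi : injective_wavelet (G : set (awh R n)) muG S psi ->
  {ae vol, forall gamma, U gamma -> 0 < Phi gamma}.
Proof.
move=> inj; pose N := U `&` [set x | Phi x = 0].
have mN : measurable N.
  have := @measurable_funTS _ _ _ _ U _ mPhi; move/(_ mU _ (emeasurable_set1 0)); exact.
suff : {ae vol, forall x, ~ N x}.
  apply: filterS => x Nx Ux; rewrite lt0e Phi0 andbT.
  by apply/eqP => h; exact: Nx.
apply: sigma_finite_negligible => // B mB BN Boo.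
have [f [Sf f2 fe]] := test_function mB Boo (fun x Bx => (BN x Bx).1).
have e0 : energy f = 0 by rewrite fe; apply: integral0_eq => x /BN[].
have [_ S0 _ _] := clS.
have := (integral_sqr_normc_eq0 muG mG (mwavelet (S2 Sf))).1 e0.
move=> W0; have := inj f (fun=> 0%R) Sf S0.
rewrite -f2 => h; rewrite -(sqr_integral0 vol); apply: ae_eq_sqr_integral.
- by have [] := S2 Sf.
- exact: cmeasurable_cst.
- by apply: h; apply: filterS W0 => x h Gx; rewrite wavelet0; exact: h.
Qed.

Let admissible_Phi : admissible (G : set (awh R n)) muG S psi ->
  exists2 C : R, (0 < C)%R & {ae vol, forall gamma, U gamma -> Phi gamma = C%:E}.
Proof.
move=> [c c0 [A isoA hA]]; exists (normc c ^+ 2)%R.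
  by rewrite exprn_gt0// lt0r normc_ge0 andbT normc_eq0.
have eE f : S f -> energy f = (normc c ^+ 2)%:E * sqr_integral vol f.
  move=> Sf; have [[mA _] An] := isoA _ Sf.
  rewrite -sqr_cnorm2 -[cnorm vol _ _ _]An (sqr_cnorm2_set muG mG mA).
  rewrite -ge0_integralZl_EFin//; last 3 first.
  - by move=> x _; rewrite lee_fin sqr_ge0.
  - apply/measurable_EFinP; apply: measurable_funX; exact: (measurableT_comp (@measurable_normc R) mA).
  - by rewrite sqr_ge0.
  apply: eq_integral => x /set_mem Gx.
  by rewrite hA// normcM exprMn.
pose N := U `&` [set x | Phi x != (normc c ^+ 2)%:E].
have mN : measurable N.
  by apply: emeasurable_neq => //; exact: measurable_funTS.
suff : {ae vol, forall x, ~ N x}.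
  by apply: filterS => x Nx Ux; apply/eqP/negP => h; apply: Nx; split => //; exact/negP.
apply: sigma_finite_negligible => // B mB BN Boo.
(* Testing on subsets of B shows that Phi and the constant have the same integral over each of them,
   so they agree almost everywhere on B; but B lies where they differ. *)
have : ae_eq vol B (cst (normc c ^+ 2)%:E) Phi.
  apply: integral_ae_eq => //.
  - apply/integrableP; split; first exact: measurable_cst.
    rewrite (_ : \int[vol]_(x in B) _ = \int[vol]_(x in B) cst (normc c ^+ 2)%:E x).
      by rewrite integral_cst// lte_mul_pinfty// lee_fin sqr_ge0.
    by apply: eq_integral => x _; rewrite gee0_abs// lee_fin sqr_ge0.
  - exact: measurable_funTS.
  - move=> E EB mE; have Eoo : vol E < +oo.
      by apply: le_lt_trans Boo; apply: le_measure; rewrite ?inE.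
    have [f [Sf f2 fe]] := test_function mE Eoo (fun x Ex => (BN x (EB x Ex)).1).
    by rewrite -fe eE// f2 integral_cst.
move=> BPhi; apply/(negligibleP _ mB).
apply: negligibleS BPhi => x Bx /= /(_ Bx) PE.
by have [_ /eqP] := BN _ Bx; apply.
Qed.

Let sqr_plancherel f : S f -> sqr_integral vol (plancherel f) = sqr_integral vol f.
Proof. by move=> /S2 f2; rewrite (is_plancherel_sqr_integral f2 (plancherelP f2)). Qed.

(** The transform of f vanishes outside U, so a bound on Phi over U controls the whole integral. The
    resulting finiteness is what allows [energy_finite] to be applied. *)
Let energy_le_Phi f (C : R) : (0 <= C)%R -> S f ->
  {ae vol, forall gamma, U gamma -> Phi gamma <= C%:E} ->
  energy f = \int[vol]_gamma ((normc (plancherel f gamma) ^+ 2)%:E * Phi gamma) /\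
  energy f <= C%:E * sqr_integral vol f.
Proof.
move=> C0 Sf PC; have [f2 fU] := Sf; have [[mg _] _] := plancherelP f2.
have mg2 := cmeasurable_sqr_normc mg.
have JC : \int[vol]_gamma ((normc (plancherel f gamma) ^+ 2)%:E * Phi gamma) <= C%:E * sqr_integral vol f.
  rewrite -(sqr_plancherel Sf) -ge0_integralZl_EFin//; last first.
    by move=> x _; rewrite lee_fin sqr_ge0.
  apply: ae_ge0_le_integral => //.
  - by move=> x _; rewrite mule_ge0// lee_fin sqr_ge0.
  - exact: emeasurable_funM.
  - by move=> x _; rewrite mule_ge0// lee_fin ?sqr_ge0.
  - exact: measurable_funeM.
  - apply: filterS2 PC fU => x h1 h2 _; have [Ux|Ux] := pselect (U x).
      by rewrite muleC lee_wpmul2r ?lee_fin ?sqr_ge0// h1.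
    by rewrite h2// normc0 expr0n mul0e mule0.
have Joo : \int[vol]_gamma ((normc (plancherel f gamma) ^+ 2)%:E * Phi gamma) < +oo.
  apply: le_lt_trans JC _; rewrite lte_mul_pinfty//.
  by have /cLfun2P[] := f2.
by rewrite (energy_finite f2 (plancherelP f2) Joo).
Qed.

Let Phi_bounded (C : R) : (0 < C)%R -> {ae vol, forall gamma, U gamma -> Phi gamma <= C%:E} ->
  bounded_wavelet (G : set (awh R n)) muG S psi.
Proof.
move=> C0 PC; exists (Num.sqrt C) => f Sf; have [f2 _] := Sf.
have [_ eC] := energy_le_Phi (ltW C0) Sf PC.
have mW := measurable_funTS (D := (G : set bawh)) (mwavelet f2).
have le : cnorm muG 2%:E (G : set bawh) (wavelet psi f) <= (Num.sqrt C)%:E * L2norm f.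
  rewrite cnorm2_setE// /L2norm cnorm2E.
  have -> : (Num.sqrt C)%:E = C%:E `^ 2^-1 by rewrite poweR_EFin powR12_sqrt// ltW.
  rewrite -poweRM ?sqr_integral_ge0 ?lee_fin ?(ltW C0)//.
  by apply: ge0_le_poweR; [rewrite invr_ge0|exact: energy_ge0|exact: eC].
split=> //; split => //; apply: le_lt_trans le _.
by rewrite lte_mul_pinfty ?lee_fin ?sqrtr_ge0//; case: f2.
Qed.

Let Phi_injective (C : R) : (0 < C)%R ->
  {ae vol, forall gamma, U gamma -> 0 < Phi gamma <= C%:E} ->
  injective_wavelet (G : set (awh R n)) muG S psi.
Proof.
move=> C0 PC f1 f2 S1 S2' W12.
have [_ _ lin _] := clS; pose f := (fun x => -1 * f2 x + f1 x)%R.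
have Sf : S f := lin (-1)%R _ _ S2' S1.
have [fL fU] := Sf.
have W0 : {ae muG, forall x, (G : set bawh) x -> wavelet psi f x = 0%R}.
  have : {ae muG, forall x, (G : set bawh) x -> wavelet psi f1 x = wavelet psi f2 x} by exact: W12.
  apply: filterS => -[[[z x] xi] h] Wx Gx; have /GE[z1 xV hh] := Gx.
  have hu : (h : 'M[R]_n) \in unitmx by case: hH => Hu _ _ _ _; exact: Hu.
  by rewrite /f (waveletD _ _ _ _ hu psi2 (S2 S2') (S2 S1)) mulN1r Wx// addNr.
have e0 : energy f = 0 by exact/(integral_sqr_normc_eq0 muG mG (mwavelet fL)).
have [eJ _] := energy_le_Phi (ltW C0) Sf (filterS (fun x (h : U x -> _) Ux => (andP (h Ux)).2) PC).
have [[mg _] _] := plancherelP fL.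
(* A nonnegative integrand of integral 0 vanishes almost everywhere. On U the factor Phi is
   positive, so the transform of f is 0 there; off U it is 0 by membership in the spectral
   subspace. *)
have J0 : {ae vol, forall x, setT x -> (normc (plancherel f x) ^+ 2)%:E * Phi x = 0}.
  apply/(ae_eq_integral_abs vol measurableT).
    by apply: emeasurable_funM => //; exact: cmeasurable_sqr_normc.
  rewrite -[RHS]e0 eJ; apply: eq_integral => x _.
  by rewrite gee0_abs// mule_ge0// lee_fin sqr_ge0.
have : {ae vol, forall x, f x = 0%R}.
  apply: sqr_integral_eq0; first by case: fL.
  rewrite -(sqr_plancherel Sf) -(sqr_integral0 vol); apply: (ae_eq_sqr_integral mg (cmeasurable_cst 0%R)).
  apply: filterS3 J0 PC fU => x h1 h2 h3; have [Ux|Ux] := pselect (U x); last exact: h3.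
  have /eqP := h1 I; have /andP[p0 _] := h2 Ux.
  rewrite mule_eq0 (gt_eqF p0) orbF eqe sqrf_eq0 => /eqP; exact: eq0_normc.
by apply: filterS => x /eqP; rewrite /f mulN1r addrC subr_eq0 => /eqP.
Qed.

Let Phi_admissible (C : R) : (0 < C)%R ->
  {ae vol, forall gamma, U gamma -> Phi gamma = C%:E} ->
  admissible (G : set (awh R n)) muG S psi.
Proof.
(* The energy is C times the squared norm, so the transform divided by the square root of C is the
   isometry. *)
move=> C0 PC; pose c : R[i] := ((Num.sqrt C)%:C)%C.
have c0 : c != 0%R by rewrite -normc_eq0 normc_real normr_eq0 sqrtr_eq0 -ltNge.
pose c' : R[i] := ((Num.sqrt C)^-1%:C)%C.
have cc' : (c * c' = 1)%R by rewrite -complexrM mulfV// gt_eqF// sqrtr_gt0.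
exists c => //; exists (fun f x => c' * wavelet psi f x)%R; last first.
  by move=> f g _ _; rewrite mulrA cc' mul1r.
move=> f Sf; have [fL fU] := Sf.
have [eJ _] := energy_le_Phi (ltW C0) Sf (filterS (fun x (h : U x -> _) Ux => eq_lee (h Ux)) PC).
have [[mg _] _] := plancherelP fL; have mg2 := cmeasurable_sqr_normc mg.
have eC : energy f = C%:E * sqr_integral vol f.
  rewrite eJ -(sqr_plancherel Sf) -ge0_integralZl_EFin ?ltW//; last first.
    by move=> x _; rewrite lee_fin sqr_ge0.
  apply: ge0_ae_eq_integral => //.
  - exact: emeasurable_funM.
  - exact: measurable_funeM.
  - by move=> x _; rewrite mule_ge0// lee_fin sqr_ge0.
  - by move=> x _; rewrite mule_ge0// lee_fin ?sqr_ge0// ltW.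
  - apply: filterS2 PC fU => x h1 h2 _; have [Ux|Ux] := pselect (U x).
      by rewrite h1// muleC.
    by rewrite h2// normc0 expr0n mul0e mule0.
have mA : measurable_fun setT ((fun x => c' * wavelet psi f x)%R : bawh -> bC R).
  by apply: cmeasurableM; [exact: cmeasurable_cst|exact: mwavelet].
have An : cnorm muG 2%:E (G : set bawh) (fun x => c' * wavelet psi f x)%R = L2norm f.
  rewrite cnorm2_setE//; last exact: measurable_funTS.
  rewrite /L2norm cnorm2E; congr (_ `^ _).
  have -> : sqr_integral vol f = C^-1%:E * energy f.
    by rewrite eC muleA -EFinM mulVf ?gt_eqF// mul1e.
  rewrite /energy -ge0_integralZl_EFin//; last 3 first.
  - by move=> x _; rewrite lee_fin sqr_ge0.
  - by apply: measurable_funTS; apply: cmeasurable_sqr_normc; exact: mwavelet.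
  - by rewrite invr_ge0 ltW.
  apply: eq_integral => x _; rewrite normcM exprMn EFinM; congr (_ * _).
  by rewrite normc_real real_normK ?num_real// exprVn sqr_sqrtr// ltW.
split=> //; split; first exact: measurable_funTS.
by rewrite An; case: fL.
Qed.

Lemma wavelet_admissibility :
  (weakly_admissible (G : set (awh R n)) muG S psi <-> exists2 C : R, (0 < C)%R &
     {ae vol, forall gamma, U gamma -> 0 < Phi gamma < C%:E}) /\
  (admissible (G : set (awh R n)) muG S psi <-> exists2 C : R, (0 < C)%R &
     {ae vol, forall gamma, U gamma -> Phi gamma = C%:E}).
Proof.
split; split.
- move=> [/bounded_Phi[C C0 PC] /injective_Phi P0]; exists C => //.
  by apply: filterS2 P0 PC => x h1 h2 Ux; rewrite h1// h2.
- move=> [C C0 PC].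
  have PC' : {ae vol, forall gamma, U gamma -> 0 < Phi gamma <= C%:E}.
    by apply: filterS PC => x h /h /andP[-> /ltW].
  split; last exact: Phi_injective PC'.
  by apply: (Phi_bounded C0); apply: filterS PC' => x h /h /andP[].
- exact: admissible_Phi.
- by move=> [C C0 PC]; exact: Phi_admissible PC.
Qed.

End admissibility_criterion.

(** The norm of [R[i]] takes values in [R[i]], while the integrals are written with the real-valued
    [normc]. *)
Lemma normr_eq1 (R : realType) (z : R[i]) : `|z| = 1 <-> Normc.normc z = 1.
Proof. by split=> [[]|z1]; last by rewrite normc_def; case: z z1 => a b /= ->. Qed.

Theorem corollary3p2 (R : realType) (n : nat)
    (G : set (awh R n)) (V : {vspace 'cV[R]_n}) (H : set 'M[R]_n)
    (muH : {sigma_finite_measure set (bmx R n n) -> \bar R})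
    (U : set (bvec R n)) (psi : bvec R n -> complex R) :
  translation_complete G V H -> left_haar H muH ->
  measurable U -> dual_invariant V H U ->
  closed_subspace (spectral_subspace U) -> group_invariant G (spectral_subspace U) ->
  spectral_subspace U psi ->
  (weakly_admissible G (haar_awh V muH) (spectral_subspace U) psi <->
     exists2 C : R, 0 < C &
       \forall omega \ae (@lebesgue_vec R n),
         U omega -> (0 < Phi V H muH psi omega < C%:E)%E) /\
  (admissible G (haar_awh V muH) (spectral_subspace U) psi <->
     exists2 C : R, 0 < C &
       \forall omega \ae (@lebesgue_vec R n),
         U omega -> Phi V H muH psi omega = C%:E).
Proof.
move=> [_ hH _ GVH] _ mU _ clS _ psiS.
apply: wavelet_admissibility => // z x xi h.
by rewrite GVH /=; split=> -[z1 xiV hh]; split=> //; apply/normr_eq1.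
Qed.
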